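(* Let $\{\rho_\varepsilon\}_{\varepsilon>0}\subset L^1(\mathbb R^n)$ be a family of non-negative radial functions with $\|\rho_\varepsilon\|_{L^1(\mathbb R^n)}=1$ and $\lim_{\varepsilon\to0^+}\|\rho_\varepsilon\|_{L^1(\mathbb R^n\setminus B_\delta)}=0$ for all $\delta>0$. Let $T\in\mathscr D'(\mathbb R^n;V)$ be a strongly admissible distribution (or let $T\in\mathscr D'(\mathbb R^n;V)$ be arbitrary and assume that the family $\{\rho_\varepsilon\}$ is uniformly compactly supported). Then $$\mathfrak A_{\rho_\varepsilon}T\to\mathcal AT\quad\text{in }\mathscr D'(\mathbb R^n;W)\text{ as }\varepsilon\to0^+.$$ Moreover, the extended limit $\lim_{\varepsilon\to0^+}\|\mathfrak A_{\rho_\varepsilon}T\|_p\in[0,\infty]$ exists for all $1\le p\le\infty$.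
   Context: $V,W$ are finite-dimensional inner product spaces (identified with their duals), $A_1,\dots,A_n\in\mathrm{Hom}(V,W)$, and $\mathcal A=\sum_{i=1}^nA_i\partial_i:\mathscr D'(\mathbb R^n;V)\to\mathscr D'(\mathbb R^n;W)$, with symbol $\mathbb A(\xi)=\sum_iA_i\xi_i$ and formal adjoint $\mathcal A^*=-\sum_iA_i^t\partial_i$. $\mathscr D=C^\infty_c$ and $\mathscr D'$ is its dual; $\mathcal M_b$ is the space of finite vector-valued Borel measures. Functions and measures are identified with distributions. For a nonnegative integrable radial Borel function $\rho(x)=\hat\rho(|x|)$ and $u\in\mathscr D(\mathbb R^n;V)$, $$\mathfrak A_\rho u(x)=\lim_{\delta\to0^+}n\int_{\mathbb R^n\setminus B_\delta}\mathbb A\left(\frac{\xi}{|\xi|}\right)\left[\frac{u(x+\xi)-u(x)}{|\xi|}\right]\rho(\xi)\,d\xi,$$ and $\mathfrak A_\rho^*$ denotes the operator defined in the same way from $\mathcal A^*$. With $\mu_\rho(x)=\int_0^\infty n\hat\rho(r)1_{B_r}(x)\frac{dr}{r}$ one has $\mathfrak A_\rho^*\psi=\mathcal A^*(\mu_\rho\star\psi)$ for $\psi\in\mathscr D(\mathbb R^n;W)$. $T\in\mathscr D'(\mathbb R^n;V)$ is strongly admissible if at least one of the following holds: (a) $T$ has compact support; (b) $T\in L^p(\mathbb R^n;V)$ for some $1\le p\le\infty$ or $T\in\mathcal M_b(\mathbb R^n;V)$; (c) $\mathcal AT\in L^p(\mathbb R^n;W)$ for some $1\le p\le\infty$ or $\mathcal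 AT\in\mathcal M_b(\mathbb R^n;W)$. For $T$ strongly admissible, or for any $T$ if $\rho$ is compactly supported, $\mathfrak A_\rho T\in\mathscr D'(\mathbb R^n;W)$ is defined by $\mathfrak A_\rho T(\psi)=T(\mathfrak A_\rho^*\psi)=T(\mathcal A^*(\mu_\rho\star\psi))$; in case (a) $T$ is paired with a $C^\infty$ function, in case (b) the pairing is integration, and in case (c) it is understood as $(\mathcal AT)(\mu_\rho\star\psi)$ by integration. ''Uniformly compactly supported'' means that all $\rho_\varepsilon$ vanish outside one common compact set. Extended norm: for an $X$-valued distribution $T$ and $1\le p\le\infty$ with Hölder conjugate $q$, $\|T\|_p=\sup\{T[\varphi]:\varphi\in\mathscr D(\mathbb R^n;X),\ \|\varphi\|_{L^q}\le1\}\in[0,\infty]$. *)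

(* Defs.v *)
From HB Require Import structures.
From mathcomp Require Import all_boot all_order all_algebra.
From mathcomp Require Import all_classical all_reals all_analysis measurable_realfun.
Set Implicit Arguments. Unset Strict Implicit. Unset Printing Implicit Defensive.
Import Order.TTheory GRing.Theory Num.Theory.
Import numFieldNormedType.Exports.
Local Open Scope classical_set_scope.
Local Open Scope ring_scope.

Section borel.
Context (R : realType) (n : nat).
(* The Borel sigma-algebra of R^n. *)
HB.instance Definition _ := @isMeasurable.Build (sigma_display (open : set (set 'rV[R]_n)))
  'rV[R]_n <<s (open : set (set 'rV[R]_n)) >> (@sigma_algebra0 _ setT _)
  (@sigma_algebraC _ _) (@sigma_algebra_bigcup _ setT _).
End borel.

Section rV.
Context (R : realType).

Lemma open_measurable_rV n (U : set 'rV[R]_n) : open U -> measurable U.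
Proof. exact: sub_sigma_algebra. Qed.

Lemma measurable_coord_rV n (i : 'I_n) :
  measurable_fun setT (fun x : 'rV[R]_n => x 0 i).
Proof.
apply: (measurability _ (RGenOInfty.measurableE R)).

move=> _ [_ [a ->] <-].
rewrite setTI; apply: open_measurable_rV.
apply: open_comp; first by move=> x _; exact: coord_continuous.
exact: interval_open.
Qed.

Lemma open_bigcup_ratball n (U : set 'rV[R]_n) : open U ->
  exists F : ('rV[rat]_n * nat)%type -> bool,
  U = \bigcup_(q in [set q | F q]) ball (map_mx ratr q.1 : 'rV[R]_n) (q.2.+1%:R^-1).
Proof.
move=> oU.
exists (fun q => `[< ball (map_mx ratr q.1 : 'rV[R]_n) (q.2.+1%:R^-1) `<=` U >]).
apply/seteqP; split; last by move=> x [q /= /asboolP]; apply.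
move=> x Ux.
have /nbhs_ballP[e /= e0 xeU] : nbhs x U by exact: open_nbhs_nbhs.
have [k ke] : exists k, k.+1%:R^-1 < e / 2.
  have e20 : 0 < e / 2 by rewrite divr_gt0.
  exists (Num.truncn (e / 2)^-1).
  rewrite invf_plt ?posrE ?ltr0n //; exact: Num.Theory.truncnS_gt.
have /choice[q hq] : forall i, exists q : rat, `|x 0 i - ratr q| < k.+1%:R^-1.
  move=> i.
  have : x 0 i - k.+1%:R^-1 < x 0 i + k.+1%:R^-1.
    by rewrite ltrBlDr -addrA ltrDl addr_gt0 ?invr_gt0 ?ltr0n.
  move=> /rat_in_itvoo[q]; rewrite in_itv /= => /andP[h1 h2]; exists q.
  by rewrite ltr_distlC ltrBlDr -ltrBlDr h1 /= h2.
exists (\row_i q i, k) => /=; last first.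
  split; first by rewrite invr_gt0 ltr0n.
  move=> i j; rewrite !mxE /ball /= distrC (ord1 i); exact: hq.
apply/asboolP => y [_ qy]; apply: xeU; split=> // i j.
have := qy i j; rewrite !mxE /ball /= (ord1 i) => h.
rewrite (le_lt_trans (ler_distD (ratr (q j)) _ _))//.
by rewrite (splitr e) ltrD // (lt_trans _ ke).
Qed.

Lemma measurable_fun_rV d (T : measurableType d) n (f : T -> 'rV[R]_n) :
  (forall i, measurable_fun setT (fun t => f t 0 i)) -> measurable_fun setT f.
Proof.
move=> mf; apply: (measurability (open : set (set 'rV[R]_n))) => //.
move=> _ [U oU <-]; rewrite setTI.
have [F ->] := open_bigcup_ratball oU.
rewrite preimage_bigcup bigcup_mkcond.
apply: countable_bigcupT_measurable; first exact: countableP.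
move=> q; case: ifPn => // _.
have -> : f @^-1` ball (map_mx ratr q.1 : 'rV[R]_n) (q.2.+1%:R^-1) =
  \bigcap_(i in [set: 'I_n])
    ((fun t => f t 0 i) @^-1` ball (ratr (q.1 0 i) : R) (q.2.+1%:R^-1)).
  apply/seteqP; split => t /=; first by move=> [_ h] i _ /=; have := h 0 i; rewrite mxE.
  move=> h; split; first by rewrite invr_gt0 ltr0n.
  by move=> i j; rewrite (ord1 i) mxE; exact: h.
apply: fin_bigcap_measurable => // i _.
rewrite -[X in measurable X]setTI; apply: mf => //; exact: measurable_ball.
Qed.

Definition cons_rV n (p : R * 'rV[R]_n) : 'rV[R]_n.+1 :=
  \row_i oapp (p.2 0) p.1 (unlift ord0 i).

Lemma measurable_cons_rV n : measurable_fun setT (@cons_rV n).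
Proof.
apply: measurable_fun_rV => i.
case: (unliftP ord0 i) => [j ->|->].
  rewrite (_ : (fun _ => _) = (fun x : 'rV[R]_n => x 0 j) \o snd).
    apply: measurableT_comp; [exact: measurable_coord_rV|exact: measurable_snd].
  by apply/funext => p /=; rewrite mxE liftK.
rewrite (_ : (fun _ => _) = fst); first exact: measurable_fst.
by apply/funext => p /=; rewrite mxE unlift_none.
Qed.

Section step.
Context (n : nat) (m : {sigma_finite_measure set 'rV[R]_n -> \bar R}).

Definition cons_measure : set 'rV[R]_n.+1 -> \bar R :=
  pushforward (@lebesgue_measure R \x m)%E (@cons_rV n).

Let cons_measure0 : cons_measure set0 = 0%E.
Proof. by rewrite /cons_measure /pushforward preimage_set0 measure0. Qed.

Let cons_measure_ge0 X : (0 <= cons_measure X)%E.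
Proof. by rewrite /cons_measure /pushforward measure_ge0. Qed.

Let cons_measure_sigma_additive : semi_sigma_additive cons_measure.
Proof.
pose mu := (@lebesgue_measure R \x m)%E.
have := @measure_semi_sigma_additive _ _ _
  (measure_function_pushforward__canonical__measure_function_Measure
    mu (@measurable_cons_rV n)).
exact.
Qed.

HB.instance Definition _ := isMeasure.Build _ _ _ cons_measure
  cons_measure0 cons_measure_ge0 cons_measure_sigma_additive.

Let cons_measure_sigma_finite : sigma_finite setT cons_measure.
Proof.
pose g (x : 'rV[R]_n.+1) : R * 'rV[R]_n := (x 0 ord0, \row_i x 0 (lift ord0 i)).
have gK : cancel (@cons_rV n) g.
  case=> a y; rewrite /g /cons_rV !mxE unlift_none /=; congr pair.
  by apply/rowP => i; rewrite !mxE liftK.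
have mg : measurable_fun setT g.
  apply/measurable_fun_pairP; split; first exact: measurable_coord_rV.
  apply: measurable_fun_rV => i.
  rewrite (_ : (fun _ => _) = (fun x : 'rV[R]_n.+1 => x 0 (lift ord0 i))).
    exact: measurable_coord_rV.
  by apply/funext => x /=; rewrite mxE.
have /sigma_finiteP[F [TF ndF mF]] := sigma_finiteT (@lebesgue_measure R).
have /sigma_finiteP[G [TG ndG mG]] := sigma_finiteT m.
exists (fun k => g @^-1` (F k `*` G k)).
  rewrite -preimage_bigcup (_ : \bigcup_i _ = setT) ?preimage_setT //.
  rewrite -setXTT TF TG predeqE => -[x y]; split.
    by move=> [k _ [/= ? ?]]; split; exists k.
  move=> [/= [k _ Fkx] [l _ Gly]]; exists (maxn k l) => //; split.
  - by move: x Fkx; exact/subsetPset/ndF/leq_maxl.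
  - by move: y Gly; exact/subsetPset/ndG/leq_maxr.
move=> k; have [mFk Fk] := mF k; have [mGk Gk] := mG k; split.
  by rewrite -[X in measurable X]setTI; apply: mg => //; exact: measurableX.
rewrite /cons_measure /pushforward -comp_preimage.
rewrite (_ : g \o _ = id); last by rewrite funeqE => x /=; exact: gK.
by rewrite preimage_id product_measure1E// lte_mul_pinfty// ge0_fin_numE.
Qed.

HB.instance Definition _ := Measure_isSigmaFinite.Build _ _ _ cons_measure
  cons_measure_sigma_finite.

End step.

Fixpoint leb n : {sigma_finite_measure set 'rV[R]_n -> \bar R} :=
  match n with
  | 0 => dirac (0 : 'rV[R]_0)
  | n'.+1 => cons_measure (leb n')
  end.

Lemma leb_box n (B : 'I_n -> set R) : (forall i, measurable (B i)) ->
  leb n [set x | forall i, B i (x 0 i)] = (\prod_(i < n) lebesgue_measure (B i))%E.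
Proof.
elim: n B => [|n IH] B mB /=.
  rewrite big_ord0 diracE mem_set//=; by case.
rewrite big_ord_recl -IH // /cons_measure /pushforward.
have mB' : measurable [set x : 'rV[R]_n | forall i, B (lift ord0 i) (x 0 i)].
  have -> : [set x : 'rV[R]_n | forall i, B (lift ord0 i) (x 0 i)] =
      \bigcap_(i in [set: 'I_n]) ((fun x => x 0 i) @^-1` B (lift ord0 i)).
    by apply/seteqP; split => x /= h i; [move=> _|]; exact: h.
  apply: fin_bigcap_measurable => // i _.
  by rewrite -[X in measurable X]setTI; exact: measurable_coord_rV.
rewrite -product_measure1E //.
apply: congr1; apply/seteqP; split => [[a x] h|[a x] [Ba Bx] i] /=.
  split; first by have := h ord0; rewrite mxE unlift_none.
  by move=> i; have := h (lift ord0 i); rewrite mxE liftK.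
rewrite mxE; case: (unliftP ord0 i) => [j ->|->] //=; exact: Bx.
exact: mB.
Qed.
End rV.

Section euclidean_norm.
Context (R : realType).

(* The norm `|x| on 'rV[R]_n is the sup norm. *)
Definition enorm n (x : 'rV[R]_n) : R := Num.sqrt (\sum_i x 0 i ^+ 2).

Definition ipnorm (V : vectType R) (ip : {dot V for idfun}) (v : V) : R :=
  Num.sqrt (ip v v).

End euclidean_norm.

Section adjoint.
Context (R : realType) (V W : vectType R).
Context (ipV : {dot V for (@idfun R)}) (ipW : {dot W for (@idfun R)}).

Definition is_adjoint (f : 'Hom(V, W)) (g : 'Hom(W, V)) :=
  forall v w, ipW (f v) w = ipV v (g w).

(* Existence is adjointP; uniqueness holds as ipV is positive definite. *)
Definition adjoint (f : 'Hom(V, W)) : 'Hom(W, V) :=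
  xget 0 [set g | is_adjoint f g].

Lemma adjointP f : is_adjoint f (adjoint f).
Proof.
suff [g fg] : exists g, is_adjoint f g.
  by rewrite /adjoint; case: xgetP => // /(_ g) /=; case.
pose e := vbasis {:V}.
pose J (z : V) : 'rV[R]_(\dim {:V}) := \row_k ipV e`_k z.
pose L (w : W) : 'rV[R]_(\dim {:V}) := \row_k ipW (f e`_k) w.
have linJ : linear J.
  by move=> a x y; apply/rowP => k; rewrite !mxE linearDr linearZr_LR.
have linL : linear L.
  by move=> a x y; apply/rowP => k; rewrite !mxE linearDr linearZr_LR.
pose J' := HB.pack_for {linear V -> 'rV[R]_(\dim {:V})} J
  (GRing.isLinear.Build _ _ _ _ J linJ).
pose L' := HB.pack_for {linear W -> 'rV[R]_(\dim {:V})} L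
  (GRing.isLinear.Build _ _ _ _ L linL).
have Jv (v z : V) : ipV v z = \sum_k coord e k v * J z 0 k.
  rewrite {1}(coord_vbasis (memvf v)) linear_sumlz /=.
  by apply: eq_bigr => k _; rewrite linearZl_LR mxE.
have ker0 : lker (linfun J') == 0%VS.
  apply/eqP/vspaceP => z; rewrite memv_ker lfunE /= memv0.
  apply/idP/idP => [/eqP Jz|/eqP ->]; last by rewrite -[J 0]/(J' 0) linear0.
  apply/negPn/negP => /(@neq0_dnorm_gt0 _ _ _ ipV).
  by rewrite Jv Jz big1 ?ltxx // => k _; rewrite mxE mulr0.
have img : limg (linfun J') = fullv.
  apply/eqP; rewrite eqEdim subvf /= dimvf /dim /= mul1n.
  by rewrite limg_dim_eq // (eqP ker0) capv0.
exists ((linfun J')^-1 \o linfun L')%VF => v w.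
rewrite Jv comp_lfunE lfunE /=.
have -> : J (((linfun J')^-1)%VF (L w)) = L w.
  have : L w \in limg (linfun J') by rewrite img memvf.
  by move=> /limg_lfunVK; rewrite lfunE.
rewrite {1}(coord_vbasis (memvf v)) linear_sum linear_sumlz /=.
by apply: eq_bigr => k _; rewrite linearZ /= linearZl_LR mxE.
Qed.
End adjoint.

Section vector_valued.
Context (R : realType) (n : nat) (V : vectType R).
Implicit Types (u : 'rV[R]_n -> V) (f : 'rV[R]_n -> R).

(* Calculus for functions with values in V is done in the coordinates of the
   basis vbasis {:V}. *)
Definition crd (k : 'I_(\dim {:V})) (v : V) : R := coord (vbasis {:V}) k v.

Definition from_crd (c : 'I_(\dim {:V}) -> R) : V :=
  \sum_k c k *: (vbasis {:V})`_k.

Definition pderiv (i : 'I_n) f : 'rV[R]_n -> R :=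
  fun x => 'D_(delta_mx 0 i) f x.

Definition pderivs (s : seq 'I_n) f : 'rV[R]_n -> R := foldr pderiv f s.

Definition smooth f := forall s : seq 'I_n,
  continuous (pderivs s f) /\
  forall (i : 'I_n) (x : 'rV[R]_n), derivable (pderivs s f) x (delta_mx 0 i).

Definition vpderiv (i : 'I_n) u : 'rV[R]_n -> V :=
  fun x => from_crd (fun k => pderiv i (crd k \o u) x).

Definition vsmooth u := forall k, smooth (crd k \o u).

Definition vint (D : set 'rV[R]_n) u : V :=
  from_crd (fun k => \int[leb R n]_(x in D) crd k (u x)).

Definition supp u : set 'rV[R]_n := closure [set x | u x != 0].

Definition test u := vsmooth u /\ compact (supp u).

(* An element of D'(R^n; V) is a functional whose values outside of the test
   functions are irrelevant. Continuity for the inductive limit topology is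
   stated as an estimate by finitely many derivatives on every compact set. *)
Definition schwartz_distribution (T : ('rV[R]_n -> V) -> R) :=
  (forall (a : R) u v, test u -> test v ->
    T (fun x => a *: u x + v x) = a * T u + T v) /\
  (forall K : set 'rV[R]_n, compact K -> exists (C : R) (N : nat),
    forall u, test u -> supp u `<=` K -> forall M : R,
    (forall k (s : seq 'I_n) x,
      (size s <= N)%N -> `|pderivs s (crd k \o u) x| <= M) ->
    `|T u| <= C * M).

Definition dcvg (I : Type) (F : set_system I) (S : I -> ('rV[R]_n -> V) -> R)
    (T : ('rV[R]_n -> V) -> R) :=
  forall u, test u -> S i u @[i --> F] --> T u.

(* The support of T: the complement of the largest open set where T vanishes. *)
Definition dsupp (T : ('rV[R]_n -> V) -> R) : set 'rV[R]_n :=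
  ~` \bigcup_(U in [set U | open U /\
       forall u, test u -> supp u `<=` U -> T u = 0]) U.

Definition Lp_fun (ip : {dot V for (@idfun R)}) (p : \bar R) u :=
  (forall k, measurable_fun setT (crd k \o u)) /\
  ('N[leb R n]_p[EFin \o ipnorm ip \o u] < +oo)%E.

(* The extended norm, defined for all functionals T by duality. *)
Definition dnorm (ip : {dot V for (@idfun R)}) (p : \bar R)
    (T : ('rV[R]_n -> V) -> R) : \bar R :=
  ereal_sup [set (T u)%:E | u in [set u | test u /\
    ('N[leb R n]_(hoelder_conjugate p)[EFin \o ipnorm ip \o u] <= 1)%E]].

End vector_valued.

Section operators.
Context (R : realType) (n : nat) (V W : vectType R).
Context (ipV : {dot V for (@idfun R)}) (ipW : {dot W for (@idfun R)}).

Definition first_order (B : 'I_n -> 'Hom(V, W)) (u : 'rV[R]_n -> V) :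
    'rV[R]_n -> W :=
  fun x => \sum_i B i (vpderiv i u x).

Definition symbol (B : 'I_n -> 'Hom(V, W)) (xi : 'rV[R]_n) : 'Hom(V, W) :=
  \sum_i xi 0 i *: B i.

Definition formal_adjoint (A : 'I_n -> 'Hom(V, W)) : 'I_n -> 'Hom(W, V) :=
  fun i => - adjoint ipV ipW (A i).

(* Here and below, rhat is the radial profile of x |-> rhat (enorm x). *)
Definition nonlocal (B : 'I_n -> 'Hom(V, W)) (rhat : R -> R)
    (u : 'rV[R]_n -> V) : 'rV[R]_n -> W := fun x =>
  from_crd (fun k => lim (crd k
    (n%:R *: vint [set xi : 'rV[R]_n | delta <= enorm xi]
       (fun xi => rhat (enorm xi) *:
          symbol B ((enorm xi)^-1 *: xi) ((enorm xi)^-1 *: (u (x + xi) - u x))))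
    @[delta --> 0^'+])).

End operators.

Section convolution.
Context (R : realType) (n : nat) (V : vectType R).

(* mu_rho rhat x is 0 where the integral diverges; for an integrable kernel this
   can only happen at x = 0. *)
Definition mu_rho (rhat : R -> R) (x : 'rV[R]_n) : R :=
  \int[lebesgue_measure]_(r in `]0, +oo[)
    (n%:R * rhat r * \1_[set y : 'rV[R]_n | enorm y < r] x / r).

Definition conv (f : 'rV[R]_n -> R) (u : 'rV[R]_n -> V) : 'rV[R]_n -> V :=
  fun x => vint setT (fun y => f y *: u (x - y)).

End convolution.

Section integration_functionals.
Context (R : realType) (n : nat) (V : vectType R).
Context (ip : {dot V for (@idfun R)}).

Definition charge_integral d (X : measurableType d)
    (nu : {charge set X -> \bar R}) (f : X -> R) : R :=
  let P := cid (Hahn_decomposition nu) in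
  let N := cid (projT2 P) in
  \int[jordan_pos (projT2 N)]_x f x - \int[jordan_neg (projT2 N)]_x f x.

Definition fun_functional (f : 'rV[R]_n -> V) : ('rV[R]_n -> V) -> R :=
  fun u => \int[leb R n]_x ip (f x) (u x).

(* A finite V-valued Borel measure is given by its coordinates in the basis
   vbasis {:V}, which are finite signed measures. *)
Definition measure_functional
    (nu : 'I_(\dim {:V}) -> {charge set 'rV[R]_n -> \bar R}) :
    ('rV[R]_n -> V) -> R :=
  fun u => \sum_k charge_integral (nu k) (fun x => ip (vbasis {:V})`_k (u x)).

Definition integration_functional (E : ('rV[R]_n -> V) -> R) :=
  (exists p : \bar R, (1 <= p)%E /\
     exists2 f, Lp_fun ip p f & E = fun_functional f) \/
  (exists nu, E = measure_functional nu).

Definition represents (E T : ('rV[R]_n -> V) -> R) :=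
  forall u, test u -> T u = E u.

Definition Lp_or_measure (T : ('rV[R]_n -> V) -> R) :=
  exists2 E, integration_functional E & represents E T.

Definition cutoff (K : set 'rV[R]_n) (chi : 'rV[R]_n -> R) :=
  [/\ smooth chi, compact (closure [set x | chi x != 0]) &
    exists U : set 'rV[R]_n, [/\ open U, K `<=` U & forall x, U x -> chi x = 1]].

End integration_functionals.

Section frakA.
Context (R : realType) (n : nat) (V W : vectType R).
Context (ipV : {dot V for (@idfun R)}) (ipW : {dot W for (@idfun R)}).
Context (A : 'I_n -> 'Hom(V, W)).
Implicit Types (T : ('rV[R]_n -> V) -> R) (rhat : R -> R).

Definition distr_op T : ('rV[R]_n -> W) -> R :=
  fun psi => T (first_order (formal_adjoint ipV ipW A) psi).

Definition strongly_admissible T :=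
  [\/ compact (dsupp T), Lp_or_measure ipV T | Lp_or_measure ipW (distr_op T)].

Definition radial_compact_support rhat :=
  exists2 K : set 'rV[R]_n, compact K & forall x, ~ K x -> rhat (enorm x) = 0.

Definition frakA_star rhat : ('rV[R]_n -> W) -> 'rV[R]_n -> V :=
  nonlocal (formal_adjoint ipV ipW A) rhat.

(* S is a functional given by one of the prescriptions for frakA_rho T: the
   plain pairing for a compactly supported kernel, the pairing of a compactly
   supported T with a smooth function through a cutoff, integration against T,
   or integration against A T. Where several apply, they agree on test
   functions. *)
Definition is_frakA rhat T (S : ('rV[R]_n -> W) -> R) :=
  [\/ radial_compact_support rhat /\
        (forall psi, test psi -> S psi = T (frakA_star rhat psi)),
      compact (dsupp T) /\
        (exists2 chi, cutoff (dsupp T) chi & forall psi, test psi ->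
           S psi = T (fun x => chi x *: frakA_star rhat psi x)),
      (exists E, [/\ integration_functional ipV E, represents E T &
         forall psi, test psi -> S psi = E (frakA_star rhat psi)]) |
      (exists E, [/\ integration_functional ipW E, represents E (distr_op T) &
         forall psi, test psi -> S psi = E (conv (mu_rho rhat) psi)])].

Definition frakA rhat T : ('rV[R]_n -> W) -> R :=
  xget (fun=> 0) [set S | is_frakA rhat T S].

End frakA.

(* Main.v *)
Require Import Defs.
From HB Require Import structures.
From mathcomp Require Import all_boot all_order all_algebra.
From mathcomp Require Import all_classical all_reals all_analysis measurable_realfun.
From mathcomp Require Import ring lra.
Set Implicit Arguments. Unset Strict Implicit. Unset Printing Implicit Defensive.
Import Order.TTheory GRing.Theory Num.Theory.
Import numFieldNormedType.Exports.
Local Open Scope classical_set_scope.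
Local Open Scope ring_scope.

(** Put phi = A^* psi, with A^* the formal adjoint, and mu = mu_rho. Everything rests
    on one formula: whichever prescription defines frakA_rho T,

      (frakA_rho T) psi = \int mu(y) (A T)(psi(. - y)) dy,

    where mu >= 0 and mu has the same mass 1 as rho. So frakA_rho T is an average of
    translates of A T, and the family mu_eps is an approximation of the identity
    because rho_eps is one: the mass of mu beyond distance d is at most that of rho.
    The function y |-> (A T)(psi(. - y)) is continuous, and it is bounded where the
    kernels live, because T is strongly admissible or the kernels share a compact
    support. The averages therefore converge to its value (A T) psi at y = 0.

    For the norms, translations preserve the L^q norm of psi, so an average of
    translates has ||frakA_rho T||_p <= ||A T||_p. A supremum of functionals
    psi |-> S psi is lower semicontinuous under convergence of distributions, so the
    norms converge, and their limit is ||A T||_p.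

    The formula has two ingredients. The first is the pointwise identity
    frakA_rho^* psi = mu * phi (nonlocal_conv), an integration by parts with the
    potential mu, whose gradient is - n rho(y) y / |y|^2. As rho is only measurable, it is
    proved on each line parallel to an axis by Tonelli's theorem and the substitution
    r = sqrt (c^2 + s^2) (line_identity), first for increasing functions
    (ge0_kernel_identity) and then in general (kernel_identity). The same identity
    for linear functions shows that mu and rho have the same mass (integral_kern).

    The second ingredient is that T may be applied under the integral sign of
    mu * phi. If T or mu has compact support, mu is cut into pieces of small diameter
    and the seminorm estimate of T is used on each (cutoff_dist_conv); if T or A T is a
    function or a measure, this is Fubini (averaging_integration). *)

(** * Smooth functions and their iterated partial derivatives *)

Section derive_pointwise.
Context (R : realType) (V : normedModType R).
Implicit Types (f g : V -> R) (x v : V).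

Lemma derivableD_fun f g x v : derivable f x v -> derivable g x v ->
  derivable (fun y => f y + g y) x v.
Proof. exact: derivableD. Qed.

Lemma derivableM_fun f g x v : derivable f x v -> derivable g x v ->
  derivable (fun y => f y * g y) x v.
Proof. exact: derivableM. Qed.

Lemma deriveD_fun f g x v : derivable f x v -> derivable g x v ->
  'D_v (fun y => f y + g y) x = 'D_v f x + 'D_v g x.
Proof. exact: deriveD. Qed.

Lemma deriveM_fun f g x v : derivable f x v -> derivable g x v ->
  'D_v (fun y => f y * g y) x = 'D_v f x * g x + f x * 'D_v g x.
Proof.
move=> df dg; apply: etrans (deriveM df dg) _.
by rewrite addrC; congr (_ + _); exact: mulrC.
Qed.

Lemma deriveV_fun f x v : f x != 0 -> derivable f x v ->
  'D_v (fun y => (f y)^-1) x = (-1 * 'D_v f x) * ((f x)^-1 * (f x)^-1).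
Proof.
move=> f0 df; apply: etrans (deriveV f0 df) _.
by rewrite /GRing.scale /= mulN1r !mulNr expr2 invfM mulrC.
Qed.

Lemma continuousD_fun f g : continuous f -> continuous g ->
  continuous (fun y => f y + g y).
Proof. by move=> cf cg x; apply: continuousD; [exact: cf|exact: cg]. Qed.

Lemma continuousM_fun f g : continuous f -> continuous g ->
  continuous (fun y => f y * g y).
Proof. by move=> cf cg x; apply: continuousM; [exact: cf|exact: cg]. Qed.

Lemma continuousV_fun f : (forall x, f x != 0) -> continuous f ->
  continuous (fun y => (f y)^-1).
Proof. by move=> f0 cf x; apply: continuousV; [exact: f0|exact: cf]. Qed.

Lemma continuous_shift_fun f a : continuous f -> continuous (fun y => f (y + a)).
Proof.
move=> cf x; apply: (@continuous_comp _ _ _ (fun z => z + a) f); last exact: cf.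
by apply: continuousD; [exact: cvg_id|exact: cst_continuous].
Qed.

Lemma derivable_shift f x a v : derivable f (x + a) v ->
  derivable (fun z => f (z + a)) x v.
Proof.
move=> df; rewrite /derivable.
rewrite [X in X @ _](_ : _ =
    fun h => h^-1 *: ((f \o shift (x + a)) (h *: v) - f (x + a))).
  exact: df.
by apply/funext => h; congr (_ *: (f _ - _)); rewrite /= addrA.
Qed.

Lemma derive_shift_fun f x a v : 'D_v (fun z => f (z + a)) x = 'D_v f (x + a).
Proof.
rewrite /derive.
rewrite [X in lim (X @ _)](_ : _ =
    fun h => h^-1 *: ((f \o shift (x + a)) (h *: v) - f (x + a))) //.
by apply/funext => h; congr (_ *: (f _ - _)); rewrite /= addrA.
Qed.

End derive_pointwise.

Section partial_derivatives.
Context (R : realType) (n : nat).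
Implicit Types (f g : 'rV[R]_n -> R) (i : 'I_n) (x : 'rV[R]_n) (s : seq 'I_n).

Local Notation e_ i := (delta_mx 0 i : 'rV[R]_n).

Lemma pderivs_rcons s i f : pderivs (rcons s i) f = pderivs s (pderiv i f).
Proof. by rewrite /pderivs foldr_rcons. Qed.

Lemma pderivsE i s f : pderivs (i :: s) f = pderiv i (pderivs s f).
Proof. by []. Qed.

(** By recursion on the order, where smooth quantifies over all iterated
    derivatives at once: this is what makes products and inverses inductive. *)
Fixpoint Cn (N : nat) f : Prop :=
  if N is N'.+1 then
    continuous f /\ forall i, (forall x, derivable f x (e_ i)) /\ Cn N' (pderiv i f)
  else continuous f.

Lemma CnW N f : Cn N.+1 f -> Cn N f.
Proof.
elim: N f => [|N IH] f; first by case.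
move=> [cf df]; split => // i; have [dfi /IH Cfi] := df i; by split.
Qed.

Lemma smoothP f : smooth f <-> forall N, Cn N f.
Proof.
split => [sf N|Cf s].
  elim: N f sf => [|N IH] f sf /=; first by have [] := sf [::].
  have [cf df] := sf [::]; split => // i; split; first exact: (df i).
  by apply: IH => s; have := sf (rcons s i); rewrite pderivs_rcons.
elim/last_ind: s f Cf => [|s i IH] f Cf.
  by have [cf df] := Cf 1%N; split => // i x; have [] := df i.
rewrite pderivs_rcons; apply: IH => N.
by have [_ /(_ i)[]] := Cf N.+1.
Qed.

Lemma smooth_continuous f : smooth f -> continuous f.
Proof. by move=> /(_ [::])[]. Qed.

Lemma smooth_derivable f x i : smooth f -> derivable f x (e_ i).
Proof. by move=> /(_ [::])[_]; exact. Qed.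

Lemma smooth_pderiv i f : smooth f -> smooth (pderiv i f).
Proof. by move=> sf s; have := sf (rcons s i); rewrite pderivs_rcons. Qed.

Lemma smooth_pderivs s f : smooth f -> smooth (pderivs s f).
Proof. by move=> sf; elim: s => [//|i s IH]; rewrite pderivsE; exact: smooth_pderiv. Qed.

Lemma pderivD i f g : (forall x, derivable f x (e_ i)) ->
  (forall x, derivable g x (e_ i)) ->
  pderiv i (fun x => f x + g x) = fun x => pderiv i f x + pderiv i g x.
Proof.
by move=> df dg; apply/funext => x; apply: deriveD_fun; [exact: df|exact: dg].
Qed.

Lemma pderivM i f g : (forall x, derivable f x (e_ i)) ->
  (forall x, derivable g x (e_ i)) ->
  pderiv i (fun x => f x * g x) = fun x => pderiv i f x * g x + f x * pderiv i g x.
Proof.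
by move=> df dg; apply/funext => x; apply: deriveM_fun; [exact: df|exact: dg].
Qed.

Lemma pderiv_cst i (a : R) : pderiv i (fun=> a) = fun=> 0.
Proof. by apply/funext => x; exact: derive_cst. Qed.

Lemma Cn_cst N (a : R) : Cn N (fun=> a).
Proof.
elim: N a => [|N IH] a; first exact: cst_continuous.
split; first exact: cst_continuous.
move=> i; split; first by move=> x; exact: derivable_cst.
by rewrite pderiv_cst; exact: IH.
Qed.

Lemma CnD N f g : Cn N f -> Cn N g -> Cn N (fun x => f x + g x).
Proof.
elim: N f g => [|N IH] f g; first exact: continuousD_fun.
move=> [cf df] [cg dg]; split; first exact: continuousD_fun.
move=> i; have [dfi Cfi] := df i; have [dgi Cgi] := dg i; split.
  by move=> x; apply: derivableD_fun; [exact: dfi|exact: dgi].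
rewrite (pderivD dfi dgi); exact: IH.
Qed.

Lemma CnM N f g : Cn N f -> Cn N g -> Cn N (fun x => f x * g x).
Proof.
elim: N f g => [|N IH] f g; first exact: continuousM_fun.
move=> Cf Cg; move: (Cf) (Cg) => [cf df] [cg dg]; split.
  exact: continuousM_fun.
move=> i; have [dfi Cfi] := df i; have [dgi Cgi] := dg i; split.
  by move=> x; apply: derivableM_fun; [exact: dfi|exact: dgi].
rewrite (pderivM dfi dgi); apply: CnD; apply: IH.
- exact: Cfi.
- exact: CnW.
- exact: CnW.
- exact: Cgi.
Qed.

Lemma CnV N f : (forall x, f x != 0) -> Cn N f -> Cn N (fun x => (f x)^-1).
Proof.
move=> f0; elim: N => [|N IH]; first exact: continuousV_fun.
move=> Cf; move: (Cf) => [cf df]; split; first exact: continuousV_fun.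
move=> i; have [dfi Cfi] := df i; split.
  by move=> x; apply: derivableV; [exact: f0|exact: dfi].
have -> : pderiv i (fun x => (f x)^-1) =
    (fun x => (-1 * pderiv i f x) * ((f x)^-1 * (f x)^-1)).
  by apply/funext => x; apply: deriveV_fun; [exact: f0|exact: dfi].
have CV : Cn N (fun x => (f x)^-1) by apply: IH; exact: CnW.
apply: CnM; first by apply: CnM; [exact: Cn_cst|exact: Cfi].
exact: CnM.
Qed.

Lemma smooth_cst (a : R) : smooth (fun _ : 'rV[R]_n => a).
Proof. by apply/smoothP => N; exact: Cn_cst. Qed.

Lemma smoothD f g : smooth f -> smooth g -> smooth (fun x => f x + g x).
Proof. by move=> /smoothP Cf /smoothP Cg; apply/smoothP => N; exact: CnD. Qed.

Lemma smoothM f g : smooth f -> smooth g -> smooth (fun x => f x * g x).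
Proof. by move=> /smoothP Cf /smoothP Cg; apply/smoothP => N; exact: CnM. Qed.

Lemma smoothZ (a : R) f : smooth f -> smooth (fun x => a * f x).
Proof. by apply: smoothM; exact: smooth_cst. Qed.

Lemma smoothB f g : smooth f -> smooth g -> smooth (fun x => f x - g x).
Proof.
move=> sf sg; rewrite [X in smooth X](_ : _ = fun x => f x + (-1) * g x).
  by exact: (smoothD sf (smoothZ _ sg)).
by apply/funext => x; rewrite mulN1r.
Qed.

Lemma smoothV f : (forall x, f x != 0) -> smooth f -> smooth (fun x => (f x)^-1).
Proof. by move=> f0 /smoothP Cf; apply/smoothP => N; exact: CnV. Qed.

Lemma smooth_sum (I : Type) (r : seq I) (F : I -> 'rV[R]_n -> R) :
  (forall j, smooth (F j)) -> smooth (fun x => \sum_(j <- r) F j x).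
Proof.
move=> sF; elim: r => [|j r IH].
  by under eq_fun do rewrite big_nil; exact: smooth_cst.
under eq_fun do rewrite big_cons; apply: smoothD; [exact: sF|exact: IH].
Qed.

Lemma smooth_prod (I : Type) (r : seq I) (F : I -> 'rV[R]_n -> R) :
  (forall j, smooth (F j)) -> smooth (fun x => \prod_(j <- r) F j x).
Proof.
move=> sF; elim: r => [|j r IH].
  by under eq_fun do rewrite big_nil; exact: smooth_cst.
under eq_fun do rewrite big_cons; apply: smoothM; [exact: sF|exact: IH].
Qed.

Lemma pderiv_shift i f a :
  pderiv i (fun z => f (z + a)) = (fun z => pderiv i f (z + a)).
Proof. by apply/funext => x; exact: derive_shift_fun. Qed.

Lemma pderivs_shift s f a :
  pderivs s (fun z => f (z + a)) = (fun z => pderivs s f (z + a)).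
Proof. by elim: s => [//|i s IH]; rewrite pderivsE IH pderiv_shift. Qed.

Lemma smooth_shift f a : smooth f -> smooth (fun z => f (z + a)).
Proof.
move=> sf s; rewrite pderivs_shift; have [cf df] := sf s; split.
  exact: continuous_shift_fun.
by move=> i x; apply: derivable_shift; exact: df.
Qed.

Lemma pderivsD s f g : smooth f -> smooth g ->
  pderivs s (fun x => f x + g x) = fun x => pderivs s f x + pderivs s g x.
Proof.
move=> sf sg; elim: s => [//|i s IH]; rewrite !pderivsE IH pderivD//.
- by move=> x; apply: smooth_derivable; exact: smooth_pderivs.
- by move=> x; apply: smooth_derivable; exact: smooth_pderivs.
Qed.

Lemma pderivsZ s (a : R) f : smooth f ->
  pderivs s (fun x => a * f x) = fun x => a * pderivs s f x.
Proof.
move=> sf; elim: s => [//|i s IH]; rewrite !pderivsE IH.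
rewrite (@pderivM i (fun=> a)); last 2 first.
- by move=> x; exact: derivable_cst.
- by move=> x; apply: smooth_derivable; exact: smooth_pderivs.
by rewrite pderiv_cst; apply/funext => x; rewrite mul0r add0r.
Qed.

Lemma pderivs_cst0 s : pderivs s (fun _ : 'rV[R]_n => 0) = fun=> 0.
Proof. by elim: s => [//|i s IH]; rewrite pderivsE IH pderiv_cst. Qed.

(** Leibniz: differentiating a product along s yields 2 ^ size s products of
    derivatives of f and g. *)
Lemma pderivs_prod_le (N : nat) f g (a b : R) x s : smooth f -> smooth g ->
  (size s <= N)%N ->
  (forall t, (size t <= N)%N -> `|pderivs t f x| <= a) ->
  (forall t, (size t <= N)%N -> `|pderivs t g x| <= b) ->
  `|pderivs s (fun x => f x * g x) x| <= 2 ^+ size s * (a * b).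
Proof.
elim/last_ind: s N f g => [|s i IH] N f g sf sg sN af bg.
  by rewrite expr0 mul1r normrM ler_pM//; [exact: (af [::])|exact: (bg [::])].
have sN' : (size s <= N.-1)%N by move: sN; rewrite size_rcons; case: (N).
have N0 : (0 < N)%N by move: sN; rewrite size_rcons; case: (N).
have tN t : (size t <= N.-1)%N -> (size (rcons t i) <= N)%N.
  by rewrite size_rcons -ltnS prednK.
have tN' (t : seq 'I_n) : (size t <= N.-1)%N -> (size t <= N)%N.
  by move=> h; rewrite (leq_trans h)// leq_pred.
have sdf := smooth_pderiv i sf; have sdg := smooth_pderiv i sg.
rewrite pderivs_rcons pderivM; last 2 first.
- by move=> y; exact: smooth_derivable.
- by move=> y; exact: smooth_derivable.
rewrite pderivsD; last 2 first.
- exact: (smoothM sdf sg).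
- exact: (smoothM sf sdg).
rewrite size_rcons exprS -mulrA mulrDl mul1r (le_trans (ler_normD _ _))//.
apply: lerD; apply: (IH N.-1 _ _ _ _ sN') => //.
- by move=> t /tN tN2; rewrite -pderivs_rcons; exact: af.
- by move=> t /tN' /bg.
- by move=> t /tN' /af.
- by move=> t /tN tN2; rewrite -pderivs_rcons; exact: bg.
Qed.

End partial_derivatives.

(** * Functions of bounded support *)

Section row_norm.
Context (R : realType) (n : nat).
Implicit Types (x y : 'rV[R]_n).

Lemma normr_coord_le x (i : 'I_n) : `|x 0 i| <= `|x|.
Proof.
have /mapP[j Hj ->] : `|x 0 i| \in [seq `|x v.1 v.2| | v : 'I_1 * 'I_n].
  by apply/mapP; exists (0, i) => //=; rewrite mem_enum.
by rewrite [leRHS]/Num.norm /= mx_normrE; apply/bigmax_geP; right => /=; exists j.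
Qed.

Lemma norm_rV_le x (r : R) : 0 <= r -> (forall i, `|x 0 i| <= r) -> `|x| <= r.
Proof.
move=> r0 xr; rewrite [leLHS]/Num.norm /= mx_normrE; apply/bigmax_leP; split => //.
by move=> [i j] _ /=; rewrite (ord1 i).
Qed.

Lemma compact_norm_le (r : R) : compact [set x : 'rV[R]_n | `|x| <= r].
Proof.
apply: bounded_closed_compact.
  exists r; split; first exact: num_real.
  by move=> M rM x /= xr; rewrite (le_trans xr)// ltW.
apply: (@preimage_closed _ _ (fun x : 'rV[R]_n => `|x|) [set y | y <= r]).
  by move=> x _; exact: norm_continuous.
exact: closed_le.
Qed.

End row_norm.

Section lines.
Context (R : realType) (V : normedModType R).
Implicit Types (f : V -> R) (x v : V).

Lemma is_derive_line f x v (t : R) : derivable f (x + t *: v) v ->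
  is_derive t 1 (fun t => f (x + t *: v)) ('D_v f (x + t *: v)).
Proof.
move=> df.
have E : (fun h : R => h^-1 *: (((fun t => f (x + t *: v)) \o shift t) (h *: (1 : R)) -
    f (x + t *: v))) =
  fun h => h^-1 *: ((f \o shift (x + t *: v)) (h *: v) - f (x + t *: v)).
  apply/funext => h; congr (_ *: (f _ - _)); rewrite /=.
  by rewrite [_%:A]mulr1 scalerDl addrCA addrA.
apply: DeriveDef; first by rewrite /derivable E.
by rewrite /derive E.
Qed.

Lemma line_MVT f x v (L d : R) : (forall t, derivable f (x + t *: v) v) ->
  (forall t, `|'D_v f (x + t *: v)| <= L) -> `|f (x + d *: v) - f x| <= L * `|d|.
Proof.
move=> df dL; pose g t := f (x + t *: v).
have dg (t : R) : is_derive t 1 g ('D_v f (x + t *: v)) by exact: is_derive_line.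
have cg : continuous g.
  move=> t; apply: differentiable_continuous; apply/derivable1_diffP.
  exact: (@ex_derive _ _ _ _ _ _ _ (dg t)).
have -> : f x = g 0 by rewrite /g scale0r addr0.
rewrite -/(g d); have [d0|d0] := leP 0 d.
  have [c _ ->] := MVT_segment d0 (fun t _ => dg t) (continuous_subspaceT cg).
  by rewrite subr0 normrM ler_wpM2r//; exact: dL.
have [c _] := MVT_segment (ltW d0) (fun t _ => dg t) (continuous_subspaceT cg).
rewrite distrC sub0r => ->.
by rewrite normrM normrN ler_wpM2r//; exact: dL.
Qed.

Lemma derive_local0 f x v (U : set V) : open U -> U x -> (forall y, U y -> f y = 0) ->
  'D_v f x = 0.
Proof.
move=> oU Ux fU; rewrite /derive; apply: cvg_lim => //.
have cv : (h *: v + x) @[h --> (0 : R)^'] --> x.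
  have : (h *: v + x) @[h --> (0 : R)] --> 0 *: v + x.
    apply: cvgD; last exact: cvg_cst.
    by apply: (@cvgZr_tmp _ _ _ _ _ (fun h : R => h)); exact: cvg_id.
  by rewrite scale0r add0r; apply: cvg_trans; apply: cvg_app; exact: nbhs_dnbhs.
have nU : \forall h \near (0 : R)^', U (h *: v + x).
  by apply: cv; exact: open_nbhs_nbhs.
apply: cvg_near_cst.
near=> h; rewrite /= (fU x)// fU; last by near: h.
by rewrite subrr scaler0.
Unshelve. all: by end_near. Qed.

End lines.

Section bounded_support.
Context (R : realType) (n : nat).
Implicit Types (f g : 'rV[R]_n -> R) (i : 'I_n) (x : 'rV[R]_n) (s : seq 'I_n).

Local Notation e_ i := (delta_mx 0 i : 'rV[R]_n).

(** Keeping the radius explicit, rather than the closed support, makes one and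
    the same r serve for all derivatives, sums and products. *)
Definition test_in (r : R) f := smooth f /\ forall x, r < `|x| -> f x = 0.

Lemma test_in_pderiv r i f : test_in r f -> test_in r (pderiv i f).
Proof.
move=> [sf f0]; split; first exact: smooth_pderiv.
move=> x rx; apply: (@derive_local0 _ _ f x _ [set x | r < `|x|]) => //.
apply: (@open_comp _ _ (fun x : 'rV[R]_n => `|x|) [set y | r < y]).
  by move=> y _; exact: norm_continuous.
exact: open_gt.
Qed.

Lemma test_in_pderivs r s f : test_in r f -> test_in r (pderivs s f).
Proof. by move=> tf; elim: s => [//|i s IH]; rewrite pderivsE; exact: test_in_pderiv. Qed.

Lemma test_in_bounded r f : test_in r f -> exists2 M, 0 <= M & forall x, `|f x| <= M.
Proof.
move=> [sf f0]; pose K := [set x : 'rV[R]_n | `|x| <= r].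
have cK : compact (f @` K).
  apply: continuous_compact; last exact: compact_norm_le.
  by apply: continuous_subspaceT; exact: smooth_continuous.
have [M [_ bM]] := compact_bounded cK.
exists (Num.max (M + 1) 0) => [|x]; first by rewrite le_max lexx orbT.
have [xr|rx] := leP `|x| r; last by rewrite f0// normr0 le_max lexx orbT.
rewrite le_max; apply/orP; left; apply: (bM (M + 1)); first by rewrite ltrDl.
by exists x.
Qed.

Lemma test_in_pderivs_bounded N r f : test_in r f ->
  exists2 M, 0 <= M & forall s, (size s <= N)%N -> forall x, `|pderivs s f x| <= M.
Proof.
elim: N f => [|N IH] f tf.
  have [M M0 bM] := test_in_bounded tf; exists M => // s.
  by rewrite leqn0 => /nilP -> x; exact: bM.
have [M M0 bM] := test_in_bounded tf.
have /choice[B HB] : forall i, exists B, 0 <= B /\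
    forall s, (size s <= N)%N -> forall x, `|pderivs s (pderiv i f) x| <= B.
  by move=> i; have [B B0 bB] := IH _ (test_in_pderiv i tf); exists B.
have SB : 0 <= \sum_i B i by apply: sumr_ge0 => i _; have [] := HB i.
exists (M + \sum_i B i) => [|s]; first by rewrite addr_ge0.
case/lastP: s => [_ x|s i].
  by rewrite (le_trans (bM x))// lerDl.
rewrite size_rcons ltnS => sN x; rewrite pderivs_rcons.
have [_ /(_ s sN x)/le_trans] := HB i; apply.
rewrite (bigD1 i)//= addrCA lerDl addr_ge0// sumr_ge0// => j _.
by have [] := HB j.
Qed.

(** The mean value theorem, along the n coordinate segments from x to y. *)
Lemma smooth_lipschitz f (L : R) : smooth f -> 0 <= L ->
  (forall i x, `|pderiv i f x| <= L) ->
  forall x y, `|f y - f x| <= n%:R * L * `|y - x|.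
Proof.
move=> sf L0 fL x y; pose d := y - x.
have Ey : y = x + \sum_(i <- index_enum 'I_n) d 0 i *: e_ i.
  by rewrite -row_sum_delta /d addrCA subrr addr0.
rewrite -/d {1}Ey.
have H (l : seq 'I_n) z : `|f (z + \sum_(i <- l) d 0 i *: e_ i) - f z| <=
    \sum_(i <- l) L * `|d 0 i|.
  elim: l z => [|i l IH] z; first by rewrite !big_nil addr0 subrr normr0.
  rewrite !big_cons addrA -(subrKA (f (z + d 0 i *: e_ i))).
  rewrite (le_trans (ler_normD _ _))// [leRHS]addrC lerD//.
  apply: line_MVT; first by move=> t; exact: smooth_derivable.
  by move=> t; exact: fL.
apply: le_trans (H _ _) _.
have -> : n%:R * L * `|d| = \sum_(i < n) L * `|d|.
  by rewrite sumr_const card_ord -[RHS]mulr_natl mulrA.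
by apply: ler_sum => i _; rewrite ler_wpM2l// normr_coord_le.
Qed.

Lemma test_in_lipschitz N r f : test_in r f ->
  exists2 L, 0 <= L & forall s, (size s <= N)%N ->
    forall x y, `|pderivs s f y - pderivs s f x| <= L * `|y - x|.
Proof.
move=> tf; have [M M0 bM] := test_in_pderivs_bounded N.+1 tf.
exists (n%:R * M) => [|s sN x y]; first by rewrite mulr_ge0.
apply: smooth_lipschitz => //; first by apply: smooth_pderivs; case: tf.
by move=> i z; apply: (bM (i :: s)).
Qed.

Lemma test_inM r f g : smooth g -> test_in r f -> test_in r (fun x => g x * f x).
Proof.
move=> sg [sf f0]; split; first exact: smoothM.
by move=> x /f0 ->; rewrite mulr0.
Qed.

End bounded_support.

(** * Smooth cutoffs, test functions and distributions *)

Lemma is_derive_along (R : realType) (V : normedModType R) (f : V -> R) x v (d : R) :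
  is_derive (0 : R) 1 (fun h : R => f (h *: v + x)) d -> is_derive x v f d.
Proof.
have E : (fun h : R => h^-1 *: (((fun h => f (h *: v + x)) \o shift 0) (h *: (1 : R)) -
    f (0 *: v + x))) = fun h => h^-1 *: ((f \o shift x) (h *: v) - f x).
  by apply/funext => h /=; rewrite addr0 scale0r add0r [_%:A]mulr1.
move=> [dx <-]; apply: DeriveDef; first exact/derivable1P.
by rewrite /derive E.
Qed.

Section flat_functions.
Context (R : realType).

(** P(1/t) exp(-1/t), extended by 0 to t <= 0. As P varies, this family is closed
    under derivation, which gives smoothness of all its members at once. *)
Definition flat (P : {poly R}) (t : R) : R :=
  if 0 < t then P.[t^-1] * expR (- t^-1) else 0.

(** For t > 0, exp(1/t) exceeds (1/t)^(i+2) / (i+2)!, so the monomial of degree i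
    of P contributes at most its coefficient times (i+2)! t^2. *)
Lemma flat_le (P : {poly R}) : exists C : R, forall t, `|flat P t| <= C * t ^+ 2.
Proof.
exists (\sum_(i < size P) `|P`_i| * (i.+2)`!%:R) => t; rewrite /flat.
case: ifPn => [t0|_]; last first.
  rewrite normr0 mulr_ge0 ?sqr_ge0// sumr_ge0// => i _; exact: mulr_ge0.
rewrite normrM [`|expR _|]ger0_norm ?expR_ge0// horner_coef mulr_suml.
have H (i : nat) : t ^- i * expR (- t^-1) <= i.+2`!%:R * t ^+ 2.
  have := @expR_ge1Dxn _ t^-1 i.+1; rewrite invr_ge0 => /(_ (ltW t0)).
  rewrite expRN => h; rewrite ler_pdivrMr ?expR_gt0//.
  apply: (@le_trans _ _ (i.+2`!%:R * t ^+ 2 * (t^-1 ^+ i.+2 / i.+2`!%:R))).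
    have F0 : (i.+2`!%:R : R) != 0 by rewrite pnatr_eq0 -lt0n fact_gt0.
    have tn0 : t != 0 by rewrite gt_eqF.
    rewrite -exprVn (exprS t^-1 i.+1) (exprS t^-1 i) le_eqVlt; apply/orP; left.
    by apply/eqP; move: (t^-1 ^+ i) => y; field; rewrite F0 tn0.
  rewrite ler_wpM2l ?mulr_ge0 ?exprn_ge0 ?(ltW t0)//.
  by apply: le_trans h; rewrite lerDr.
apply: le_trans (_ : (\sum_(i < size P) `|P`_i| * t ^- i) * expR (- t^-1) <= _).
  rewrite ler_wpM2r ?expR_ge0// (le_trans (ler_norm_sum _ _ _))// ler_sum// => i _.
  by rewrite normrM [`|_ ^+ i|]ger0_norm ?exprn_ge0 ?invr_ge0 ?(ltW t0)// exprVn.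
rewrite mulr_suml; apply: ler_sum => i _.
by rewrite -!mulrA ler_wpM2l.
Qed.

(** Differentiating P(1/t) exp(-1/t) gives (1/t)^2 (P - P')(1/t) exp(-1/t). *)
Definition flat_next (P : {poly R}) : {poly R} := 'X^2 * (P - P^`()).

Lemma is_derive_flat (P : {poly R}) (t : R) :
  is_derive t 1 (flat P) (flat (flat_next P) t).
Proof.
have [t0|t0|->] := ltgtP t 0.
- have E : \forall s \near t, 0 = flat P s.
    near=> s; rewrite /flat ifF//; apply/negbTE; rewrite -leNgt ltW//.
    by near: s; exact: lt_nbhsl.
  have -> : flat (flat_next P) t = 0.
    by rewrite /flat ifF//; apply/negbTE; rewrite -leNgt ltW.
  by apply: (near_eq_is_derive E); exact: is_derive_cst.
- have E : \forall s \near t, P.[s^-1] * expR (- s^-1) = flat P s.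
    by near=> s; rewrite /flat ifT//; near: s; exact: lt_nbhsr.
  apply: (near_eq_is_derive E).
  rewrite /flat t0.
  have tn0 : t != 0 by rewrite gt_eqF.
  have dV : is_derive t 1 (fun s : R => s^-1) (- t ^- 2).
    have := is_deriveV tn0 (is_derive_id t (1 : R)).
    by move/is_derive_eq; apply; exact: mulr1.
  have dP : is_derive t 1 (fun s => P.[s^-1]) (- t ^- 2 * P^`().[t^-1]).
    by rewrite mulrC; exact: (@is_derive1_comp _ (horner P) (fun s => s^-1) t _ _ (is_derive_poly P t^-1) dV).
  have dVN : is_derive t 1 (fun s : R => - s^-1) (t ^- 2).
    by have := is_deriveN dV; rewrite opprK.
  have dE : is_derive t 1 (fun s => expR (- s^-1)) (t ^- 2 * expR (- t^-1)).
    by rewrite mulrC; exact: (@is_derive1_comp _ expR (fun s => - s^-1) t _ _ (is_derive_expR _) dVN).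
  have := is_deriveM dP dE; move/is_derive_eq; apply.
  rewrite /GRing.scale /= /flat_next hornerM hornerXn hornerD hornerN exprVn; ring.
- have -> : flat (flat_next P) 0 = 0 by rewrite /flat ltxx.
  have [C HC] := flat_le P.
  have q0 : h^-1 *: ((flat P \o shift 0) (h *: 1) - flat P 0) @[h --> (0 : R)^'] --> (0 : R).
    have f0 : flat P 0 = 0 by rewrite /flat ltxx.
    apply/norm_cvg0P.
    apply: (@squeeze_cvgr _ _ _ _ (fun=> 0) (fun h => C * `|h|)).
    + near=> h; rewrite normr_ge0 /= f0 subr0 addr0.
      have hn0 : h != 0 by near: h; exact: nbhs_dnbhs_neq.
      rewrite [_%:A]mulr1 normrZ normfV ler_pdivrMl ?normr_gt0//.
      by rewrite mulrCA -expr2 real_normK ?num_real.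
    + exact: cvg_cst.
    + suff : C * `|h| @[h --> (0 : R)^'] --> C * `|0 : R| by rewrite normr0 mulr0.
      apply: cvgMl_tmp; apply: cvg_norm; exact: nbhs_dnbhs.
  apply: DeriveDef; first by apply/cvg_ex; exists 0.
  by rewrite /derive; exact: cvg_lim.
Unshelve. all: by end_near. Qed.

End flat_functions.

Section smooth_along_coordinates.
Context (R : realType) (n : nat).
Implicit Types (P : {poly R}) (a b : R) (i j : 'I_n).

Local Notation e_ i := (delta_mx 0 i : 'rV[R]_n).

Lemma is_derive_flat_coord P a b i j (x : 'rV[R]_n) :
  is_derive x (e_ j) (fun x : 'rV[R]_n => flat P (a * x 0 i + b))
    (a * (j == i)%:R * flat (flat_next P) (a * x 0 i + b)).
Proof.
pose g (h : R) := a * (j == i)%:R * h + (a * x 0 i + b).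
have dg : is_derive (0 : R) 1 g (a * (j == i)%:R).
  have := is_deriveD (is_deriveZ (a * (j == i)%:R) (is_derive_id (0 : R) (1 : R)))
    (is_derive_cst (a * x 0 i + b) (0 : R) (1 : R)).
  by move/is_derive_eq; apply; rewrite addr0; exact: mulr1.
have g0 : g 0 = a * x 0 i + b by rewrite /g mulr0 add0r.
have df := is_derive_flat P (g 0).
have := @is_derive1_comp _ (flat P) g 0 _ _ df dg; rewrite g0 mulrC => dfg.
have E : (fun h : R => flat P (a * (h *: e_ j + x) 0 i + b)) = flat P \o g.
  apply/funext => h /=; congr flat; rewrite !mxE eqxx /= /g [i == j]eq_sym.
  by ring.
by apply: is_derive_along; rewrite E.
Qed.

Lemma smooth_flat_coord P a b i :
  smooth (fun x : 'rV[R]_n => flat P (a * x 0 i + b)).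
Proof.
apply/smoothP => N.
have cf Q : continuous (fun x : 'rV[R]_n => flat Q (a * x 0 i + b)).
  move=> x; apply: (@continuous_comp _ _ _ (fun x : 'rV[R]_n => a * x 0 i + b) (flat Q)).
    apply: (@continuousD_fun _ _ (fun x : 'rV[R]_n => a * x 0 i) (fun=> b)).
      apply: continuousM_fun; first exact: cst_continuous.
      exact: coord_continuous.
    exact: cst_continuous.
  apply: differentiable_continuous; apply/derivable1_diffP.
  by have [] := is_derive_flat Q (a * x 0 i + b).
elim: N P => [|N IH] P; first exact: cf.
split; first exact: cf.
move=> j; split; first by move=> x; have [] := is_derive_flat_coord P a b i j x.
have -> : pderiv j (fun x : 'rV[R]_n => flat P (a * x 0 i + b)) =
    fun x : 'rV[R]_n => (a * (j == i)%:R) * flat (flat_next P) (a * x 0 i + b).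
  by apply/funext => x; have [] := is_derive_flat_coord P a b i j x.
by apply: CnM; [exact: Cn_cst|exact: IH].
Qed.

(** Smooth step from 0 on the nonpositive reals to 1 on [1, +oo[. *)
Definition step (t : R) := flat 1 t * (flat 1 t + flat 1 (1 - t))^-1.

Lemma flat1_ge0 (t : R) : 0 <= flat 1 t.
Proof. by rewrite /flat; case: ifP => // t0; rewrite hornerC mul1r expR_ge0. Qed.

Lemma flat1_gt0 (t : R) : 0 < t -> 0 < flat 1 t.
Proof. by move=> t0; rewrite /flat t0 hornerC mul1r expR_gt0. Qed.

Lemma step_den_neq0 (t : R) : flat 1 t + flat 1 (1 - t) != 0.
Proof.
rewrite gt_eqF//; have [t0|t0] := ltP 0 t.
  by rewrite ltr_wpDr ?flat1_ge0 ?flat1_gt0.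
by rewrite ltr_wpDl ?flat1_ge0 ?flat1_gt0// subr_gt0 (le_lt_trans t0).
Qed.

Lemma step0 (t : R) : t <= 0 -> step t = 0.
Proof. by move=> t0; rewrite /step /flat ltNge t0 /= mul0r. Qed.

Lemma step1 (t : R) : 1 <= t -> step t = 1.
Proof.
move=> t1; have := step_den_neq0 t; rewrite /step => h.
have E : flat 1 (1 - t) = 0 :> R by rewrite /flat subr_gt0 ltNge t1.
by move: h; rewrite E addr0 => h; rewrite divff.
Qed.

Lemma smooth_step_coord a b i : smooth (fun x : 'rV[R]_n => step (a * x 0 i + b)).
Proof.
have sf := smooth_flat_coord 1 a b i.
have sf1 : smooth (fun x : 'rV[R]_n => flat 1 (1 - (a * x 0 i + b))).
  have := smooth_flat_coord 1 (- a) (1 - b) i.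
  by congr smooth; apply/funext => x; congr flat; rewrite mulNr; ring.
apply: (smoothM sf); apply: smoothV; last exact: (smoothD sf sf1).
by move=> x; exact: step_den_neq0.
Qed.

(** A smooth function that is 1 on the cube of radius r about c and 0 off the
    cube of radius 2 r. *)
Definition plateau (c : 'rV[R]_n) (r : R) (x : 'rV[R]_n) : R :=
  \prod_i (step (2 - r^-1 * (x 0 i - c 0 i)) * step (2 + r^-1 * (x 0 i - c 0 i))).

Lemma smooth_plateau c r : smooth (plateau c r).
Proof.
apply: smooth_prod => i; apply: smoothM.
  have := smooth_step_coord (- r^-1) (2 + r^-1 * c 0 i) i.
  by congr smooth; apply/funext => x; congr step; ring.
have := smooth_step_coord (r^-1) (2 - r^-1 * c 0 i) i.
by congr smooth; apply/funext => x; congr step; ring.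
Qed.

Lemma plateau1 c r x : 0 < r -> `|x - c| <= r -> plateau c r x = 1.
Proof.
move=> r0 xc; apply: big1 => i _.
have : `|r^-1 * (x 0 i - c 0 i)| <= 1.
  rewrite normrM gtr0_norm ?invr_gt0// ler_pdivrMl// mulr1.
  by apply: le_trans xc; have := normr_coord_le (x - c) i; rewrite !mxE.
rewrite ler_norml => /andP[h1 h2].
by rewrite !step1 ?mulr1//; lra.
Qed.

Lemma plateau0 c r x : 0 < r -> 2 * r <= `|x - c| -> plateau c r x = 0.
Proof.
move=> r0 xc; apply/eqP; apply/negPn/negP => p0.
have : `|x - c| < 2 * r; last by rewrite ltNge xc.
rewrite [ltLHS]/Num.norm /= mx_normrE; apply/bigmax_ltP; split.
  by rewrite mulr_gt0.
move=> [k i] _ /=; rewrite (ord1 k) ltNge; apply/negP => h.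
move/negP: p0; apply; apply/eqP/eqP; rewrite prodf_seq_eq0; apply/hasP.
exists i; first by rewrite mem_index_enum.
rewrite /= mulf_eq0.
have : 2 <= `|r^-1 * (x 0 i - c 0 i)|.
  rewrite normrM gtr0_norm ?invr_gt0// mulrC ler_pdivlMr//.
  by move: h; rewrite !mxE.
rewrite ler_normr => /orP[h2|h2]; apply/orP; [left|right]; apply/eqP/step0; lra.
Qed.

End smooth_along_coordinates.

Section vector_coordinates.
Context (R : realType) (V : vectType R).
Implicit Types (v w : V) (k : 'I_(\dim {:V})).

Lemma crdD k v w : crd k (v + w) = crd k v + crd k w.
Proof. exact: linearD. Qed.

Lemma crdZ k (a : R) v : crd k (a *: v) = a * crd k v.
Proof. exact: linearZ. Qed.

Lemma crdB k v w : crd k (v - w) = crd k v - crd k w.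
Proof. exact: linearB. Qed.

Lemma crd0 k : crd k (0 : V) = 0.
Proof. exact: linear0. Qed.

Lemma crd_sum k (I : Type) (r : seq I) (F : I -> V) :
  crd k (\sum_(j <- r) F j) = \sum_(j <- r) crd k (F j).
Proof. exact: linear_sum. Qed.

Lemma crdK v : from_crd (fun k => crd k v) = v.
Proof. by rewrite /from_crd /crd -coord_vbasis ?memvf. Qed.

Lemma from_crdK k (c : 'I_(\dim {:V}) -> R) : crd k (from_crd c) = c k.
Proof. by rewrite /crd /from_crd coord_sum_free// (basis_free (vbasisP _)). Qed.

Lemma crd_inj v w : (forall k, crd k v = crd k w) -> v = w.
Proof. by move=> h; rewrite -(crdK v) -(crdK w); congr from_crd; apply/funext. Qed.

Lemma crd_eq0 v : (forall k, crd k v = 0) -> v = 0.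
Proof. by move=> h; apply: crd_inj => k; rewrite h crd0. Qed.

End vector_coordinates.

Section vector_test_functions.
Context (R : realType) (n : nat) (V : vectType R).
Implicit Types (u v : 'rV[R]_n -> V) (T : ('rV[R]_n -> V) -> R).

Definition vtest_in (r : R) u := forall k, test_in r (crd k \o u).

Lemma vtest_in0 r u x : vtest_in r u -> r < `|x| -> u x = 0.
Proof. by move=> tu rx; apply: crd_eq0 => k; have [_] := tu k; apply. Qed.

Lemma closed_norm_le (c : 'rV[R]_n) (r : R) : closed [set x : 'rV[R]_n | `|x - c| <= r].
Proof.
apply: (@preimage_closed _ _ (fun x : 'rV[R]_n => `|x - c| : R) [set y | y <= r]).
  move=> x _.
  exact: (@continuous_shift_fun _ _ (fun y : 'rV[R]_n => `|y|) (- c) (@norm_continuous _ _)).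
exact: closed_le.
Qed.

Lemma supp_sub u (c : 'rV[R]_n) (r : R) : (forall x, r < `|x - c| -> u x = 0) ->
  supp u `<=` [set x | `|x - c| <= r].
Proof.
move=> u0; rewrite /supp [X in _ `<=` X](iffLR (closure_id _) (@closed_norm_le c r)).
apply: closureS => x /= ux; rewrite leNgt; apply/negP => /u0 /eqP.
exact/negP.
Qed.

Lemma test_vtest_in u : test u -> exists r, vtest_in r u.
Proof.
move=> [su cu]; have [M [_ bM]] := compact_bounded cu.
exists (M + 1) => k; split; first exact: su.
move=> x Mx /=; have [->|ux] := eqVneq (u x) 0; first exact: crd0.
have : supp u x by apply: subset_closure.
have M1 : M < M + 1 by rewrite ltrDl.
by move=> /(bM _ M1) /=; rewrite leNgt Mx.
Qed.

Lemma vtest_in_supp r u : vtest_in r u -> supp u `<=` [set x | `|x| <= r].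
Proof.
move=> tu; have := @supp_sub u 0 r; under eq_fun do rewrite subr0.
apply=> x; rewrite subr0; exact: vtest_in0.
Qed.

Lemma vtest_in_test r u : vtest_in r u -> test u.
Proof.
move=> tu; split; first by move=> k; have [] := tu k.
apply: (subclosed_compact _ (@compact_norm_le R n r)); last exact: vtest_in_supp.
exact: closed_closure.
Qed.

Lemma vtest_inW r r' u : r <= r' -> vtest_in r u -> vtest_in r' u.
Proof.
move=> rr' tu k; have [su u0] := tu k; split => // x r'x; apply: u0.
exact: le_lt_trans r'x.
Qed.

Lemma vtest_in_lin r (a : R) u v : vtest_in r u -> vtest_in r v ->
  vtest_in r (fun x => a *: u x + v x).
Proof.
move=> tu tv k; have [su u0] := tu k; have [sv v0] := tv k; split.
  have -> : crd k \o (fun x => a *: u x + v x) =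
      fun x => a * (crd k \o u) x + (crd k \o v) x.
    by apply/funext => x /=; rewrite crdD crdZ.
  exact: (smoothD (smoothZ a su) sv).
by move=> x rx /=; rewrite crdD crdZ [crd k (u x)]u0// [crd k (v x)]v0// mulr0 addr0.
Qed.

Lemma vtest_in_cst0 r : vtest_in r (fun _ => 0).
Proof.
move=> k; split; last by move=> x _ /=; rewrite crd0.
have -> : crd k \o (fun _ : 'rV[R]_n => 0) = fun=> 0 by apply/funext => x /=; rewrite crd0.
exact: smooth_cst.
Qed.

Lemma test_lin (a : R) u v : test u -> test v -> test (fun x => a *: u x + v x).
Proof.
move=> /test_vtest_in[r tu] /test_vtest_in[s tv].
apply: (@vtest_in_test (Num.max r s)); apply: vtest_in_lin.
  by apply: vtest_inW tu; rewrite le_max lexx.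
by apply: vtest_inW tv; rewrite le_max lexx orbT.
Qed.

Lemma vtest_in_mul r (g : 'rV[R]_n -> R) u : smooth g -> vtest_in r u ->
  vtest_in r (fun x => g x *: u x).
Proof.
move=> sg tu k; have := test_inM sg (tu k).
by congr test_in; apply/funext => x /=; rewrite crdZ.
Qed.

Lemma test_mul (g : 'rV[R]_n -> R) u : smooth g -> test u ->
  test (fun x => g x *: u x).
Proof.
by move=> sg /test_vtest_in[r tu]; apply: vtest_in_test (vtest_in_mul sg tu).
Qed.

Lemma vsmooth_shift r u y : vtest_in r u -> vsmooth (fun x => u (x - y)).
Proof. by move=> tu k; have [su _] := tu k; exact: (smooth_shift (- y) su). Qed.

Lemma vtest_in_shift r u y : vtest_in r u -> vtest_in (r + `|y|) (fun x => u (x - y)).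
Proof.
move=> tu k; have [_ u0] := tu k; split; first exact: (vsmooth_shift y tu).
move=> x ryx /=; apply: u0; rewrite -ltrBDr in ryx; apply: (lt_le_trans ryx).
exact: lerB_dist.
Qed.

Lemma test_shift u y : test u -> test (fun x => u (x - y)).
Proof. by move=> /test_vtest_in[r tu]; apply: vtest_in_test (vtest_in_shift y tu). Qed.

Lemma dist_lin T (a : R) u v : schwartz_distribution T -> test u -> test v ->
  T (fun x => a *: u x + v x) = a * T u + T v.
Proof. by move=> [lT _]; exact: lT. Qed.

Lemma dist0 T : schwartz_distribution T -> T (fun=> 0) = 0.
Proof.
move=> dT; have t0 : test (fun _ : 'rV[R]_n => 0 : V).
  exact: vtest_in_test (vtest_in_cst0 0).
have := dist_lin 1 dT t0 t0; rewrite mul1r.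
rewrite (_ : (fun _ => _) = fun=> 0); last by apply/funext => x; rewrite scaler0 addr0.
by move=> /eqP; rewrite -subr_eq subrr eq_sym => /eqP.
Qed.

Lemma distD T u v : schwartz_distribution T -> test u -> test v ->
  T (fun x => u x + v x) = T u + T v.
Proof.
move=> dT tu tv; rewrite -[T u]mul1r -(dist_lin _ dT)//; congr T.
by apply/funext => x; rewrite scale1r.
Qed.

Lemma distB T u v : schwartz_distribution T -> test u -> test v ->
  T (fun x => u x - v x) = T u - T v.
Proof.
move=> dT tu tv; rewrite addrC -mulN1r -(dist_lin _ dT)//; congr T.
by apply/funext => x; rewrite scaleN1r addrC.
Qed.

Lemma dist_bound T (r : R) : schwartz_distribution T -> exists C N, 0 <= C /\
  forall u, vtest_in r u -> forall M, (forall k s x, (size s <= N)%N ->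
    `|pderivs s (crd k \o u) x| <= M) -> 0 <= M -> `|T u| <= C * M.
Proof.
move=> [_ /(_ _ (@compact_norm_le R n r))[C [N HC]]].
exists `|C|, N; split => // u tu M uM M0.
apply: le_trans (HC u (vtest_in_test tu) (vtest_in_supp tu) M uM) _.
by rewrite ler_wpM2r// ler_norm.
Qed.

Lemma vtest_in_lipschitz N r u : vtest_in r u -> exists2 L, 0 <= L &
  forall k s, (size s <= N)%N -> forall x y,
    `|pderivs s (crd k \o u) y - pderivs s (crd k \o u) x| <= L * `|y - x|.
Proof.
move=> tu; have /choice[L HL] : forall k, exists L, 0 <= L /\
    forall s, (size s <= N)%N -> forall x y,
    `|pderivs s (crd k \o u) y - pderivs s (crd k \o u) x| <= L * `|y - x|.
  by move=> k; have [L L0 HL] := test_in_lipschitz N (tu k); exists L.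
exists (\sum_k L k) => [|k s sN x y].
  by apply: sumr_ge0 => k _; have [] := HL k.
have [_ /(_ s sN x y)/le_trans] := HL k; apply.
rewrite ler_wpM2r// (bigD1 k)//= lerDl sumr_ge0// => j _.
by have [] := HL j.
Qed.

Lemma vtest_in_bounded N r u : vtest_in r u -> exists2 M, 0 <= M &
  forall k s x, (size s <= N)%N -> `|pderivs s (crd k \o u) x| <= M.
Proof.
move=> tu; have /choice[L HL] : forall k, exists L, 0 <= L /\
    forall s, (size s <= N)%N -> forall x, `|pderivs s (crd k \o u) x| <= L.
  by move=> k; have [L L0 HL] := test_in_pderivs_bounded N (tu k); exists L.
exists (\sum_k L k) => [|k s x sN].
  by apply: sumr_ge0 => k _; have [] := HL k.
have [_ /(_ s sN x)/le_trans] := HL k; apply.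
by rewrite (bigD1 k)//= lerDl sumr_ge0// => j _; have [] := HL j.
Qed.

(** By compactness, finitely many small cubes on which T vanishes cover the
    support of u. They are removed one at a time: if c is a plateau function
    around the first cube, then T kills c u, and (1 - c) u lives on the others. *)
Lemma dist_off_dsupp T u : schwartz_distribution T -> test u ->
  (forall x, supp u x -> ~ dsupp T x) -> T u = 0.
Proof.
move=> dT tu uT.
(* p is the center and the radius of a cube; T vanishes on the cube of twice the
   radius, because plateau needs this room to fall from 1 to 0. *)
pose null (p : 'rV[R]_n * R) := 0 < p.2 /\
  forall v, test v -> (forall x, 2 * p.2 < `|x - p.1| -> v x = 0) -> T v = 0.
have key (l : seq ('rV[R]_n * R)) v : test v -> {in l, forall p, null p} ->
    (forall x, v x != 0 -> exists2 p, p \in l & `|x - p.1| <= p.2) -> T v = 0.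
  elim: l v => [|p l IH] v tv nl vl.
    suff -> : v = fun=> 0 by exact: dist0.
    apply/funext => x; apply/eqP/negPn/negP => /vl[p].
    by rewrite in_nil.
  have [p0 np] : null p by apply: nl; rewrite mem_head.
  pose c := plateau p.1 p.2; have sc : smooth c by exact: smooth_plateau.
  have sc' : smooth (fun x => 1 - c x) by apply: (smoothB _ sc); exact: smooth_cst.
  have -> : v = fun x => c x *: v x + (1 - c x) *: v x.
    by apply/funext => x; rewrite -scalerDl addrC subrK scale1r.
  rewrite distD//; [|exact: test_mul|exact: test_mul].
  rewrite np; [|exact: test_mul|]; last first.
    by move=> x px; rewrite /c plateau0 ?scale0r// ltW.
  rewrite add0r; apply: IH; first exact: test_mul.
    by move=> q ql; apply: nl; rewrite in_cons ql orbT.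
  move=> x cv; have vx : v x != 0.
    by apply: contraNneq cv => ->; rewrite scaler0.
  have [q] := vl _ vx; rewrite in_cons => /orP[/eqP -> xq|ql xq]; last by exists q.
  by move: cv; rewrite /c plateau1// subrr scale0r eqxx.
have := tu.2; rewrite compact_cover => cu.
have [] := cu _ null (fun p => ball p.1 p.2).
- by move=> p [p0 _]; exact: ball_open.
- move=> x /[dup] sx /uT/contrapT[U [oU TU] Ux].
  have /nbhs_ballP[e /= e0 xeU] : nbhs x U by exact: open_nbhs_nbhs.
  exists (x, e / 4); last by apply: ballxx; rewrite divr_gt0.
  split => /=; first by rewrite divr_gt0.
  move=> v tv v0; apply: TU => //.
  apply: subset_trans (supp_sub v0) _ => y /= ye; apply: xeU.
  by rewrite -ball_normE /= distrC (le_lt_trans ye)//; lra.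
move=> D' Dn uD'; apply: (key (finmap.enum_fset D') u tu).
  by move=> p pD; have := Dn p pD; rewrite inE.
move=> x ux; have : supp u x by exact: subset_closure.
by move=> /uD'[p pD]; rewrite -ball_normE /= distrC => /ltW px; exists p.
Qed.

Lemma cutoff_exists (K : set 'rV[R]_n) : compact K -> exists chi, cutoff K chi.
Proof.
move=> cK; have [M [_ bM]] := compact_bounded cK.
pose r := Num.max (M + 1) 1; have r0 : 0 < r by rewrite lt_max ltr01 orbT.
exists (plateau 0 (r + 1)).
have r1 : 0 < r + 1 by rewrite addr_gt0.
split; first exact: smooth_plateau.
  apply: (subclosed_compact _ (@compact_norm_le R n (2 * (r + 1)))).
    exact: closed_closure.
  have cl : closed [set x : 'rV[R]_n | `|x| <= 2 * (r + 1)].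
    by have := @closed_norm_le 0 (2 * (r + 1)); under eq_fun do rewrite subr0.
  rewrite [X in _ `<=` X](iffLR (closure_id _) cl).
  apply: closureS => x /=; rewrite leNgt => h; apply/negP => rx; move/negP: h; apply.
  by rewrite plateau0// subr0 ltW.
exists [set x | `|x| < r + 1]; split.
- apply: (@open_comp _ _ (fun x : 'rV[R]_n => `|x|) [set y | y < r + 1]).
    by move=> y _; exact: norm_continuous.
  exact: open_lt.
- move=> x Kx /=; rewrite (@le_lt_trans _ _ (M + 1))//.
    by apply: (bM (M + 1)); rewrite ?ltrDl.
  by rewrite /r (@le_lt_trans _ _ (Num.max (M + 1) 1)) ?le_max ?lexx// ltrDl.
- by move=> x /= xr; rewrite plateau1// subr0 ltW.
Qed.

End vector_test_functions.

(** * Invariance of Lebesgue measure on row vectors *)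

Section measure_preserving_maps.
Context d1 d2 (X : measurableType d1) (Y : measurableType d2) (R : realType).
Context (mu : {measure set X -> \bar R}) (nu : {measure set Y -> \bar R}).
Context (tau : X -> Y) (mtau : measurable_fun setT tau).
Context (munu : forall A, measurable A -> mu (tau @^-1` A) = nu A).

Lemma ge0_integral_preserving (f : Y -> \bar R) : measurable_fun setT f ->
  (forall y, (0 <= f y)%E) -> (\int[mu]_x f (tau x) = \int[nu]_y f y)%E.
Proof.
move=> mf f0; rewrite -[LHS](@ge0_integral_pushforward _ _ _ _ _ _ mtau mu setT)//.
by apply: eq_measure_integral => A mA _; exact: munu.
Qed.

Lemma integral_preserving (f : Y -> \bar R) : measurable_fun setT f ->
  (\int[mu]_x f (tau x) = \int[nu]_y f y)%E.
Proof.
move=> mf; rewrite integralE [RHS]integralE.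
congr (_ - _)%E; rewrite -ge0_integral_preserving//.
- by apply: eq_integral => x _; rewrite ?funeposE ?funenegE.
- exact: measurable_funepos.
- by apply: eq_integral => x _; rewrite ?funeposE ?funenegE.
- exact: measurable_funeneg.
Qed.

Lemma Rintegral_preserving (f : Y -> R) : measurable_fun setT f ->
  \int[mu]_x f (tau x) = \int[nu]_y f y.
Proof.
move=> mf; rewrite /Rintegral; congr fine.
by apply: (integral_preserving (f := EFin \o f)); exact/measurable_EFinP.
Qed.

Lemma Lnorm_preserving (q : \bar R) (f : Y -> \bar R) : (0 <= q)%E ->
  measurable_fun setT f ->
  ('N[mu]_q[f \o tau] = 'N[nu]_q[f])%E.
Proof.
move=> q0 mf; rewrite unlock; case: q q0 => [r|_|] //=.
  move=> _; congr (_ `^ _)%E.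
  apply: (ge0_integral_preserving (f := fun y => (`|f y| `^ r)%E)).
    apply: (measurableT_comp (measurable_poweR r)); exact: measurableT_comp.
  by move=> y; exact: poweR_ge0.
rewrite -(munu measurableT) preimage_setT; case: ifPn => // _.
have ma : measurable_fun setT (abse \o f) by exact: measurableT_comp.
rewrite !ess_sup_inf.ess_supEmu0//; last first.
  exact: (measurableT_comp ma mtau).
congr ereal_inf; apply/seteqP; split => y /=; rewrite -munu//;
  by rewrite -[X in measurable X]setTI; apply: ma => //; exact: emeasurable_itv.
Qed.

End measure_preserving_maps.

Section leb_boxes.
Context (R : realType) (n : nat).

Definition box (B : 'I_n -> set R) := [set x : 'rV[R]_n | forall i, B i (x 0 i)].

Lemma measurable_box (B : 'I_n -> set R) : (forall i, measurable (B i)) -> measurable (box B).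
Proof.
move=> mB; have -> : box B = \bigcap_(i in [set: 'I_n]) ((fun x => x 0 i) @^-1` B i).
  by apply/seteqP; split => x /= h i; [move=> _|]; exact: h.
apply: fin_bigcap_measurable => // i _.
by rewrite -[X in measurable X]setTI; exact: measurable_coord_rV.
Qed.

Definition boxes : set (set 'rV[R]_n) :=
  [set X | exists2 B, (forall i, measurable (B i)) & X = box B].

Lemma measurable_boxesE : (measurable : set (set 'rV[R]_n)) = <<s boxes >>.
Proof.
apply/seteqP; split; last first.
  apply: smallest_sub; first exact: sigma_algebra_measurable.
  by move=> _ [B mB ->]; exact: measurable_box.
apply: smallest_sub; first exact: smallest_sigma_algebra.
move=> U oU; have [F ->] := open_bigcup_ratball oU.
pose GT := g_sigma_algebraType boxes.
rewrite bigcup_mkcond.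
apply: (@countable_bigcupT_measurable _ GT); first exact: countableP.
move=> q; case: ifPn => [_|_]; last exact: (@measurable0 _ GT).
apply: sub_sigma_algebra.
exists (fun i => ball (ratr (q.1 0 i) : R) (q.2.+1%:R^-1)).
  by move=> i; exact: measurable_ball.
apply/seteqP; split => x /=.
  by move=> [_ h] i; have := h 0 i; rewrite mxE.
move=> h; split; first by rewrite invr_gt0 ltr0n.
by move=> i j; rewrite (ord1 i) mxE; exact: h.
Qed.

Lemma boxes_setI_closed : setI_closed boxes.
Proof.
move=> _ _ [B mB ->] [C mC ->]; exists (fun i => B i `&` C i).
  by move=> i; exact: measurableI.
apply/seteqP; split => x /=; first by move=> [hB hC] i; split.
by move=> h; split => i; have [] := h i.
Qed.

Lemma prod_itv_lty (r : R) :
  (\prod_(i < n) @lebesgue_measure R `[(- r)%R, r]%classic < +oo)%E.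
Proof.
rewrite ltey_eq; apply/orP; left; elim/big_ind : _ => //.
- by move=> x y; exact: fin_numM.
- by move=> i _; rewrite lebesgue_measure_itv /=; case: ifPn.
Qed.

(** Boxes are stable under intersection and generate the Borel sets, and the
    cubes [-k, k]^n have finite measure and exhaust the space. *)
Lemma leb_unique (m : {measure set 'rV[R]_n -> \bar R}) :
  (forall B : 'I_n -> set R, (forall i, measurable (B i)) ->
     m (box B) = (\prod_(i < n) lebesgue_measure (B i))%E) ->
  forall A, measurable A -> m A = leb R n A.
Proof.
move=> mE; apply: (measure_unique boxes
    (fun k => box (fun=> `[- k%:R, k%:R]%classic))).
- exact: measurable_boxesE.
- exact: boxes_setI_closed.
- by move=> k; exists (fun=> `[- k%:R, k%:R]%classic).
- apply/seteqP; split => // x _; exists (Num.truncn `|x|).+1 => // i /=.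
  rewrite in_itv /= -ler_norml ltW//.
  apply: le_lt_trans (Num.Theory.truncnS_gt _).
  exact: normr_coord_le.
- by move=> _ [B mB ->]; rewrite mE// -leb_box.
- move=> k; rewrite mE//; exact: prod_itv_lty.
Qed.

Lemma leb_preserving (tau : 'rV[R]_n -> 'rV[R]_n) : measurable_fun setT tau ->
  (forall B : 'I_n -> set R, (forall i, measurable (B i)) ->
     leb R n (tau @^-1` box B) = (\prod_(i < n) lebesgue_measure (B i))%E) ->
  forall A, measurable A -> leb R n (tau @^-1` A) = leb R n A.
Proof.
move=> mtau tB.
exact: (leb_unique (m :=
  measure_function_pushforward__canonical__measure_function_Measure (leb R n) mtau)).
Qed.

Lemma measurable_coordwise (f : 'I_n -> R -> R) : (forall i, measurable_fun setT (f i)) ->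
  measurable_fun setT (fun x : 'rV[R]_n => \row_i f i (x 0 i)).
Proof.
move=> mf; apply: measurable_fun_rV => i.
rewrite (_ : (fun _ => _) = f i \o (fun x : 'rV[R]_n => x 0 i)); last first.
  by apply/funext => x /=; rewrite mxE.
by apply: measurableT_comp => //; exact: measurable_coord_rV.
Qed.

Lemma leb_coordwise (f : 'I_n -> R -> R) : (forall i, measurable_fun setT (f i)) ->
  (forall i B, measurable B -> lebesgue_measure (f i @^-1` B) = lebesgue_measure B :> \bar R) ->
  forall A, measurable A ->
    leb R n ((fun x : 'rV[R]_n => \row_i f i (x 0 i)) @^-1` A) = leb R n A.
Proof.
move=> mf fB; apply: leb_preserving; first exact: measurable_coordwise.
move=> B mB.
have -> : (fun x : 'rV[R]_n => \row_i f i (x 0 i)) @^-1` box B =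
    box (fun i => f i @^-1` B i).
  by apply/seteqP; split => x /= h i; have := h i; rewrite mxE.
rewrite leb_box; last first.
  by move=> i; rewrite -[X in measurable X]setTI; exact: mf.
by apply: eq_bigr => i _; exact: fB.
Qed.

Lemma lebesgue_shift (a : R) (B : set R) : measurable B ->
  lebesgue_measure ((fun t => t + a) @^-1` B) = lebesgue_measure B :> \bar R.
Proof.
move=> mB; have ma : measurable_fun setT (fun t : measurableTypeR R => t + a : measurableTypeR R).
  by apply: measurable_funD.
rewrite -[LHS]/(pushforward lebesgue_measure (fun t : measurableTypeR R => t + a : measurableTypeR R) B).
apply/esym.
apply: (@lebesgue_measure_unique R (measure_function_pushforward__canonical__measure_function_Measure
    (@lebesgue_measure R) ma)) => // _ [[x y] _ <-].
rewrite /= /pushforward.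
have -> : (fun t : R => t + a) @^-1` `]x, y] = `]x - a, y - a]%classic.
  by apply/seteqP; split => t /=; rewrite !in_itv /= ltrBlDr lerBrDr.
rewrite !lebesgue_measure_itv /= !lte_fin ltrD2r; case: ifPn => // _.
by rewrite -!EFinD; congr EFin; ring.
Qed.

Lemma measurable_shift_rV (a : 'rV[R]_n) : measurable_fun setT (fun x : 'rV[R]_n => x + a).
Proof.
have := @measurable_coordwise (fun i t => t + a 0 i).
rewrite (_ : (fun x : 'rV[R]_n => _) = fun x => x + a); last first.
  by apply/funext => x; apply/rowP => i; rewrite !mxE.
by apply => i; exact: measurable_funD.
Qed.

Lemma leb_shift (a : 'rV[R]_n) A : measurable A ->
  leb R n ((fun x : 'rV[R]_n => x + a) @^-1` A) = leb R n A.
Proof.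
have := @leb_coordwise (fun i t => t + a 0 i).
rewrite (_ : (fun x : 'rV[R]_n => _) = fun x => x + a); last first.
  by apply/funext => x; apply/rowP => i; rewrite !mxE.
apply => [i|i B mB]; [exact: measurable_funD|exact: lebesgue_shift].
Qed.

Definition mirror (P : pred 'I_n) (x : 'rV[R]_n) : 'rV[R]_n :=
  \row_i (if P i then - x 0 i else x 0 i).

Lemma measurable_mirror P : measurable_fun setT (mirror P).
Proof.
apply: (@measurable_coordwise (fun i t => if P i then - t else t)) => i.
case: (P i) => //; exact: oppr_measurable.
Qed.

Lemma leb_mirror P A : measurable A -> leb R n (mirror P @^-1` A) = leb R n A.
Proof.
apply: (@leb_coordwise (fun i t => if P i then - t else t)) => i.
  case: (P i) => //; exact: oppr_measurable.
move=> B mB; case: (P i) => //; exact: lebesgue_measureN.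
Qed.

Lemma closed_measurable_rV (F : set 'rV[R]_n) : closed F -> measurable F.
Proof.
by move=> cF; rewrite -[F]setCK; apply: measurableC; apply: open_measurable_rV; exact: closed_openC.
Qed.

Lemma measurable_norm_le (r : R) : measurable [set x : 'rV[R]_n | `|x| <= r].
Proof. by apply: closed_measurable_rV; apply: compact_closed => //; exact: compact_norm_le. Qed.

Lemma leb_norm_lty (r : R) : (leb R n [set x | (`|x| <= r)%R] < +oo)%E.
Proof.
apply: (@le_lt_trans _ _ (leb R n (box (fun=> `[- r, r]%classic)))).
  apply: le_measure; rewrite ?inE.
  - exact: measurable_norm_le.
  - by apply: measurable_box => i; exact: measurable_itv.
  - move=> x /= xr i; rewrite /= in_itv /= -ler_norml.
    by apply: le_trans xr; exact: normr_coord_le.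
rewrite leb_box; first exact: prod_itv_lty.
by move=> i; exact: measurable_itv.
Qed.

Lemma continuous_measurable_rV (f : 'rV[R]_n -> R) : continuous f -> measurable_fun setT f.
Proof.
move=> cf; apply: (measurability _ (RGenOInfty.measurableE R)).
move=> _ [_ [a ->] <-]; rewrite setTI; apply: open_measurable_rV.
apply: open_comp; first by move=> x _; exact: cf.
exact: interval_open.
Qed.

End leb_boxes.

Section insertion.
Context (R : realType) (n : nat) (i : 'I_n.+1).

(** Coordinates of R^(n+1) with the i-th one put first, so that Fubini applies
    along any coordinate axis. *)
Definition insert (p : R * 'rV[R]_n) : 'rV[R]_n.+1 :=
  \row_j oapp (p.2 0) p.1 (unlift i j).

Lemma insertE p : insert p 0 i = p.1.
Proof. by rewrite mxE unlift_none. Qed.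

Lemma insert_lift p j : insert p 0 (lift i j) = p.2 0 j.
Proof. by rewrite mxE liftK. Qed.

Lemma measurable_insert : measurable_fun setT insert.
Proof.
apply: measurable_fun_rV => k.
case: (unliftP i k) => [j ->|->].
  rewrite (_ : (fun _ => _) = (fun x : 'rV[R]_n => x 0 j) \o snd).
    apply: measurableT_comp; [exact: measurable_coord_rV|exact: measurable_snd].
  by apply/funext => p /=; rewrite insert_lift.
rewrite (_ : (fun _ => _) = fst); first exact: measurable_fst.
by apply/funext => p /=; rewrite insertE.
Qed.

Lemma leb_insert (A : set 'rV[R]_n.+1) : measurable A ->
  (@lebesgue_measure R \x leb R n)%E (insert @^-1` A) = leb R n.+1 A.
Proof.
move: A; apply: (leb_unique (m :=
  measure_function_pushforward__canonical__measure_function_Measure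
    (@lebesgue_measure R \x leb R n)%E measurable_insert)) => B mB.
rewrite /= /pushforward.
have -> : insert @^-1` box B = B i `*` box (fun j => B (lift i j)).
  apply/seteqP; split => [[a x] h|[a x] [Ba Bx] k] /=.
    split; first by have := h i; rewrite insertE.
    by move=> j; have := h (lift i j); rewrite insert_lift.
  by case: (unliftP i k) => [j ->|->]; rewrite ?insert_lift ?insertE.
rewrite product_measure1E; [|exact: mB|by apply: measurable_box => j; exact: mB].
by rewrite leb_box// [RHS](bigD1_ord i).
Qed.

Lemma ge0_integral_insert (f : 'rV[R]_n.+1 -> \bar R) : measurable_fun setT f ->
  (forall x, (0 <= f x)%E) ->
  (\int[leb R n.+1]_x f x = \int[leb R n]_y \int[lebesgue_measure]_t f (insert (t, y)))%E.
Proof.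
move=> mf f0; rewrite -(@ge0_integral_preserving _ _ _ _ R (@lebesgue_measure R \x leb R n)%E
  (leb R n.+1) _ measurable_insert leb_insert)//.
have mfi : measurable_fun setT (f \o insert).
  by apply: measurableT_comp => //; exact: measurable_insert.
exact: (@fubini_tonelli2 _ _ _ _ R (@lebesgue_measure R) (leb R n) (f \o insert) mfi (fun x => f0 _)).
Qed.

End insertion.

(** * The substitution r = sqrt (c^2 + s^2) *)

Section sqrt_substitution.
Context (R : realType).
Implicit Types (c s t : R).
Local Notation leb1 := (@lebesgue_measure R).

Definition hypot (c s : R) : R := Num.sqrt (c ^+ 2 + s ^+ 2).

Lemma hypot_ge0 c s : 0 <= hypot c s. Proof. exact: sqrtr_ge0. Qed.

Lemma hypot_sqr c s : hypot c s ^+ 2 = c ^+ 2 + s ^+ 2.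
Proof. by rewrite sqr_sqrtr// addr_ge0 ?sqr_ge0. Qed.

Lemma hypot_gt c s : 0 <= c -> 0 < s -> c < hypot c s.
Proof.
move=> c0 s0; rewrite -(@ltr_pXn2r _ 2)// ?nnegrE ?hypot_ge0// hypot_sqr.
by rewrite ltrDl exprn_gt0.
Qed.

Lemma continuous_hypot c : continuous (hypot c).
Proof.
move=> s; apply: (@continuous_comp _ _ _ (fun s => c ^+ 2 + s ^+ 2) Num.sqrt); last exact: sqrt_continuous.
by apply: continuousD; [exact: cst_continuous|exact: exprn_continuous].
Qed.

Lemma is_derive_hypot c s : 0 < c -> is_derive s 1 (hypot c) (s / hypot c s).
Proof.
move=> c0; have p0 : 0 < c ^+ 2 + s ^+ 2 by rewrite ltr_wpDr ?sqr_ge0 ?exprn_gt0.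
have d2 : is_derive s 1 (fun s => c ^+ 2 + s ^+ 2) (2 * s).
  have := is_deriveD (is_derive_cst (c ^+ 2) s (1 : R)) (is_deriveX 2 (is_derive_id s (1 : R))).
  by move/is_derive_eq; apply; rewrite add0r; exact: mulr1.
have := @is_derive1_comp _ Num.sqrt (fun s => c ^+ 2 + s ^+ 2) s _ _ (is_derive1_sqrt p0) d2.
move/is_derive_eq; apply; rewrite -/(hypot c s).
have h0 : hypot c s != 0 by rewrite gt_eqF// sqrtr_gt0.
by field.
Qed.

Lemma hypot_itv c (a b s : R) : 0 < c -> c <= a -> a < b -> 0 < s ->
  (a < hypot c s <= b) =
  (Num.sqrt (a ^+ 2 - c ^+ 2) < s <= Num.sqrt (b ^+ 2 - c ^+ 2)).
Proof.
move=> c0 ca ab s0.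
have a0 : 0 <= a by rewrite (le_trans (ltW c0)).
have b0 : 0 <= b by rewrite (le_trans a0)// ltW.
have ac : 0 <= a ^+ 2 - c ^+ 2 by rewrite subr_ge0 ler_pXn2r// nnegrE// ltW.
have bc : 0 <= b ^+ 2 - c ^+ 2.
  by rewrite (le_trans ac)// lerB// ler_pXn2r// ltW.
rewrite -(@ltr_pXn2r _ 2 _ a)// ?nnegrE ?hypot_ge0//.
rewrite -(@ler_pXn2r _ 2 _ (hypot c s))// ?nnegrE ?hypot_ge0//.
rewrite -(@ltr_pXn2r _ 2 _ (Num.sqrt _) s)// ?nnegrE ?sqrtr_ge0 ?(ltW s0)//.
rewrite -(@ler_pXn2r _ 2 _ s)// ?nnegrE ?sqrtr_ge0 ?(ltW s0)//.
rewrite hypot_sqr !sqr_sqrtr//.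
by apply/andP/andP => -[h1 h2]; split; lra.
Qed.

Lemma measurable_hypot c : measurable_fun setT (hypot c).
Proof. by apply: continuous_measurable_fun; exact: continuous_hypot. Qed.

(** The derivative of hypot c, that is, the Jacobian of the substitution. *)
Definition hypot_weight c s : R := s / hypot c s.

Lemma continuous_hypot_weight c : 0 < c -> continuous (hypot_weight c).
Proof.
move=> c0; apply: (@continuousM_fun _ _ id (fun s => (hypot c s)^-1)).
  by move=> s; exact: cvg_id.
apply: continuousV_fun; last exact: continuous_hypot.
by move=> s; rewrite gt_eqF// sqrtr_gt0 ltr_wpDr ?sqr_ge0 ?exprn_gt0.
Qed.

Lemma integral_hypot_weight c (a b : R) : 0 < c -> c <= a -> a < b ->
  (\int[leb1]_(s in `]Num.sqrt (a ^+ 2 - c ^+ 2)%R, Num.sqrt (b ^+ 2 - c ^+ 2)%R])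
     (hypot_weight c s)%:E = (b - a)%:E)%E.
Proof.
move=> c0 ca ab.
have a0 : 0 <= a by rewrite (le_trans (ltW c0)).
have b0 : 0 <= b by rewrite (le_trans a0)// ltW.
have ac : 0 <= a ^+ 2 - c ^+ 2 by rewrite subr_ge0 ler_pXn2r// nnegrE// ltW.
have acbc : a ^+ 2 - c ^+ 2 < b ^+ 2 - c ^+ 2 by rewrite ltrD2r ltr_pXn2r// nnegrE.
set x := Num.sqrt _; set y := Num.sqrt _.
have xy : x < y by rewrite ltr_sqrt// (le_lt_trans ac).
rewrite integral_itv_obnd_cbnd; last first.
  apply: measurable_funTS; apply/measurable_EFinP; apply: continuous_measurable_fun.
  exact: continuous_hypot_weight.
rewrite (@continuous_FTC2 _ _ (hypot c) x y xy).
- have E z : c <= z -> hypot c (Num.sqrt (z ^+ 2 - c ^+ 2)) = z.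
    move=> cz; have z0 : 0 <= z by rewrite (le_trans (ltW c0)).
    rewrite /hypot sqr_sqrtr; first by rewrite addrC subrK sqrtr_sqr ger0_norm.
    by rewrite subr_ge0 ler_pXn2r// nnegrE ltW.
  by rewrite !E// (le_trans ca)// ltW.
- by apply: continuous_subspaceT; exact: continuous_hypot_weight.
- split.
  + by move=> s _; have [] := is_derive_hypot s c0.
  + by apply: cvg_at_right_filter; exact: continuous_hypot.
  + by apply: cvg_at_left_filter; exact: continuous_hypot.
- by move=> s _; rewrite derive1E; have [_ ->] := is_derive_hypot s c0.
Qed.

Section subst.
Context (c : R) (c0 : 0 < c).

(* Slices of the region E below the graph of hypot_weight c have this function as
   their measure. Hence on ]c, +oo[ the image of planar Lebesgue measure under tau is
   the image under hypot c of the measure of density hypot_weight c. Points off E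
   are sent to c, outside of this interval. *)
Let E := [set p : R * R | (0 < p.1) && (0 < p.2) && (p.2 < hypot_weight c p.1)].

Let tau (p : measurableTypeR R * measurableTypeR R) : measurableTypeR R :=
  if (0 < p.1) && (0 < p.2) && (p.2 < hypot_weight c p.1) then hypot c p.1 else c.

Let mtau : measurable_fun setT tau.
Proof.
apply: measurable_fun_ifT.
- apply: measurable_and; first apply: measurable_and.
  + by apply: measurable_fun_ltr.
  + by apply: measurable_fun_ltr.
  + apply: measurable_fun_ltr => //; apply: measurableT_comp => //.
    by apply: continuous_measurable_fun; exact: continuous_hypot_weight.
- by apply: measurableT_comp => //; exact: measurable_hypot.
- exact: measurable_cst.
Qed.

Let nu := measure_function_pushforward__canonical__measure_function_Measure
  (leb1 \x leb1)%E mtau.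

Let nuE (phi : R -> \bar R) : measurable_fun setT phi -> (forall r, (0 <= phi r)%E) ->
  (\int[nu]_(r in `]c, +oo[) phi r =
   \int[leb1]_(s in `]0%R, +oo[) (phi (hypot c s) * (hypot_weight c s)%:E))%E.
Proof.
move=> mphi phi0.
have tauE : tau @^-1` `]c, +oo[ = E.
  apply/seteqP; split => -[s v] /=; rewrite /tau /= in_itv /= andbT.
    by case: ifPn => //; rewrite ltxx.
  by move=> Esv; rewrite Esv hypot_gt ?ltW//; case/andP: Esv => /andP[].
have -> : (\int[nu]_(r in `]c, +oo[) phi r = \int[leb1 \x leb1]_(p in tau @^-1` `]c, +oo[) (phi \o tau) p)%E.
  by apply: ge0_integral_pushforward => //; exact: measurable_funTS.
rewrite tauE integral_mkcond.
have mE : measurable E.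
  rewrite -tauE -[X in measurable X]setTI; exact: mtau.
have mf : measurable_fun setT ((phi \o tau) \_ E).
  by apply/(measurable_restrictT _ mE); apply: measurable_funTS; exact: measurableT_comp.
have f0 p : (0 <= ((phi \o tau) \_ E) p)%E by rewrite patchE; case: ifPn => // _; exact: phi0.
apply: etrans (@fubini_tonelli1 _ _ _ _ R leb1 leb1 _ mf f0) _.
rewrite [RHS]integral_mkcond; apply: eq_integral => s _.
rewrite /fubini_F [RHS]patchE; have [s0|s0] := boolP (0 < s); last first.
  rewrite memNset; last by rewrite /= in_itv /= andbT; exact/negP.
  apply: integral0_eq => v _; rewrite patchE memNset//.
  by rewrite /E /= (negbTE s0).
rewrite mem_set; last by rewrite /= in_itv /= andbT.
rewrite (_ : (fun y => _) = (fun v => (phi (hypot c s))) \_ `]0%R, hypot_weight c s[).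
  rewrite -integral_mkcond integral_cst//= lebesgue_measure_itv /= lte_fin.
  by rewrite divr_gt0 ?sqrtr_gt0 ?ltr_wpDr ?sqr_ge0 ?exprn_gt0// oppr0 adde0.
apply/funext => v; rewrite !patchE.
have -> : ((s, v) \in E) = (v \in `]0%R, hypot_weight c s[%classic).
  by apply/idP/idP; rewrite !inE /E /= in_itv /= s0.
case: ifPn => //; rewrite inE /= in_itv /= => v0.
by rewrite /tau /= s0 v0.
Qed.

Let nu_itv (a b : R) : c <= a -> nu `]a, b]%classic = leb1 `]a, b]%classic.
Proof.
move=> ca; have [ab|ba] := ltP a b; last first.
  by rewrite set_itv_ge ?measure0// bnd_simp -leNgt.
have D : `]a, b]%classic `<=` (`]c, +oo[%classic : set R).
  by move=> r /=; rewrite !in_itv /= andbT => /andP[+ _]; exact: le_lt_trans.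
have -> : nu `]a, b]%classic = (\int[nu]_(r in `]c, +oo[) (\1_`]a, b]%classic r)%:E)%E.
  by rewrite integral_indic//= setIidl.
rewrite nuE; last 2 first.
- by apply/measurable_EFinP; exact: measurable_indic.
- by move=> r; rewrite lee_fin.
rewrite lebesgue_measure_itv /= lte_fin ab -EFinB -(integral_hypot_weight c0 ca ab).
rewrite integral_mkcond [RHS]integral_mkcond; apply: eq_integral => s _.
rewrite !patchE; have [s0|s0] := ltP 0 s; last first.
  rewrite !memNset//= in_itv /=; last by rewrite andbT ltNge s0.
  by apply/negP; rewrite negb_and -leNgt (le_trans s0) ?sqrtr_ge0.
rewrite mem_set; last by rewrite /= in_itv /= s0.
have := hypot_itv c0 ca ab s0.
case: (boolP (a < hypot c s <= b)) => h /esym h'; rewrite indicE.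
  by rewrite !mem_set ?mul1e//= in_itv.
by rewrite !memNset ?mul0e//= in_itv /=; apply/negP; rewrite ?h'.
Qed.

Let nu_leb (A : set (measurableTypeR R)) : measurable A -> A `<=` `]c, +oo[ -> nu A = leb1 A.
Proof.
have mD : measurable (`]c, +oo[%classic : set (measurableTypeR R)) by exact: measurable_itv.
have mDc := measurableC mD.
(* Uniqueness of Lebesgue measure is about measures on the whole line, so nu is
   completed by Lebesgue measure off ]c, +oo[. *)
pose m' := measure_add (mrestr nu mD) (mrestr leb1 mDc).
have leb_m' : forall A, measurable A -> leb1 A = m' A.
  apply: lebesgue_measure_unique => _ [[a b] _ <-].
  rewrite [RHS]measure_addE /= /mrestr.
  have mab : measurable (`]a, b]%classic : set (measurableTypeR R)) by exact: measurable_itv.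
  rewrite (measureDI leb1 mab mD) addeC; congr (_ + _)%E.
  have -> : `]a, b] `&` `]c, +oo[ = `]Num.max a c, b]%classic :> set R.
    apply/seteqP; split => r /=; rewrite !in_itv /= andbT gt_max.
      by move=> [/andP[-> ->] ->].
    by move=> /andP[/andP[-> ->] ->].
  by rewrite nu_itv// le_max lexx orbT.
move=> mA AD; rewrite leb_m'// [RHS]measure_addE /= /mrestr [A `&` _]setIidl//.
rewrite (_ : A `&` ~` _ = set0) ?measure0 ?adde0//.
by apply/disjoints_subset; rewrite setCK.
Qed.

(** Change of variables r = hypot c s for a merely measurable phi: nu and Lebesgue
    measure agree on the intervals of ]c, +oo[ by the fundamental theorem of
    calculus, hence on its Borel sets. *)
Lemma gt0_integral_hypot (phi : R -> \bar R) : measurable_fun setT phi ->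
  (forall r, (0 <= phi r)%E) ->
  (\int[leb1]_(r in `]c, +oo[) phi r =
   \int[leb1]_(s in `]0%R, +oo[) (phi (hypot c s) * (hypot_weight c s)%:E))%E.
Proof.
move=> mphi phi0; rewrite -nuE//; apply: eq_measure_integral => A mA AD.
by rewrite nu_leb.
Qed.

End subst.

Lemma ge0_integral_hypot c (phi : R -> \bar R) : 0 <= c -> measurable_fun setT phi ->
  (forall r, (0 <= phi r)%E) ->
  (\int[leb1]_(r in `]c, +oo[) phi r =
   \int[leb1]_(s in `]0%R, +oo[) (phi (hypot c s) * (hypot_weight c s)%:E))%E.
Proof.
rewrite le_eqVlt => /orP[/eqP<- mphi phi0|c0 mphi phi0].
  apply: eq_integral => s; rewrite inE /= in_itv /= andbT => s0.
  rewrite /hypot_weight /hypot expr0n add0r sqrtr_sqr gtr0_norm//.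
  by rewrite divff ?gt_eqF// mule1.
exact: gt0_integral_hypot.
Qed.

Lemma ge0_integral_fold (f : R -> \bar R) : measurable_fun setT f ->
  (forall t, (0 <= f t)%E) ->
  (\int[leb1]_t f t = \int[leb1]_(s in `]0%R, +oo[) (f s + f (- s)%R))%E.
Proof.
move=> mf f0.
have mN : measurable_fun setT (fun s => f (- s)) by apply: measurableT_comp => //; exact: oppr_measurable.
rewrite ge0_integralD//; last 2 first.
- exact: measurable_funTS.
- exact: measurable_funTS.
rewrite -(setUv `]0%R, +oo[%classic) ge0_integral_setU//= ; last 3 first.
- exact: measurableC.
- by rewrite setUv.
- exact/disj_setPCl.
congr (_ + _)%E; rewrite setCitvr.
have := @ge0_integration_by_substitution0 R (fun s => f (- s)) mN (fun r => f0 _).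
under [in RHS]eq_integral do rewrite opprK.
by move=> <-; rewrite integral_itv_obnd_cbnd//; exact: measurable_funTS.
Qed.
End sqrt_substitution.

(** * A radial kernel along one coordinate *)

Section inverse.
Context (R : realType).

Lemma measurable_invr : measurable_fun setT (fun x : R => x^-1).
Proof.
rewrite -(setUv [set (0 : R)]); apply/measurable_funU => //.
- exact: measurableC.
split; first exact: measurable_fun_set1.
apply: open_continuous_measurable_fun.
  by apply: closed_openC; exact: closed_eq.
by move=> x; rewrite inE /= => /eqP x0; exact: inv_continuous.
Qed.

End inverse.

Section bounded_multiplier.
Context d (X : measurableType d) (R : realType) (mu : {measure set X -> \bar R}).
Implicit Types (g b : X -> R).

Lemma integrable_mul_bounded (C : R) g b : mu.-integrable setT (EFin \o g) ->
  measurable_fun setT b -> (forall x, `|b x| <= C) ->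
  mu.-integrable setT (EFin \o (fun x => g x * b x)).
Proof.
move=> ig mb bC; have mg : measurable_fun setT g.
  by apply/measurable_EFinP; exact: measurable_int ig.
apply: (le_integrable measurableT _ _ (integrableZl measurableT C ig)).
  by apply/measurable_EFinP; exact: measurable_funM.
move=> x _ /=; rewrite lee_fin !normrM mulrC ler_wpM2r//.
by rewrite (le_trans (bC x))// ler_norm.
Qed.

Lemma Rintegral_mul_bounded (C : R) g b : mu.-integrable setT (EFin \o g) ->
  (forall x, 0 <= g x) -> measurable_fun setT b -> (forall x, `|b x| <= C) ->
  `|\int[mu]_x (g x * b x)| <= C * \int[mu]_x g x.
Proof.
move=> ig g0 mb bC; have igb := integrable_mul_bounded ig mb bC.
apply: (le_trans (le_normr_Rintegral measurableT igb)).
rewrite -RintegralZl//; apply: le_Rintegral => //.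
- exact: integrable_norm.
- exact: (integrableZl measurableT C ig).
- by move=> x _; rewrite normrM ger0_norm// mulrC ler_wpM2r.
Qed.

End bounded_multiplier.

Section euclidean_norm.
Context (R : realType).

Lemma enorm_ge0 n (x : 'rV[R]_n) : 0 <= enorm x.
Proof. exact: sqrtr_ge0. Qed.

Lemma enorm_sqr n (x : 'rV[R]_n) : enorm x ^+ 2 = \sum_i x 0 i ^+ 2.
Proof. by rewrite sqr_sqrtr// sumr_ge0// => i _; exact: sqr_ge0. Qed.

Lemma coord_le_enorm n (x : 'rV[R]_n) i : `|x 0 i| <= enorm x.
Proof.
rewrite -(@ler_pXn2r _ 2)// ?nnegrE ?enorm_ge0// enorm_sqr real_normK ?num_real//.
by rewrite (bigD1 i)//= lerDl sumr_ge0// => j _; exact: sqr_ge0.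
Qed.

Lemma norm_le_enorm n (x : 'rV[R]_n) : `|x| <= enorm x.
Proof. by apply: norm_rV_le; [exact: enorm_ge0|exact: coord_le_enorm]. Qed.

Lemma enormN n (x : 'rV[R]_n) : enorm (- x) = enorm x.
Proof. by congr Num.sqrt; apply: eq_bigr => i _; rewrite mxE sqrrN. Qed.

Lemma enorm_eq0 n (x : 'rV[R]_n) : enorm x = 0 -> x = 0.
Proof.
by move=> x0; apply/eqP; rewrite -normr_le0 -x0; exact: norm_le_enorm.
Qed.

Lemma continuous_enorm n : continuous (@enorm R n).
Proof.
move=> x; apply: (@continuous_comp _ _ _ (fun x : 'rV[R]_n => \sum_i x 0 i ^+ 2) Num.sqrt); last exact: sqrt_continuous.
have H (s : seq 'I_n) : continuous (fun x : 'rV[R]_n => \sum_(i <- s) x 0 i ^+ 2).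
  elim: s => [|i s IH].
    by under eq_fun do rewrite big_nil; exact: cst_continuous.
  under eq_fun do rewrite big_cons expr2.
  by apply: continuousD_fun => //; apply: continuousM_fun; exact: coord_continuous.
exact: H.
Qed.

Lemma measurable_enorm n : measurable_fun setT (@enorm R n).
Proof. by apply: continuous_measurable_rV; exact: continuous_enorm. Qed.

Lemma measurable_enorm_ge n (d : R) : measurable [set x : 'rV[R]_n | d <= enorm x].
Proof.
have := @measurable_enorm n measurableT `[d, +oo[%classic (measurable_itv _).
rewrite setTI; congr measurable.
by apply/seteqP; split => x /=; rewrite in_itv /= andbT.
Qed.

Lemma enorm_insert n (i : 'I_n.+1) (t : R) (y : 'rV[R]_n) :
  enorm (insert i (t, y)) = hypot (enorm y) t.
Proof.
congr Num.sqrt; rewrite (bigD1_ord i)//= insertE enorm_sqr addrC; congr (_ + _).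
by apply: eq_bigr => j _; rewrite insert_lift.
Qed.

Lemma enorm_mirror n P (x : 'rV[R]_n) : enorm (mirror P x) = enorm x.
Proof.
congr Num.sqrt; apply: eq_bigr => i _; rewrite mxE.
by case: (P i); rewrite ?sqrrN.
Qed.

Lemma mirror_insert n (i : 'I_n.+1) (t : R) (y : 'rV[R]_n) :
  mirror (pred1 i) (insert i (t, y)) = insert i (- t, y).
Proof.
apply/rowP => k; rewrite mxE; case: (unliftP i k) => [j ->|->] /=.
  by rewrite eq_sym (negbTE (neq_lift _ _)) !insert_lift.
by rewrite eqxx !insertE.
Qed.

Lemma insert_line n (i : 'I_n.+1) (t : R) (y : 'rV[R]_n) :
  insert i (t, y) = insert i (0, y) + t *: delta_mx 0 i.
Proof.
apply/rowP => k; rewrite !mxE eqxx /=; case: (unliftP i k) => [j ->|->] /=.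
  by rewrite eq_sym (negbTE (neq_lift _ _)) mulr0 addr0.
by rewrite eqxx mulr1 add0r.
Qed.

Lemma origin_box n : [set 0] = box (fun _ : 'I_n => [set 0 : R]).
Proof.
apply/seteqP; split => x /=; first by move=> -> i; rewrite mxE.
by move=> x0; apply/rowP => i; rewrite x0 mxE.
Qed.

Lemma measurable_origin n : measurable [set (0 : 'rV[R]_n)].
Proof. by rewrite origin_box; exact: measurable_box. Qed.

Lemma leb_origin n : (leb R n.+1 [set 0%R : 'rV[R]_n.+1] = 0)%E.
Proof.
by rewrite origin_box leb_box//; rewrite (bigD1 ord0)//= lebesgue_measure_set1 mul0e.
Qed.

End euclidean_norm.

Section radial_kernel.
Context (R : realType) (h : R -> R) (mh : measurable_fun setT h) (h0 : forall r, 0 <= h r).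
Local Notation leb1 := (@lebesgue_measure R).

Definition tail_fun (a r : R) : R := if (0 < r) && (a < r) then h r / r else 0.

(** Up to the dimension factor, the averaging kernel of the radial profile h at
    distance a from the origin. *)
Definition tail (a : R) : \bar R := \int[leb1]_r (tail_fun a r)%:E.

Lemma tail_fun_ge0 a r : 0 <= tail_fun a r.
Proof. by rewrite /tail_fun; case: ifP => // /andP[r0 _]; rewrite divr_ge0// ltW. Qed.

Lemma tail_ge0 a : (0 <= tail a)%E.
Proof. by apply: integral_ge0 => r _; rewrite lee_fin tail_fun_ge0. Qed.

Lemma measurable_tail_fun : measurable_fun setT (fun p : R * R => tail_fun p.1 p.2).
Proof.
apply: measurable_fun_ifT.
- by apply: measurable_and; apply: measurable_fun_ltr.
- apply: measurable_funM; first exact: measurableT_comp.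
  apply: measurableT_comp => //; exact: measurable_invr.
- exact: measurable_cst.
Qed.

Lemma measurable_tail : measurable_fun setT tail.
Proof.
have mf : measurable_fun setT (EFin \o (fun p : R * R => tail_fun p.1 p.2)).
  by apply/measurable_EFinP; exact: measurable_tail_fun.
exact: (@measurable_fun_fubini_tonelli_F _ _ _ _ R leb1 _ mf (fun p => tail_fun_ge0 _ _)).
Qed.

(** The vector field h(|y|) y / |y|^2 has this i-th coordinate at height s on a line
    parallel to the i-th axis at distance c from the origin. *)
Definition slice (c s : R) : R := h (hypot c s) * s / hypot c s ^+ 2.

Lemma measurable_slice c : measurable_fun setT (slice c).
Proof.
apply: measurable_funM.
  apply: measurable_funM => //; apply: measurableT_comp => //; exact: measurable_hypot.
apply: measurableT_comp; first exact: measurable_invr.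
by apply: measurable_funX; exact: measurable_hypot.
Qed.

(** After the substitution r = hypot c s, the condition r > hypot c t reads
    s > |t|, and dr / r becomes s ds / (c^2 + s^2). *)
Lemma tail_hypot c t : 0 <= c ->
  tail (hypot c t) = (\int[leb1]_s (if (0 < s)%R && (`|t| < s)%R then slice c s else 0)%:E)%E.
Proof.
move=> c0.
pose phi r := (tail_fun (hypot c t) r)%:E.
have mphi : measurable_fun setT phi.
  apply/measurable_EFinP.
  exact: (measurableT_comp measurable_tail_fun (pair1_measurable (hypot c t))).
have hc : c <= hypot c t.
  by rewrite -(@ler_pXn2r _ 2)// ?nnegrE ?hypot_ge0// hypot_sqr lerDl sqr_ge0.
transitivity (\int[leb1]_(r in `]c, +oo[) phi r)%E.
  rewrite [RHS]integral_mkcond; apply: eq_integral => r _; rewrite patchE /phi.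
  have [cr|rc] := ltP c r; first by rewrite mem_set//= in_itv /= cr.
  rewrite memNset//=; last by rewrite in_itv /= andbT; apply/negP; rewrite -leNgt.
  by rewrite /tail_fun (ltNge (hypot c t)) (le_trans rc hc) andbF.
rewrite ge0_integral_hypot//; last by move=> r; rewrite lee_fin tail_fun_ge0.
rewrite integral_mkcond; apply: eq_integral => s _; rewrite patchE.
have [s0|s0] := ltP 0 s; last first.
  by rewrite memNset//= in_itv /= andbT; apply/negP; rewrite -leNgt.
rewrite mem_set /= ?in_itv /= ?s0// /phi -EFinM /tail_fun.
have -> : 0 < hypot c s by exact: le_lt_trans c0 (hypot_gt c0 s0).
have -> : (hypot c t < hypot c s) = (`|t| < s).
  rewrite -(@ltr_pXn2r _ 2)// ?nnegrE ?hypot_ge0// !hypot_sqr ltrD2l.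
  by rewrite -[t ^+ 2]real_normK ?num_real// ltr_pXn2r// nnegrE// ltW.
rewrite andTb; case: ifP => _; last by rewrite mul0r.
rewrite /slice /hypot_weight; congr EFin; rewrite expr2 invfM; ring.
Qed.

Lemma integral_derive (U W : R -> R) (s : R) : continuous W ->
  (forall t : R, is_derive t 1 U (W t)) -> 0 < s ->
  (\int[leb1]_(t in `](- s)%R, s[) (W t)%:E = (U s - U (- s))%:E)%E.
Proof.
move=> cW dU s0; have Ns : - s < s by rewrite gtrN.
have cU : continuous U.
  move=> t; apply: differentiable_continuous; apply/derivable1_diffP.
  by have [] := dU t.
have mW : measurable_fun setT (EFin \o W).
  by apply/measurable_EFinP; exact: continuous_measurable_fun.
rewrite integral_itv_obnd_cbnd; last exact: measurable_funTS.
rewrite integral_itv_bndo_bndc; last exact: measurable_funTS.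
rewrite (@continuous_FTC2 _ _ U (- s) s Ns) ?EFinB//.
- exact: continuous_subspaceT.
- split.
  + by move=> t _; have [] := dU t.
  + by apply: cvg_at_right_filter; exact: cU.
  + by apply: cvg_at_left_filter; exact: cU.
- by move=> t _; rewrite derive1E; have [_ ->] := dU t.
Qed.

Lemma increments_ge0 (U W : R -> R) (s : R) : continuous W -> (forall t, 0 <= W t) ->
  (forall t : R, is_derive t 1 U (W t)) -> 0 < s -> 0 <= U s - U (- s).
Proof.
move=> cW W0 dU s0; rewrite -lee_fin -(integral_derive cW dU s0).
by apply: integral_ge0 => t _; rewrite lee_fin.
Qed.

Lemma slice_ge0 c s : 0 <= s -> 0 <= slice c s.
Proof. by move=> s0; rewrite divr_ge0 ?mulr_ge0 ?exprn_ge0 ?hypot_ge0. Qed.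

(** By tail_hypot the left-hand side is the integral of slice c s * W t over the
    region |t| < s; integrating in t first produces the increments of U. *)
Lemma line_identity c (U W : R -> R) : 0 <= c -> continuous W -> (forall t, 0 <= W t) ->
  (forall t : R, is_derive t 1 U (W t)) ->
  (\int[leb1]_t (tail (hypot c t) * (W t)%:E) =
   \int[leb1]_(s in `]0%R, +oo[) (slice c s * (U s - U (- s)%R))%:E)%E.
Proof.
move=> c0 cW W0 dU.
pose f (p : R * R) := (if (0 < p.2) && (`|p.1| < p.2) then slice c p.2 * W p.1 else 0)%:E.
have mf : measurable_fun setT f.
  apply/measurable_EFinP; apply: measurable_fun_ifT.
  - apply: measurable_and; first by apply: measurable_fun_ltr.
    by apply: measurable_fun_ltr => //; apply: measurableT_comp => //; exact: measurableT_comp.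
  - apply: measurable_funM; first by apply: measurableT_comp => //; exact: measurable_slice.
    by apply: measurableT_comp => //; exact: continuous_measurable_fun.
  - exact: measurable_cst.
have f0 p : (0 <= f p)%E.
  rewrite lee_fin; case: ifP => // /andP[s0 _].
  by rewrite mulr_ge0// slice_ge0// ltW.
have mWc : measurable_fun setT W by exact: continuous_measurable_fun.
have msl (b : R) : measurable_fun setT (fun s : R => (if (0 < s)%R && (b < s)%R then slice c s else 0)%:E).
  apply/measurable_EFinP; apply: measurable_fun_ifT.
  - by apply: measurable_and; apply: measurable_fun_ltr.
  - exact: measurable_slice.
  - exact: measurable_cst.
transitivity (\int[leb1]_t \int[leb1]_s f (t, s))%E.
  apply: eq_integral => t _; rewrite tail_hypot// muleC -ge0_integralZl_EFin//.
  - apply: eq_integral => s _; rewrite /f /= -EFinM; case: ifP => _; last by rewrite mulr0.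
    by rewrite mulrC.
  - by move=> s _; rewrite lee_fin; case: ifP => // /andP[s0 _]; rewrite slice_ge0// ltW.
  - exact: msl.
have := @fubini_tonelli _ _ _ _ R leb1 leb1 _ mf f0.
rewrite /fubini_F /fubini_G => ->.
rewrite [RHS]integral_mkcond; apply: eq_integral => s _; rewrite patchE.
have [s0|s0] := ltP 0 s; last first.
  rewrite memNset//=; last by rewrite in_itv /= andbT; apply/negP; rewrite -leNgt.
  by apply: integral0_eq => t _; rewrite /f /= ltNge s0.
rewrite mem_set /= ?in_itv /= ?s0// EFinM -(integral_derive cW dU s0).
rewrite -ge0_integralZl_EFin//.
- rewrite [RHS]integral_mkcond; apply: eq_integral => t _; rewrite patchE /f /= s0 /=.
  have -> : (t \in `](- s)%R, s[%classic) = (`|t| < s).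
    by apply/idP/idP; rewrite inE /= in_itv /= ltr_norml.
  by case: ifP.
- by move=> t _; rewrite lee_fin.
- by apply: measurable_funTS; apply/measurable_EFinP.
- by rewrite slice_ge0// ltW.
Qed.

Context (m : nat) (i : 'I_m.+1).
Implicit Types (u W : 'rV[R]_m.+1 -> R) (y : 'rV[R]_m.+1).

Definition radial_density y : R := h (enorm y) * y 0 i / enorm y ^+ 2.

Lemma measurable_radial_density : measurable_fun setT radial_density.
Proof.
apply: measurable_funM.
  apply: measurable_funM; last exact: measurable_coord_rV.
  by apply: measurableT_comp => //; exact: measurable_enorm.
apply: measurableT_comp; first exact: measurable_invr.
by apply: measurable_funX; exact: measurable_enorm.
Qed.

(** Integration by parts against tail, whose gradient is minus the radial density.
    It is line_identity on all lines parallel to the i-th axis. Folding each line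
    at its point nearest to the origin brings in the reflection and makes the
    integrand on the right nonnegative, so that Tonelli's theorem applies. *)
Lemma ge0_kernel_identity u W : continuous u -> continuous W -> (forall y, 0 <= W y) ->
  (forall y, is_derive y (delta_mx 0 i : 'rV[R]_m.+1) u (W y)) ->
  (2%:E * \int[leb R m.+1]_y (tail (enorm y) * (W y)%:E) =
   \int[leb R m.+1]_y (radial_density y * (u y - u (mirror (pred1 i) y)))%:E)%E.
Proof.
move=> cu cW W0 du.
have mW : measurable_fun setT W by exact: continuous_measurable_rV.
have mu' : measurable_fun setT u by exact: continuous_measurable_rV.
have mtW : measurable_fun setT (fun y : 'rV[R]_m.+1 => tail (enorm y) * (W y)%:E)%E.
  apply: emeasurable_funM; last exact/measurable_EFinP.
  by apply: (measurableT_comp measurable_tail); exact: measurable_enorm.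
have mQ : measurable_fun setT
    (fun y : 'rV[R]_m.+1 => (radial_density y * (u y - u (mirror (pred1 i) y)))%:E).
  apply/measurable_EFinP; apply: measurable_funM; first exact: measurable_radial_density.
  apply: measurable_funB => //; apply: measurableT_comp => //; exact: measurable_mirror.
pose U (y' : 'rV[R]_m) t := u (insert i (t, y')).
pose w (y' : 'rV[R]_m) t := W (insert i (t, y')).
have ins_cont (y' : 'rV[R]_m) : continuous (fun t : R => insert i (t, y')).
  rewrite (_ : (fun t : R => _) = fun t : R => insert i (0, y') + t *: delta_mx 0 i).
    move=> t; apply: cvgD; first exact: cvg_cst.
    by apply: (@cvgZr_tmp _ _ _ _ _ (fun t : R => t)); exact: cvg_id.
  by apply/funext => t; exact: insert_line.
have cw (y' : 'rV[R]_m) : continuous (w y').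
  move=> t; apply: (@continuous_comp _ _ _ (fun t => insert i (t, y')) W) => //.
    exact: ins_cont.
  exact: cW.
have dU (y' : 'rV[R]_m) (t : R) : is_derive t 1 (U y') (w y' t).
  have [du1 du2] := du (insert i (0, y') + t *: delta_mx 0 i).
  have := is_derive_line du1; rewrite du2 -insert_line.
  by congr is_derive; apply/funext => s; rewrite /U [in RHS]insert_line.
have key (y' : 'rV[R]_m) (s : R) : 0 < s -> radial_density (insert i (s, y')) *
    (u (insert i (s, y')) - u (mirror (pred1 i) (insert i (s, y')))) =
    slice (enorm y') s * (U y' s - U y' (- s)).
  by move=> s0; rewrite /radial_density enorm_insert insertE mirror_insert.
have keyN (y' : 'rV[R]_m) (s : R) : radial_density (insert i (- s, y')) *
    (u (insert i (- s, y')) - u (mirror (pred1 i) (insert i (- s, y')))) =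
    slice (enorm y') s * (U y' s - U y' (- s)).
  rewrite /radial_density enorm_insert insertE mirror_insert opprK /slice /U.
  rewrite (_ : hypot (enorm y') (- s) = hypot (enorm y') s); first by rewrite /=; ring.
  by rewrite /hypot sqrrN.
have Q0 y : (0 <= (radial_density y * (u y - u (mirror (pred1 i) y)))%:E)%E.
  have -> : y = insert i (y 0 i, \row_j y 0 (lift i j)).
    apply/rowP => k; case: (unliftP i k) => [j ->|->]; last by rewrite insertE.
    by rewrite insert_lift mxE.
  move: (y 0 i) (\row_j _) => t y'; rewrite lee_fin.
  have [t0|t0|->] := ltgtP t 0.
  - rewrite -[t]opprK keyN mulr_ge0 ?slice_ge0 ?oppr_ge0 ?(ltW t0)//.
    by apply: (@increments_ge0 _ (w y')); rewrite ?oppr_gt0// => s; exact: W0.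
  - rewrite key// mulr_ge0 ?slice_ge0 ?(ltW t0)//.
    by apply: (@increments_ge0 _ (w y')) => // s; exact: W0.
  - by rewrite /radial_density insertE mulr0 !mul0r.
rewrite (ge0_integral_insert i mtW); last first.
  by move=> y; rewrite mule_ge0 ?tail_ge0// lee_fin.
rewrite (ge0_integral_insert i mQ)// -ge0_integralZl_EFin//; last 2 first.
- by move=> y' _; apply: integral_ge0 => t _; rewrite mule_ge0 ?tail_ge0// lee_fin.
- have mtWi : measurable_fun setT ((fun y : 'rV[R]_m.+1 => tail (enorm y) * (W y)%:E)%E \o insert i).
    by apply: measurableT_comp => //; exact: measurable_insert.
  have nn z : (0 <= ((fun y : 'rV[R]_m.+1 => tail (enorm y) * (W y)%:E)%E \o insert i) z)%E.
    by rewrite mule_ge0 ?tail_ge0// lee_fin.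
  exact: (@measurable_fun_fubini_tonelli_G _ _ _ _ R leb1 _ mtWi nn).
apply: eq_integral => y' _.
under eq_integral do rewrite enorm_insert.
rewrite (line_identity (enorm_ge0 y') (cw y') (fun t => W0 _) (dU y')).
rewrite ge0_integral_fold; last 2 first.
- have mi : measurable_fun setT (fun t : R => insert i (t, y')).
    exact: (measurableT_comp (@measurable_insert R m i) (pair2_measurable y')).
  exact: (measurableT_comp mQ mi).
- by move=> t; exact: Q0.
rewrite -ge0_integralZl_EFin//.
- apply: eq_integral => s; rewrite inE /= in_itv /= andbT => s0.
  by rewrite key// keyN -EFinM -EFinD; congr EFin; ring.
- move=> s; rewrite /= in_itv /= andbT => s0; rewrite lee_fin mulr_ge0 ?slice_ge0 ?(ltW s0)//.
  by apply: (@increments_ge0 _ (w y')) => // t; exact: W0.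
- apply: measurable_funTS; apply/measurable_EFinP; apply: measurable_funM.
    exact: measurable_slice.
  have cU : continuous (U y').
    by move=> t; apply: differentiable_continuous; apply/derivable1_diffP; have [] := dU y' t.
  apply: measurable_funB; first exact: continuous_measurable_fun.
  by apply: measurableT_comp; [exact: continuous_measurable_fun|exact: oppr_measurable].
Qed.

End radial_kernel.

(** * The averaging kernel of a radial density *)

Lemma is_derive_addZ (R : realType) (V : normedModType R) (f g : V -> R) x v (L a b : R) :
  is_derive x v f a -> is_derive x v g b ->
  is_derive x v (fun y => f y + L * g y) (a + L * b).
Proof.
move=> df dg; have := is_deriveD df (is_deriveZ L dg).
exact.
Qed.

Section kernel_mass.
Context (R : realType) (m : nat).
Local Notation n := m.+1.
Local Notation leb := (leb R n).
Implicit Types (y : 'rV[R]_n) (i : 'I_n) (h : R -> R).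

Lemma mul2e_inj (X Y : \bar R) : (2%:E * X = 2%:E * Y)%E -> X = Y.
Proof.
have E (Z : \bar R) : Z = ((2^-1)%:E * (2%:E * Z))%E.
  by rewrite muleA -EFinM mulVf ?mul1e// pnatr_eq0.
by move=> XY; rewrite (E X) XY -E.
Qed.

Lemma is_derive_coord i y : is_derive y (delta_mx 0 i : 'rV[R]_n) (fun y : 'rV[R]_n => y 0 i) 1.
Proof.
apply: is_derive_along.
rewrite (_ : (fun h : R => _) = (fun t : R => t + y 0 i)); last first.
  by apply/funext => t; rewrite !mxE !eqxx mulr1.
have := is_deriveD (is_derive_id (0 : R) (1 : R)) (is_derive_cst (y 0 i) (0 : R) (1 : R)).
by move/is_derive_eq; apply; rewrite addr0.
Qed.

(** The kernel identity for u = y_i, where W = 1, summed over i: the squares y_i^2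
    add up to |y|^2. *)
Lemma tail_mass h : measurable_fun setT h -> (forall r, 0 <= h r) ->
  (n%:R%:E * \int[leb]_y tail h (enorm y) = \int[leb]_y (h (enorm y))%:E)%E.
Proof.
move=> mh h0; apply: mul2e_inj; rewrite muleCA.
pose q i y := radial_density h i y * (y 0 i - (mirror (pred1 i) y) 0 i).
have qE i y : q i y = 2 * (h (enorm y) * y 0 i ^+ 2 / enorm y ^+ 2).
  rewrite /q /radial_density mxE /= eqxx opprK; ring.
have mq i : measurable_fun setT (EFin \o q i).
  apply/measurable_EFinP; apply: measurable_funM; first exact: measurable_radial_density.
  apply: measurable_funB; first exact: measurable_coord_rV.
  exact: (measurableT_comp (measurable_coord_rV i) (measurable_mirror (pred1 i))).
have q0 i y : (0 <= (q i y)%:E)%E.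
  rewrite lee_fin qE; apply: mulr_ge0 => //; apply: divr_ge0; last exact: sqr_ge0.
  by apply: mulr_ge0 => //; exact: sqr_ge0.
have H i : (2%:E * \int[leb]_y tail h (enorm y) = \int[leb]_y (q i y)%:E)%E.
  rewrite -[RHS](@ge0_kernel_identity _ _ mh h0 _ i (fun y => y 0 i) (fun=> 1)
    (@coord_continuous _ _ _ _ _) (@cst_continuous _ _ _) (fun=> ler01) (is_derive_coord i)).
  by congr (_ * _)%E; apply: eq_integral => y _; rewrite mule1.
transitivity (\sum_(i < n) \int[leb]_y (q i y)%:E)%E.
  under eq_bigr do rewrite -H; rewrite sumr_const card_ord.
  exact: mule_natl.
rewrite -ge0_integral_sum//.
have mhe : measurable_fun setT (EFin \o (h \o @enorm R n)).
  by apply/measurable_EFinP; apply: measurableT_comp => //; exact: measurable_enorm.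
rewrite -ge0_integralZl_EFin//; last by move=> y _; rewrite lee_fin.
apply: ge0_ae_eq_integral => //.
- by apply: emeasurable_sum => i; exact: mq.
- exact: measurable_funeM.
- by move=> y _; apply: sume_ge0 => i _.
- by move=> y _; rewrite mule_ge0 ?lee_fin.
exists [set 0]; split; first exact: measurable_origin.
  exact: leb_origin.
move=> y /= hy; apply: contrapT => y0; apply: hy => _.
rewrite sumEFin -EFinM; congr EFin.
under eq_bigr do rewrite qE.
rewrite -mulr_sumr; congr (_ * _); rewrite -mulr_suml -mulr_sumr -enorm_sqr mulfK//.
by rewrite expf_eq0/=; apply/eqP => /enorm_eq0.
Qed.

Context (h : R -> R) (mh : measurable_fun setT h) (h0 : forall r, 0 <= h r).
Context (ih : leb.-integrable setT (EFin \o (h \o @enorm R n))).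

Lemma measurable_tail_enorm : measurable_fun setT (fun y : 'rV[R]_n => tail h (enorm y)).
Proof. by apply: (measurableT_comp (measurable_tail mh h0)); exact: measurable_enorm. Qed.

Lemma integrable_tail : leb.-integrable setT (fun y : 'rV[R]_n => tail h (enorm y)).
Proof.
apply/integrableP; split; first exact: measurable_tail_enorm.
under eq_integral do rewrite gee0_abs ?tail_ge0//.
have : (\int[leb]_y (h (enorm y))%:E < +oo)%E.
  move/integrableP : ih => [_]; apply: le_lt_trans.
  by rewrite le_eqVlt; apply/orP; left; apply/eqP; apply: eq_integral => y _ /=; rewrite ger0_norm.
rewrite -tail_mass// => lty.
rewrite ltey; apply/eqP => toy; move: lty; rewrite toy.
by rewrite gt0_muley ?ltxx// lte_fin.
Qed.

(** fine turns an infinite tail into 0; when h(|y|) is integrable this concerns at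
    most the origin, as tail decreases. *)
Definition kern y : R := n%:R * fine (tail h (enorm y)).

Lemma kern_ge0 y : 0 <= kern y.
Proof. by rewrite mulr_ge0// fine_ge0// tail_ge0. Qed.

Lemma measurable_kern : measurable_fun setT kern.
Proof.
by apply: measurable_funM => //; apply: measurableT_comp => //; exact: measurable_tail_enorm.
Qed.

Lemma integral_tail_fine (W : 'rV[R]_n -> R) : measurable_fun setT W ->
  (forall y, 0 <= W y) ->
  (\int[leb]_y (tail h (enorm y) * (W y)%:E) =
   \int[leb]_y (fine (tail h (enorm y)) * W y)%:E)%E.
Proof.
move=> mW W0; apply: ge0_ae_eq_integral => //.
- by apply: emeasurable_funM; [exact: measurable_tail_enorm|exact/measurable_EFinP].
- apply/measurable_EFinP; apply: measurable_funM => //.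
  by apply: measurableT_comp => //; exact: measurable_tail_enorm.
- by move=> y _; rewrite mule_ge0 ?lee_fin// tail_ge0.
- by move=> y _; rewrite lee_fin mulr_ge0// fine_ge0// tail_ge0.
have := integrable_ae measurableT integrable_tail.
apply: filterS => y /= /(_ I) fy _.
by rewrite EFinM fineK.
Qed.

Lemma integrable_tail_fine :
  leb.-integrable setT (EFin \o (fun y : 'rV[R]_n => fine (tail h (enorm y)))).
Proof.
apply/integrableP; split.
  by apply/measurable_EFinP; apply: measurableT_comp => //; exact: measurable_tail_enorm.
move/integrableP : integrable_tail => [_]; apply: le_lt_trans.
rewrite le_eqVlt; apply/orP; left; apply/eqP.
have := integral_tail_fine (measurable_cst (1 : R)) (fun=> ler01).
under eq_integral do rewrite mule1.
under [in RHS]eq_integral do rewrite mulr1.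
move=> E; transitivity (\int[leb]_y tail h (enorm y))%E.
  rewrite E; apply: eq_integral => y _ /=.
  by rewrite ger0_norm// fine_ge0// tail_ge0.
by apply: eq_integral => y _; rewrite gee0_abs// tail_ge0.
Qed.

Lemma integrable_kern : leb.-integrable setT (EFin \o kern).
Proof.
have := integrableZl measurableT n%:R integrable_tail_fine.
by congr (leb.-integrable _ _); apply/funext => y /=; rewrite EFinM.
Qed.

Lemma integral_kern : (\int[leb]_y (kern y)%:E = \int[leb]_y (h (enorm y))%:E)%E.
Proof.
rewrite -tail_mass//.
have := integral_tail_fine (measurable_cst (1 : R)) (fun=> ler01).
under eq_integral do rewrite mule1.
move=> ->; rewrite -ge0_integralZl_EFin//.
- by apply: eq_integral => y _; rewrite mulr1 -EFinM.
- by move=> y _; rewrite mulr1 lee_fin fine_ge0// tail_ge0.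
- apply/measurable_EFinP; apply: measurable_funM => //.
  by apply: measurableT_comp => //; exact: measurable_tail_enorm.
Qed.

Lemma nneg_kernel_identity i (u W : 'rV[R]_n -> R) : continuous u -> continuous W ->
  (forall y, 0 <= W y) ->
  (forall y, is_derive y (delta_mx 0 i : 'rV[R]_n) u (W y)) ->
  leb.-integrable setT (EFin \o (fun y => fine (tail h (enorm y)) * W y)) ->
  2 * \int[leb]_y (fine (tail h (enorm y)) * W y) =
  \int[leb]_y (radial_density h i y * (u y - u (mirror (pred1 i) y))).
Proof.
move=> cu cW W0 du iW; rewrite /Rintegral -(ge0_kernel_identity mh h0 cu cW W0 du).
rewrite integral_tail_fine//; last exact: continuous_measurable_rV.
by rewrite fineM// integrable_fin_num.
Qed.

Definition angular i y : R := y 0 i / enorm y ^+ 2.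

Lemma measurable_angular i : measurable_fun setT (angular i).
Proof.
apply: measurable_funM; first exact: measurable_coord_rV.
apply: measurableT_comp; first exact: measurable_invr.
by apply: measurable_funX; exact: measurable_enorm.
Qed.

Lemma angular_le i y (a C : R) : 0 <= C -> `|a| <= C * enorm y -> `|angular i y * a| <= C.
Proof.
move=> C0 aC; rewrite /angular.
have [y0|y0] := eqVneq (enorm y) 0.
  by rewrite y0 expr0n invr0 mulr0 mul0r normr0.
have yp : 0 < enorm y by rewrite lt_neqAle eq_sym y0 enorm_ge0.
rewrite !normrM normfV [`|enorm y ^+ 2|]ger0_norm ?sqr_ge0//.
apply: (@le_trans _ _ (enorm y / enorm y ^+ 2 * (C * enorm y))).
  apply: ler_pM => //; first by rewrite divr_ge0 ?sqr_ge0.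
  by rewrite ler_wpM2r ?invr_ge0 ?sqr_ge0// coord_le_enorm.
by rewrite le_eqVlt; apply/orP; left; apply/eqP; field.
Qed.

Lemma radial_densityE i y : radial_density h i y = h (enorm y) * angular i y.
Proof. by rewrite /radial_density /angular mulrA. Qed.

Lemma radial_density_mirror i y :
  radial_density h i (mirror (pred1 i) y) = - radial_density h i y.
Proof. by rewrite /radial_density enorm_mirror mxE /= eqxx mulrN mulNr. Qed.

Lemma integrable_radial_increment (C : R) i (a : 'rV[R]_n -> R) : 0 <= C ->
  measurable_fun setT a -> (forall y, `|a y| <= C * enorm y) ->
  leb.-integrable setT (EFin \o (fun y => radial_density h i y * a y)).
Proof.
move=> C0 ma aC.
rewrite (_ : (fun y => _) = fun y => (h \o @enorm R n) y * (angular i y * a y)); last first.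
  by apply/funext => y; rewrite radial_densityE mulrA.
apply: (integrable_mul_bounded (C := C) ih).
  by apply: measurable_funM => //; exact: measurable_angular.
by move=> y; exact: angular_le.
Qed.

(** The identity for nonnegative derivatives is applied to f + L, with primitive
    u + L y_i, and to the constant 1. The reflected half of the increment equals the
    other half because the radial density is odd. *)
Lemma kernel_identity i (u f : 'rV[R]_n -> R) (L C : R) : continuous u -> continuous f ->
  (forall y, is_derive y (delta_mx 0 i : 'rV[R]_n) u (f y)) ->
  (forall y, `|f y| <= L) -> 0 <= C -> (forall y, `|u y - u 0| <= C * enorm y) ->
  \int[leb]_y (kern y * f y) =
  n%:R * \int[leb]_y (radial_density h i y * (u y - u 0)).
Proof.
move=> cu cf du fL C0 uC.
have L0 : 0 <= L := le_trans (normr_ge0 _) (fL 0).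
have mu' : measurable_fun setT u by exact: continuous_measurable_rV.
have mf : measurable_fun setT f by exact: continuous_measurable_rV.
pose tl y := fine (tail h (enorm y)).
have itl : leb.-integrable setT (EFin \o tl) := integrable_tail_fine.
have itf : leb.-integrable setT (EFin \o (fun y => tl y * f y)).
  exact: (integrable_mul_bounded (C := L)).
have mm : measurable_fun setT (fun y => u (mirror (pred1 i) y)).
  exact: (measurableT_comp mu' (measurable_mirror (pred1 i))).
have um y : `|u (mirror (pred1 i) y) - u 0| <= C * enorm y.
  by rewrite -(enorm_mirror (pred1 i) y); exact: uC.
have iu : leb.-integrable setT (EFin \o (fun y => radial_density h i y * (u y - u 0))).
  by apply: (integrable_radial_increment (C := C)) => //; exact: measurable_funB.
have ium : leb.-integrable setT
    (EFin \o (fun y => - radial_density h i y * (u (mirror (pred1 i) y) - u 0))).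
  have := integrableN (integrable_radial_increment i C0 (measurable_funB mm (measurable_cst _)) um).
  by congr (leb.-integrable _ _); apply/funext => y /=; rewrite mulNr.
have split2 : \int[leb]_y (radial_density h i y * (u y - u (mirror (pred1 i) y))) =
    2 * \int[leb]_y (radial_density h i y * (u y - u 0)).
  rewrite (_ : (fun y => _) = fun y => radial_density h i y * (u y - u 0) +
      (- radial_density h i y * (u (mirror (pred1 i) y) - u 0))); last first.
    by apply/funext => y; ring.
  rewrite RintegralD// -[2]/(1 + 1) mulrDl !mul1r; congr (_ + _).
  rewrite -[RHS](Rintegral_preserving (measurable_mirror (pred1 i)) (leb_mirror (pred1 i))).
    by apply: eq_Rintegral => y _; rewrite radial_density_mirror.
  apply: measurable_funM; first exact: measurable_radial_density.
  exact: measurable_funB.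
have icoord : leb.-integrable setT
    (EFin \o (fun y => radial_density h i y * (y 0 i - (mirror (pred1 i) y) 0 i))).
  apply: (integrable_radial_increment (C := 2)) => //.
    apply: measurable_funB; first exact: measurable_coord_rV.
    exact: (measurableT_comp (measurable_coord_rV i) (measurable_mirror (pred1 i))).
  move=> y; rewrite mxE /= eqxx (_ : _ - _ = 2 * y 0 i); last by ring.
  rewrite normrM ger0_norm//.
  by rewrite ler_wpM2l// coord_le_enorm.
have iuu : leb.-integrable setT
    (EFin \o (fun y => radial_density h i y * (u y - u (mirror (pred1 i) y)))).
  apply: (integrable_radial_increment (C := 2 * C)); rewrite ?mulr_ge0//.
    exact: measurable_funB.
  move=> y; rewrite (_ : _ - _ = (u y - u 0) - (u (mirror (pred1 i) y) - u 0)); last by ring.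
  by rewrite (le_trans (ler_normB _ _))// -mulrA mulrDl mul1r lerD.
have H1 : 2 * \int[leb]_y (tl y * 1) =
    \int[leb]_y (radial_density h i y * (y 0 i - (mirror (pred1 i) y) 0 i)).
  apply: (@nneg_kernel_identity i (fun y => y 0 i) (fun=> 1)) => //.
  - exact: coord_continuous.
  - exact: cst_continuous.
  - exact: is_derive_coord.
  - by under eq_fun do rewrite mulr1.
have H2 : 2 * \int[leb]_y (tl y * (f y + L)) =
    \int[leb]_y (radial_density h i y * ((u y + L * y 0 i) -
      (u (mirror (pred1 i) y) + L * (mirror (pred1 i) y) 0 i))).
  apply: (@nneg_kernel_identity i (fun y => u y + L * y 0 i) (fun y => f y + L)) => //.
  - apply: continuousD_fun => //; apply: continuousM_fun; first exact: cst_continuous.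
    exact: coord_continuous.
  - by apply: continuousD_fun => //; exact: cst_continuous.
  - by move=> y; have := fL y; rewrite ler_norml => /andP[+ _]; rewrite -subr_ge0 opprK.
  - by move=> y; rewrite -[X in _ + X]mulr1; exact: (is_derive_addZ L (du y) (is_derive_coord i y)).
  - apply: (integrable_mul_bounded (C := 2 * L)) => //; first exact: measurable_funD.
    by move=> y; rewrite (le_trans (ler_normD _ _))// mulrDl mul1r lerD// ger0_norm.
have E2 : \int[leb]_y (radial_density h i y * ((u y + L * y 0 i) -
      (u (mirror (pred1 i) y) + L * (mirror (pred1 i) y) 0 i))) =
    2 * \int[leb]_y (radial_density h i y * (u y - u 0)) +
    L * (2 * \int[leb]_y (tl y * 1)).
  rewrite H1 -split2 -RintegralZl// -RintegralD//; last first.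
    exact: (integrableZl measurableT L icoord).
  by apply: eq_Rintegral => y _; ring.
have E1 : \int[leb]_y (tl y * (f y + L)) =
    \int[leb]_y (tl y * f y) + L * \int[leb]_y (tl y * 1).
  have -> : \int[leb]_y (tl y * 1) = \int[leb]_y tl y.
    by apply: eq_Rintegral => y _; rewrite mulr1.
  rewrite -RintegralZl// -RintegralD//; last exact: (integrableZl measurableT L itl).
  by apply: eq_Rintegral => y _; ring.
have E : \int[leb]_y (tl y * f y) = \int[leb]_y (radial_density h i y * (u y - u 0)).
  by move: H2; rewrite E2 E1; lra.
rewrite -E -RintegralZl//.
by apply: eq_Rintegral => y _; rewrite mulrA.
Qed.

End kernel_mass.

Section kernel_concentration.
Context (R : realType) (m : nat).
Local Notation n := m.+1.
Local Notation leb := (leb R n).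

(** Beyond distance d the kernel only sees the part of h on [d, +oo[, and the
    kernel of that part has the same mass as the part itself. *)
Lemma kern_concentration (h : R -> R) (d : R) :
  measurable_fun setT h -> (forall r, 0 <= h r) ->
  leb.-integrable setT (EFin \o (h \o @enorm R n)) -> 0 < d ->
  (\int[leb]_(y in [set y : 'rV[R]_n | (d <= enorm y)%R]) (kern h y)%:E <=
   \int[leb]_(y in [set y : 'rV[R]_n | (d <= enorm y)%R]) (h (enorm y))%:E)%E.
Proof.
move=> mh h0 ih d0; pose D := [set y : 'rV[R]_n | d <= enorm y].
pose g r := if d <= r then h r else 0.
have mg : measurable_fun setT g.
  by apply: measurable_fun_ifT => //; apply: measurable_fun_ler.
have g0 r : 0 <= g r by rewrite /g; case: ifP.
have gh r : g r <= h r by rewrite /g; case: ifP.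
have mge : measurable_fun setT (g \o @enorm R n).
  by apply: measurableT_comp => //; exact: measurable_enorm.
have ig : leb.-integrable setT (EFin \o (g \o @enorm R n)).
  apply: (le_integrable measurableT _ _ ih); first exact/measurable_EFinP.
  by move=> y _ /=; rewrite lee_fin !ger0_norm.
have mD : measurable D by exact: measurable_enorm_ge.
have kE y : D y -> kern h y = kern g y.
  move=> Dy; rewrite /kern; congr (_ * fine _); apply: eq_integral => r _.
  rewrite /tail_fun; case: ifPn => // /andP[r0 yr]; rewrite /g ifT//.
  by rewrite (le_trans Dy)// ltW.
have -> : (\int[leb]_(y in D) (h (enorm y))%:E = \int[leb]_y (kern g y)%:E)%E.
  rewrite integral_kern// integral_mkcond; apply: eq_integral => y _.
  rewrite patchE /g; case: ifPn; rewrite ?inE /D /=; first by move=> ->.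
  by move=> /negP; rewrite inE /= => /negP/negbTE ->.
rewrite (eq_integral (fun y => (kern g y)%:E)); last first.
  by move=> y; rewrite inE => /kE ->.
apply: ge0_subset_integral => //.
- by apply/measurable_EFinP; exact: measurable_kern.
- by move=> y _; rewrite lee_fin kern_ge0.
Qed.

End kernel_concentration.

(** * Convolution and distributions *)

Section mean_value_lines.
Context (R : realType) (V : normedModType R).

Lemma line_MVT_ex (f : V -> R) x v (d : R) : (forall t, derivable f (x + t *: v) v) ->
  exists2 c, `|c| <= `|d| & f (x + d *: v) - f x = 'D_v f (x + c *: v) * d.
Proof.
move=> df; pose g t := f (x + t *: v).
have dg (t : R) : is_derive t 1 g ('D_v f (x + t *: v)) by exact: is_derive_line.
have cg : continuous g.
  move=> t; apply: differentiable_continuous; apply/derivable1_diffP.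
  exact: (@ex_derive _ _ _ _ _ _ _ (dg t)).
have -> : f x = g 0 by rewrite /g scale0r addr0.
rewrite -/(g d); have [d0|d0] := leP 0 d.
  have [c cd ->] := MVT_segment d0 (fun t _ => dg t) (continuous_subspaceT cg).
  exists c; last by rewrite subr0.
  by move: cd; rewrite in_itv /= => /andP[c0 cd]; rewrite !ger0_norm.
have [c cd E] := MVT_segment (ltW d0) (fun t _ => dg t) (continuous_subspaceT cg).
exists c; last by rewrite -(opprK (g d - g 0)) opprB E sub0r mulrN opprK.
by move: cd; rewrite in_itv /= => /andP[cd c0]; rewrite !ler0_norm ?lerN2// ltW.
Qed.

End mean_value_lines.

Lemma Rintegral_eq0 d (X : measurableType d) (R : realType)
    (mu : {measure set X -> \bar R}) (g : X -> R) :
  (forall x, g x = 0) -> \int[mu]_x g x = 0.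
Proof. by move=> g0; rewrite /Rintegral integral0_eq// => x _; rewrite g0. Qed.

Section scalar_convolution.
Context (R : realType) (n : nat).
Local Notation leb := (leb R n).
Implicit Types (mu f : 'rV[R]_n -> R).

Definition sconv mu f (x : 'rV[R]_n) : R := \int[leb]_y (mu y * f (x - y)).

Definition weight mu := leb.-integrable setT (EFin \o mu) /\ forall y, 0 <= mu y.

Lemma weight_ge0 mu : weight mu -> 0 <= \int[leb]_y mu y.
Proof. by move=> [_ mu0]; apply: Rintegral_ge0. Qed.

Lemma measurable_reverse (x : 'rV[R]_n) : measurable_fun setT (fun y : 'rV[R]_n => x - y).
Proof.
apply: measurable_fun_rV => i.
rewrite (_ : (fun _ => _) = fun y : 'rV[R]_n => x 0 i - y 0 i).
  by apply: measurable_funB => //; exact: measurable_coord_rV.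
by apply/funext => y; rewrite !mxE.
Qed.

Lemma measurable_if_far f (c : 'rV[R]_n) (eta : R) : measurable_fun setT f ->
  measurable_fun setT (fun y : 'rV[R]_n => if eta < `|y - c| then 0 else f y).
Proof.
move=> mf; apply: measurable_fun_ifT => //.
apply: measurable_fun_ltr => //; apply: continuous_measurable_rV.
exact: (@continuous_shift_fun _ _ (fun y : 'rV[R]_n => `|y|) (- c) (@norm_continuous _ _)).
Qed.

Lemma test_measurable_shift r f x : test_in r f ->
  measurable_fun setT (fun y : 'rV[R]_n => f (x - y)).
Proof.
move=> [sf _]; have mf := continuous_measurable_rV (smooth_continuous sf).
exact: (measurableT_comp mf (measurable_reverse x)).
Qed.

Lemma integrable_sconv mu f r x : weight mu -> test_in r f ->
  leb.-integrable setT (EFin \o (fun y => mu y * f (x - y))).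
Proof.
move=> [imu _] tf; have [M M0 fM] := test_in_bounded tf.
apply: (integrable_mul_bounded (C := M) imu) => //.
exact: test_measurable_shift tf.
Qed.

Lemma integrable_sconvB mu f r a b : weight mu -> test_in r f ->
  leb.-integrable setT (EFin \o (fun y => mu y * f (a - y) - mu y * f (b - y))).
Proof.
move=> wmu tf.
exact: (integrableB measurableT (integrable_sconv a wmu tf) (integrable_sconv b wmu tf)).
Qed.

Lemma sconv_lipschitz mu f r (L : R) : weight mu -> test_in r f ->
  (forall x y, `|f y - f x| <= L * `|y - x|) ->
  forall x y, `|sconv mu f y - sconv mu f x| <= L * \int[leb]_y mu y * `|y - x|.
Proof.
move=> wmu tf fL x y; rewrite /sconv.
rewrite -RintegralB//; [|exact: integrable_sconv wmu tf|exact: integrable_sconv wmu tf].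
rewrite (_ : (fun z => _) = fun z => mu z * (f (y - z) - f (x - z))); last first.
  by apply/funext => z; rewrite mulrBr.
have [imu mu0] := wmu.
rewrite mulrAC; apply: Rintegral_mul_bounded => //.
  by apply: measurable_funB; apply: test_measurable_shift tf.
by move=> z; apply: le_trans (fL _ _) _; rewrite opprB addrA subrK.
Qed.

Lemma lipschitz_continuous (V : normedModType R) (g : V -> R) (L : R) :
  (forall x y, `|g y - g x| <= L * `|y - x|) -> continuous g.
Proof.
move=> gL x; apply/cvgrPdist_le => e e0.
have K0 : 0 < `|L| + 1 by rewrite ltr_wpDl.
near=> y; apply: le_trans (_ : (`|L| + 1) * `|y - x| <= _).
  rewrite distrC (le_trans (gL _ _))// ler_wpM2r// (le_trans (ler_norm _))// lerDl.
  exact: ler01.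
rewrite -ler_pdivlMl// mulrC distrC ltW//.
by near: y; apply/nbhs_normP; exists (e / (`|L| + 1)) => //=; rewrite divr_gt0.
Unshelve. all: by end_near. Qed.

Lemma sconv_continuous mu f r : weight mu -> test_in r f -> continuous (sconv mu f).
Proof.
move=> wmu tf; have [L L0 fL] := test_in_lipschitz 0 tf.
exact: (lipschitz_continuous (sconv_lipschitz wmu tf (fL [::] (leqnn _)))).
Qed.

(** The difference quotients of f converge at a rate L |h| that is uniform in the
    point, so they may be averaged. *)
Lemma is_derive_sconv mu f r i x : weight mu -> test_in r f ->
  is_derive x (delta_mx 0 i : 'rV[R]_n) (sconv mu f) (sconv mu (pderiv i f) x).
Proof.
move=> wmu tf; have [L L0 fL] := test_in_lipschitz 1 tf.
have fL1 := fL [:: i] (leqnn _).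
have tdf := test_in_pderiv i tf; have [sf _] := tf; have [imu mu0] := wmu.
pose e : 'rV[R]_n := delta_mx 0 i.
have q (h : R) : h != 0 -> `|sconv mu (pderiv i f) x -
    h^-1 *: ((sconv mu f \o shift x) (h *: e) - sconv mu f x)| <=
    L * \int[leb]_y mu y * `|h|.
  move=> h0; rewrite [_ *: _]mulrC -[_ / h]mulrC /sconv /=.
  rewrite -RintegralB//; [|exact: integrable_sconv wmu tf|exact: integrable_sconv wmu tf].
  rewrite -RintegralZl//; last first.
    exact: integrable_sconvB wmu tf.
  rewrite -RintegralB//; [|exact: integrable_sconv wmu tdf|]; last first.
    exact: (integrableZl measurableT h^-1 (integrable_sconvB _ _ wmu tf)).
  rewrite [X in `|X|](_ : _ = \int[leb]_z (mu z * (pderiv i f (x - z) -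
      h^-1 * (f (h *: e + x - z) - f (x - z))))); last first.
    by apply: eq_Rintegral => z _; ring.
  rewrite mulrAC; apply: Rintegral_mul_bounded => //.
    apply: measurable_funB; first exact: test_measurable_shift tdf.
    apply: measurable_funM => //.
    by apply: measurable_funB; apply: test_measurable_shift tf.
  move=> z; have df t : derivable f (x - z + t *: e) e by exact: smooth_derivable.
  have [c ch E] := line_MVT_ex h df.
  rewrite (_ : h *: e + x - z = x - z + h *: e); last by rewrite -addrA addrC.
  rewrite E [_ * h]mulrC mulKf//.
  rewrite distrC (le_trans (fL1 _ _))// addrC addKr normrZ ler_wpM2l//.
  have e1 : `|e| <= 1.
    by apply: norm_rV_le => // j; rewrite mxE; case: (_ && _); rewrite ?normr1 ?normr0.
  by rewrite (le_trans (ler_wpM2l (normr_ge0 c) e1))// mulr1.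
have lim0 : h^-1 *: ((sconv mu f \o shift x) (h *: e) - sconv mu f x) @[h --> (0 : R)^'] -->
    sconv mu (pderiv i f) x.
  apply/cvgrPdist_le => eps eps0.
  pose K := L * \int[leb]_y mu y + 1.
  have K0 : 0 < K by rewrite ltr_wpDl// mulr_ge0// weight_ge0.
  near=> h; apply: le_trans (q _ _) _; first by near: h; exact: nbhs_dnbhs_neq.
  apply: (@le_trans _ _ (K * `|h|)); first by rewrite ler_wpM2r// lerDl.
  rewrite -ler_pdivlMl// mulrC.
  near: h; apply: nbhs_dnbhs.
  apply/nbhs_normP; exists (eps / K) => /=; first by rewrite divr_gt0.
  by move=> h /=; rewrite sub0r normrN => /ltW.
apply: DeriveDef; first by apply/cvg_ex; exists (sconv mu (pderiv i f) x).
by rewrite /derive; exact: cvg_lim.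
Unshelve. all: by end_near. Qed.

Lemma pderiv_sconv mu f r i : weight mu -> test_in r f ->
  pderiv i (sconv mu f) = sconv mu (pderiv i f).
Proof.
by move=> wmu tf; apply/funext => x; have [_] := is_derive_sconv i x wmu tf.
Qed.

Lemma pderivs_sconv mu f r s : weight mu -> test_in r f ->
  pderivs s (sconv mu f) = sconv mu (pderivs s f).
Proof.
move=> wmu tf; elim: s => // i s IH; rewrite !pderivsE IH.
exact: (pderiv_sconv i wmu (test_in_pderivs s tf)).
Qed.

Lemma smooth_sconv mu f r : weight mu -> test_in r f -> smooth (sconv mu f).
Proof.
move=> wmu tf; apply/smoothP => N; elim: N f tf => [|N IH] f tf.
  exact: sconv_continuous wmu tf.
split; first exact: sconv_continuous wmu tf.
move=> i; split; first by move=> x; have [] := is_derive_sconv i x wmu tf.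
by rewrite (pderiv_sconv i wmu tf); apply: IH; exact: test_in_pderiv.
Qed.

End scalar_convolution.

Section distribution_of_convolution.
Context (R : realType) (n : nat) (V : vectType R).
Local Notation leb := (leb R n).
Implicit Types (mu : 'rV[R]_n -> R) (u phi : 'rV[R]_n -> V).

Lemma crd_conv mu phi k : crd k \o Defs.conv mu phi = sconv mu (crd k \o phi).
Proof.
apply/funext => x; rewrite /= /conv /vint from_crdK /sconv.
by apply: eq_Rintegral => y _; rewrite crdZ.
Qed.

Lemma crd_convE mu phi k x : crd k (Defs.conv mu phi x) = sconv mu (crd k \o phi) x.
Proof. by rewrite -crd_conv. Qed.

Lemma pderivs_diff_shift s (f : 'rV[R]_n -> R) a b : smooth f ->
  pderivs s (fun x => f (x - a) - f (x - b)) =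
  fun x => pderivs s f (x - a) - pderivs s f (x - b).
Proof.
move=> sf; have sa := smooth_shift (- a) sf; have sb := smooth_shift (- b) sf.
rewrite (_ : (fun x => f (x - a) - f (x - b)) = fun x => f (x - a) + (-1) * f (x - b)); last first.
  by apply/funext => x; rewrite mulN1r.
rewrite (pderivsD s sa (smoothZ (-1) sb)) (pderivsZ s (-1) sb).
rewrite (pderivs_shift s f (- a)) (pderivs_shift s f (- b)).
by apply/funext => x; rewrite mulN1r.
Qed.

Context (T : ('rV[R]_n -> V) -> R) (dT : schwartz_distribution T).
Context (chi : 'rV[R]_n -> R) (rho : R) (tchi : test_in rho chi).

(** Tests T against smooth functions of arbitrary support, through a cutoff. *)
Definition cutoff_dist u : R := T (fun x => chi x *: u x).

Lemma cutoff_vtest u : vsmooth u -> vtest_in rho (fun x => chi x *: u x).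
Proof.
move=> su k; have [schi chi0] := tchi; split.
  rewrite (_ : _ \o _ = fun x => chi x * (crd k \o u) x); last first.
    by apply/funext => x /=; rewrite crdZ.
  exact: (smoothM schi (su k)).
by move=> x rx; rewrite /= chi0// scale0r crd0.
Qed.

Lemma cutoff_dist_lin (a : R) u v : vsmooth u -> vsmooth v ->
  cutoff_dist (fun x => a *: u x + v x) = a * cutoff_dist u + cutoff_dist v.
Proof.
move=> su sv; rewrite /cutoff_dist.
rewrite -(dist_lin a dT (vtest_in_test (cutoff_vtest su)) (vtest_in_test (cutoff_vtest sv))).
by congr T; apply/funext => x; rewrite scalerDr !scalerA mulrC.
Qed.

Lemma cutoff_dist_bound : exists C N, 0 <= C /\ forall u, vsmooth u -> forall M, 0 <= M ->
  (forall k s x, (size s <= N)%N -> `|pderivs s (crd k \o u) x| <= M) ->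
  `|cutoff_dist u| <= C * M.
Proof.
have [C [N [C0 HC]]] := dist_bound rho dT.
have [A A0 chiA] := test_in_pderivs_bounded N tchi.
exists (C * (2 ^+ N * A)), N; split; first by rewrite !mulr_ge0.
move=> u su M M0 uM.
rewrite -mulrA -[X in C * X]mulrA; apply: HC; first exact: cutoff_vtest.
  move=> k s x sN; rewrite (_ : _ \o _ = fun x => chi x * (crd k \o u) x); last first.
    by apply/funext => z /=; rewrite crdZ.
  apply: le_trans (pderivs_prod_le (N := N) (a := A) (b := M) _ _ sN _ _) _.
  - by case: tchi.
  - exact: su.
  - by move=> t tN; exact: chiA.
  - by move=> t tN; exact: uM.
  rewrite ler_wpM2r ?mulr_ge0// ler_weXn2l//.
  by rewrite (ler_nat _ 1 2).
by rewrite !mulr_ge0.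
Qed.

Context (phi : 'rV[R]_n -> V) (r : R) (tphi : vtest_in r phi).

Let shifted y := fun x => phi (x - y).

Let vsmooth_shifted y : vsmooth (shifted y) := vsmooth_shift y tphi.

Lemma vsmooth_conv mu : weight mu -> vsmooth (Defs.conv mu phi).
Proof. by move=> wmu k; rewrite crd_conv; exact: (smooth_sconv wmu (tphi k)). Qed.

Definition cutoff_shift y := cutoff_dist (shifted y).

(** Both bounds hold because the derivatives of phi up to the order of T are
    Lipschitz: close translates of phi are close in the seminorms of T, and so is
    an average of translates that are all close to one of them. *)
Lemma cutoff_shift_lipschitz : exists2 K, 0 <= K &
  (forall y c, `|cutoff_shift y - cutoff_shift c| <= K * `|y - c|) /\
  (forall mu c eta, weight mu -> 0 <= eta -> (forall y, eta < `|y - c| -> mu y = 0) ->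
    `|cutoff_dist (Defs.conv mu phi) - \int[leb]_y mu y * cutoff_shift c| <=
      K * eta * \int[leb]_y mu y).
Proof.
have [C [N [C0 HC]]] := cutoff_dist_bound.
have [L L0 phiL] := vtest_in_lipschitz N tphi.
exists (C * L); first by rewrite mulr_ge0.
split=> [y c|mu c eta wmu eta0 mu0].
  rewrite /cutoff_shift -mulN1r addrC -(cutoff_dist_lin (-1) (vsmooth_shifted c) (vsmooth_shifted y)).
  rewrite -mulrA; apply: HC; last 2 first.
  - by rewrite mulr_ge0.
  - move=> k s x sN; have [sk _] := tphi k.
    rewrite (_ : _ \o _ = fun x => (crd k \o phi) (x - y) - (crd k \o phi) (x - c)); last first.
      by apply/funext => z; rewrite /= scaleN1r addrC crdB.
    rewrite (pderivs_diff_shift s y c sk) (le_trans (phiL _ _ sN _ _))// distrC.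
    by rewrite opprB addrC subrKA.
  - move=> k; have [sk _] := tphi k.
    rewrite (_ : _ \o _ = fun x => (-1) * (crd k \o shifted c) x + (crd k \o shifted y) x).
      exact: (smoothD (smoothZ _ (vsmooth_shifted c k)) (vsmooth_shifted y k)).
    by apply/funext => z /=; rewrite crdD crdZ.
set m := \int[leb]_y mu y.
have m0 : 0 <= m by exact: weight_ge0.
have -> : cutoff_dist (Defs.conv mu phi) - m * cutoff_shift c =
    cutoff_dist (fun x => (- m) *: shifted c x + Defs.conv mu phi x).
  by rewrite (cutoff_dist_lin (- m) (vsmooth_shifted c) (vsmooth_conv wmu)) addrC mulNr.
have -> : C * L * eta * m = C * (L * eta * m) by rewrite !mulrA.
apply: HC; last 2 first.
- by rewrite !mulr_ge0.
- move=> k s x sN; have [sk _] := tphi k; have [imu mupos] := wmu.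
  rewrite (_ : _ \o _ = fun x => (- m) * (crd k \o shifted c) x + sconv mu (crd k \o phi) x); last first.
    by apply/funext => z; rewrite /= crdD crdZ crd_convE.
  have ss := smooth_sconv wmu (tphi k).
  rewrite (pderivsD s (smoothZ (- m) (vsmooth_shifted c k)) ss) (pderivsZ s (- m) (vsmooth_shifted c k)).
  rewrite (pderivs_sconv s wmu (tphi k)) (pderivs_shift s (crd k \o phi) (- c)).
  set f := pderivs s (crd k \o phi).
  have tf : test_in r f by exact: test_in_pderivs.
  rewrite addrC mulNr mulrC /m -RintegralZl// -RintegralB//; last 2 first.
  + exact: integrable_sconv wmu tf.
  + exact: (integrableZl measurableT (f (x - c)) imu).
  rewrite (_ : (fun z => _) = fun z => mu z * (if eta < `|z - c| then 0 else f (x - z) - f (x - c))); last first.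
    apply/funext => z; case: ifPn => [/mu0 ->|_]; last by ring.
    by rewrite !mul0r mulr0 subrr.
  apply: Rintegral_mul_bounded => //.
    apply: measurable_if_far.
    by apply: measurable_funB => //; exact: test_measurable_shift tf.
  move=> z; case: ifPn => [_|]; first by rewrite normr0 mulr_ge0.
  rewrite -leNgt => zc; apply: le_trans (phiL _ _ sN _ _) _.
  by rewrite ler_wpM2l// opprB addrC subrKA distrC.
- move=> k.
  rewrite (_ : _ \o _ = fun x => (- m) * (crd k \o shifted c) x + (crd k \o Defs.conv mu phi) x).
    exact: (smoothD (smoothZ _ (vsmooth_shifted c k)) (vsmooth_conv wmu k)).
  by apply/funext => z /=; rewrite crdD crdZ.
Qed.

Lemma cutoff_shift_continuous : continuous cutoff_shift.
Proof.
have [K K0 [HK _]] := cutoff_shift_lipschitz.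
exact: (lipschitz_continuous (fun x y => HK y x)).
Qed.

(** The cube that carries chi and the one that carries the translate are disjoint. *)
Lemma cutoff_shift_far y : rho + r < `|y| -> cutoff_shift y = 0.
Proof.
move=> yfar; rewrite /cutoff_shift /cutoff_dist (_ : (fun x => _) = fun=> 0); first exact: dist0.
apply/funext => x; have [xr|rx] := leP `|x| rho; last first.
  by have [_ ->] := tchi; rewrite ?scale0r.
rewrite /shifted (vtest_in0 tphi) ?scaler0//.
have := lerB_dist y x; rewrite distrC; apply: lt_le_trans.
by rewrite ltrBrDl (le_lt_trans _ yfar)// lerD2r.
Qed.

Lemma weight_restrict mu (D : set 'rV[R]_n) : weight mu -> measurable D ->
  weight (mu \_ D).
Proof.
move=> [imu mu0] mD; split; last by move=> y; rewrite patchE; case: ifP.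
have := (integrable_mkcond (EFin \o mu) mD).1 (integrableS measurableT mD (@subsetT _ _) imu).
by rewrite restrict_EFin.
Qed.

Lemma measurable_cutoff_shift : measurable_fun setT cutoff_shift.
Proof. by apply: continuous_measurable_rV; exact: cutoff_shift_continuous. Qed.

Lemma cutoff_shift_bounded : exists2 M, 0 <= M & forall y, `|cutoff_shift y| <= M.
Proof.
have cK : compact (cutoff_shift @` [set y : 'rV[R]_n | `|y| <= rho + r]).
  apply: continuous_compact; last exact: compact_norm_le.
  by apply: continuous_subspaceT; exact: cutoff_shift_continuous.
have [M [_ bM]] := compact_bounded cK.
exists (Num.max (M + 1) 0) => [|y]; first by rewrite le_max lexx orbT.
have [yr|ry] := leP `|y| (rho + r); last first.
  by rewrite cutoff_shift_far// normr0 le_max lexx orbT.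
rewrite le_max; apply/orP; left; apply: (bM (M + 1)); first by rewrite ltrDl.
by exists y.
Qed.

Lemma integrable_cutoff_shift mu : weight mu ->
  leb.-integrable setT (EFin \o (fun y => mu y * cutoff_shift y)).
Proof.
move=> [imu _]; have [M _ bM] := cutoff_shift_bounded.
by apply: (integrable_mul_bounded (C := M) imu) => //; exact: measurable_cutoff_shift.
Qed.

Let defect mu := cutoff_dist (Defs.conv mu phi) - \int[leb]_y (mu y * cutoff_shift y).

Let defectD mu nu : weight mu -> weight nu -> defect (mu \+ nu) = defect mu + defect nu.
Proof.
move=> wmu wnu; rewrite /defect.
have -> : Defs.conv (mu \+ nu) phi = fun x => 1 *: Defs.conv mu phi x + Defs.conv nu phi x.
  apply/funext => x; apply: crd_inj => k; rewrite crdD crdZ mul1r.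
  rewrite !crd_convE /sconv -RintegralD//.
  - by apply: eq_Rintegral => y _; rewrite mulrDl.
  - exact: integrable_sconv wmu (tphi k).
  - exact: integrable_sconv wnu (tphi k).
rewrite (cutoff_dist_lin 1 (vsmooth_conv wmu) (vsmooth_conv wnu)) mul1r.
rewrite (_ : (\int[leb]_y _) = \int[leb]_y (mu y * cutoff_shift y) +
    \int[leb]_y (nu y * cutoff_shift y)); first by ring.
rewrite -RintegralD//; [|exact: integrable_cutoff_shift|exact: integrable_cutoff_shift].
by apply: eq_Rintegral => y _; rewrite mulrDl.
Qed.

(* By induction on l, mu is cut into pieces that live near one point c each; for
   such a piece both terms of the defect are close to cutoff_shift c times its
   mass. *)
Let defect_small : exists2 K, 0 <= K & forall eta mu (l : seq 'rV[R]_n), 0 < eta -> weight mu ->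
  (forall y, mu y != 0 -> exists2 c, c \in l & `|y - c| <= eta) ->
  `|defect mu| <= K * eta * \int[leb]_y mu y.
Proof.
have [K K0 [HL HK]] := cutoff_shift_lipschitz.
exists (K + K) => [|eta mu l eta0]; first exact: addr_ge0.
elim: l mu => [|c l IH] mu wmu mul.
  have mu0 : mu = fun=> 0.
    apply/funext => y; apply/eqP/negPn/negP => /mul[c]; by rewrite in_nil.
  have c0 : cutoff_dist (Defs.conv mu phi) = 0.
    rewrite /cutoff_dist (_ : (fun x => _) = fun=> 0); first exact: dist0.
    apply/funext => x; rewrite (_ : Defs.conv mu phi x = 0) ?scaler0//.
    apply: crd_eq0 => k; rewrite crd_convE.
    by apply: Rintegral_eq0 => y; rewrite mu0 mul0r.
  rewrite /defect c0 Rintegral_eq0; last by move=> y; rewrite mu0 mul0r.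
  rewrite subrr normr0.
  by rewrite mulr_ge0 ?weight_ge0// mulr_ge0 ?addr_ge0// ltW.
pose D := [set y : 'rV[R]_n | `|y - c| <= eta].
have mD : measurable D by apply: closed_measurable_rV; exact: closed_norm_le.
have mDc := measurableC mD.
have wD := weight_restrict wmu mD; have wDc := weight_restrict wmu mDc.
have muE : mu = (mu \_ D) \+ (mu \_ (~` D)).
  apply/funext => y /=; rewrite !patchE in_setC; case: (y \in D) => /=.
    by rewrite addr0.
  by rewrite add0r.
have -> : \int[leb]_y mu y = \int[leb]_y (mu \_ D) y + \int[leb]_y (mu \_ (~` D)) y.
  by rewrite {1}muE RintegralD//; [case: wD|case: wDc].
rewrite {1}muE defectD// mulrDr (le_trans (ler_normD _ _))// lerD//; last first.
  apply: IH => // y; rewrite patchE in_setC; case: ifPn => [|_]; last by rewrite eqxx.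
  move=> /negP yD /mul[d]; rewrite in_cons => /orP[/eqP -> yc|dl yd]; last by exists d.
  by exfalso; apply: yD; rewrite inE.
have sup y : eta < `|y - c| -> (mu \_ D) y = 0.
  move=> yc; rewrite patchE memNset// => yD.
  by have := lt_le_trans yc yD; rewrite ltxx.
have Hc := HK _ c _ wD (ltW eta0) sup.
rewrite /defect.
rewrite (_ : _ - _ = (cutoff_dist (Defs.conv (mu \_ D) phi) - \int[leb]_y (mu \_ D) y * cutoff_shift c) -
    (\int[leb]_y ((mu \_ D) y * cutoff_shift y) - \int[leb]_y (mu \_ D) y * cutoff_shift c)); last first.
  by ring.
rewrite (le_trans (ler_normB _ _))// mulrDl mulrDl lerD//.
have [iD D0] := wD.
rewrite [X in _ - X]mulrC -RintegralZl// -RintegralB//; last 2 first.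
- exact: integrable_cutoff_shift.
- exact: (integrableZl measurableT (cutoff_shift c) iD).
rewrite [X in `|X|](_ : _ = \int[leb]_y ((mu \_ D) y *
    (if eta < `|y - c| then 0 else cutoff_shift y - cutoff_shift c))); last first.
  apply: eq_Rintegral => y _; case: ifPn => [/sup ->|_]; last by ring.
  by rewrite !mul0r mulr0 subrr.
apply: Rintegral_mul_bounded => //.
  apply: measurable_if_far.
  by apply: measurable_funB => //; exact: measurable_cutoff_shift.
move=> y; case: ifPn => [_|]; first by rewrite normr0 mulr_ge0// ltW.
by rewrite -leNgt => yc; rewrite (le_trans (HL _ _))// ler_wpM2l.
Qed.

Lemma finite_net (b eta : R) : 0 < eta ->
  exists l : seq 'rV[R]_n, forall y, `|y| <= b -> exists2 c, c \in l & `|y - c| <= eta.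
Proof.
move=> eta0; have := @compact_norm_le R n b; rewrite compact_cover => cu.
have [] := cu _ setT (fun c : 'rV[R]_n => ball c eta).
- by move=> c _; exact: ball_open.
- by move=> y _; exists y => //; exact: ballxx.
move=> D' _ cD'; exists (finmap.enum_fset D') => y /cD'[c cD]; rewrite -ball_normE /= => cy.
by exists c => //; rewrite distrC ltW.
Qed.

(** T may be applied under the integral sign of a convolution. The defect of this
    equality is additive in mu, and a finite net of mesh eta bounds it by a multiple
    of eta for every eta. *)
Lemma cutoff_dist_conv mu : weight mu ->
  cutoff_dist (Defs.conv mu phi) = \int[leb]_y (mu y * cutoff_shift y).
Proof.
(* Translations by more than rho + r move phi off the support of chi. *)
move=> wmu; pose b := rho + r; pose D := [set y : 'rV[R]_n | `|y| <= b].
have mD : measurable D by exact: measurable_norm_le.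
have wD := weight_restrict wmu mD.
have -> : cutoff_dist (Defs.conv mu phi) = cutoff_dist (Defs.conv (mu \_ D) phi).
  rewrite /cutoff_dist; congr T; apply/funext => x.
  have [xr|rx] := leP `|x| rho; last by have [_ ->] := tchi; rewrite ?scale0r.
  congr (_ *: _); apply: crd_inj => k.
  rewrite !crd_convE; apply: eq_Rintegral => y _; rewrite patchE; case: ifPn => // yD.
  rewrite mul0r; have [_ ->] := tphi k; first by rewrite mulr0.
  have by' : b < `|y| by rewrite ltNge; apply/negP => yb; move/negP: yD; apply; rewrite inE.
  have := lerB_dist y x; rewrite distrC; apply: lt_le_trans.
  by rewrite ltrBrDl (le_lt_trans _ by')// lerD2r.
have -> : \int[leb]_y (mu y * cutoff_shift y) = \int[leb]_y ((mu \_ D) y * cutoff_shift y).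
  apply: eq_Rintegral => y _; rewrite patchE; case: ifPn => // yD.
  by rewrite cutoff_shift_far ?mulr0// ltNge; apply/negP => yb; move/negP: yD; apply; rewrite inE.
apply/eqP; rewrite -subr_eq0 -normr_le0; apply/ler_addgt0Pr => e e0; rewrite add0r.
have [K K0 HK] := defect_small.
pose m := \int[leb]_y (mu \_ D) y; have m0 : 0 <= m by exact: weight_ge0.
have Km : 0 < K * m + 1 by rewrite ltr_wpDl// mulr_ge0.
pose eta := e / (K * m + 1); have eta0 : 0 < eta by rewrite divr_gt0.
have [l Hl] := finite_net b eta0.
apply: le_trans (HK eta _ l eta0 wD _) _.
  move=> y; rewrite patchE; case: ifPn; last by rewrite eqxx.
  by rewrite inE => /Hl.
rewrite mulrAC /eta mulrA ler_pdivrMr// mulrC ler_wpM2l ?(ltW e0)//.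
by rewrite lerDl.
Qed.

End distribution_of_convolution.

(** * Functionals given by integration *)

Section pairing.
Context (R : realType) (n : nat) (V : vectType R).
Context (nu : {sigma_finite_measure set 'rV[R]_n -> \bar R}).
Local Notation leb := (leb R n).
Implicit Types (mu : 'rV[R]_n -> R) (u phi : 'rV[R]_n -> V).
Context (g : 'rV[R]_n -> 'I_(\dim {:V}) -> R).
Context (mg : forall k, measurable_fun setT (fun x => g x k)).

(** The common form of integration against a function (nu is Lebesgue measure) and
    against a measure (nu is a Jordan component of one of its coordinates, and g
    is constant). *)
Definition pairing u : R := \int[nu]_x \sum_k (g x k * crd k (u x)).

Definition total x := \sum_k `|g x k|.

Lemma measurable_total : measurable_fun setT total.
Proof. by apply: measurable_sum => k; apply: measurableT_comp => //; exact: mg. Qed.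

Lemma total_ge0 x : 0 <= total x.
Proof. by apply: sumr_ge0. Qed.

(** Unlike a finite total mass, this holds for bounded and p-integrable densities,
    and it suffices to pair with translates of one test function. *)
Definition uniformly_local := forall r : R, exists2 C : R, 0 <= C & forall y,
  (\int[nu]_(x in [set x : 'rV[R]_n | (`|x - y| <= r)%R]) (total x)%:E <= C%:E)%E.

Context (ug : uniformly_local).

Lemma pairing_integrand (r M : R) u (y : 'rV[R]_n) : (forall k, measurable_fun setT (crd k \o u)) ->
  0 <= M -> (forall x, r < `|x - y| -> u x = 0) -> (forall k x, `|crd k (u x)| <= M) ->
  forall C, (\int[nu]_(x in [set x : 'rV[R]_n | (`|x - y| <= r)%R]) (total x)%:E <= C%:E)%E ->
  (\int[nu]_x `|(\sum_k (g x k * crd k (u x)))%:E| <= (M * C)%:E)%E.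
Proof.
move=> mu' M0 u0 uM C HC.
pose D := [set x : 'rV[R]_n | `|x - y| <= r].
have mD : measurable D by apply: closed_measurable_rV; exact: closed_norm_le.
have msum : measurable_fun setT (fun x => \sum_k (g x k * crd k (u x))).
  by apply: measurable_sum => k; apply: measurable_funM; [exact: mg|exact: (mu' k)].
have mt := measurable_total.
apply: (@le_trans _ _ (\int[nu]_(x in D) (M%:E * (total x)%:E))%E); last first.
  rewrite ge0_integralZl_EFin//.
  - by rewrite EFinM lee_pmul ?lee_fin//; apply: integral_ge0 => x _; rewrite lee_fin total_ge0.
  - by move=> x _; rewrite lee_fin total_ge0.
  - by apply: measurable_funTS; apply/measurable_EFinP.
rewrite [leRHS]integral_mkcond; apply: ge0_le_integral => //.
- by apply: measurableT_comp => //; exact/measurable_EFinP.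
- apply/(measurable_restrictT _ mD); apply: measurable_funTS.
  by apply: measurable_funeM; apply/measurable_EFinP.
move=> x _; rewrite patchE; case: ifPn => [_|].
  rewrite -EFinM lee_fin mulr_sumr (le_trans (ler_norm_sum _ _ _))//.
  by apply: ler_sum => k _; rewrite normrM mulrC ler_wpM2r.
move=> /negP; rewrite inE /D /= => /negP; rewrite -ltNge => /u0 ->.
by rewrite big1 ?normr0// => k _; rewrite crd0 mulr0.
Qed.

Lemma pairing_bound (r : R) : exists2 C, 0 <= C & forall u y M,
  (forall k, measurable_fun setT (crd k \o u)) -> 0 <= M ->
  (forall x, r < `|x - y| -> u x = 0) -> (forall k x, `|crd k (u x)| <= M) ->
  nu.-integrable setT (EFin \o (fun x => \sum_k (g x k * crd k (u x)))) /\
  `|pairing u| <= C * M.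
Proof.
have [C C0 HC] := ug r; exists C => // u y M mu' M0 u0 uM.
have msum : measurable_fun setT (fun x => \sum_k (g x k * crd k (u x))).
  by apply: measurable_sum => k; apply: measurable_funM; [exact: mg|exact: (mu' k)].
have B := pairing_integrand mu' M0 u0 uM (HC y).
have iu : nu.-integrable setT (EFin \o (fun x => \sum_k (g x k * crd k (u x)))).
  apply/integrableP; split; first exact/measurable_EFinP.
  exact: le_lt_trans B (ltry _).
split => //; rewrite /pairing -lee_fin EFin_normr_Rintegral//.
by rewrite (le_trans (le_abse_integral _ _ _))//; [exact: measurable_int iu|rewrite mulrC].
Qed.

Lemma Rintegral_sum d (X : measurableType d) (m : {measure set X -> \bar R}) (I : Type)
    (s : seq I) (F : I -> X -> R) :
  (forall i, m.-integrable setT (EFin \o F i)) ->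
  \int[m]_x (\sum_(i <- s) F i x) = \sum_(i <- s) \int[m]_x F i x.
Proof.
move=> iF; elim: s => [|i s IH].
  by rewrite big_nil; apply: Rintegral_eq0 => x; rewrite big_nil.
rewrite big_cons -IH -RintegralD//; first by apply: eq_Rintegral => x _; rewrite big_cons.
have := @integrable_sum _ _ _ m setT measurableT _ s xpredT (fun i x => (F i x)%:E) (fun i _ => iF i).
by congr (m.-integrable _ _); apply/funext => x /=; rewrite sumEFin.
Qed.

Context (phi : 'rV[R]_n -> V) (r : R) (tphi : vtest_in r phi).
Context (mu : 'rV[R]_n -> R) (wmu : weight mu).

Let F (p : 'rV[R]_n * 'rV[R]_n) : R := mu p.2 * \sum_k (g p.1 k * crd k (phi (p.1 - p.2))).

Let mphi k y : measurable_fun setT (crd k \o (fun x => phi (x - y))).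
Proof. exact: continuous_measurable_rV (smooth_continuous (vsmooth_shift y tphi k)). Qed.

Let mF : measurable_fun setT F.
Proof.
have mmu : measurable_fun setT mu by apply/measurable_EFinP; exact: measurable_int wmu.1.
apply: measurable_funM; first exact: (measurableT_comp mmu measurable_snd).
apply: measurable_sum => k; apply: measurable_funM.
  exact: (measurableT_comp (mg k) measurable_fst).
have [sk _] := tphi k.
have mk : measurable_fun setT (crd k \o phi).
  by apply: continuous_measurable_rV; exact: smooth_continuous sk.
apply: (measurableT_comp mk); apply: measurable_fun_rV => i.
rewrite (_ : (fun _ => _) = fun t : 'rV[R]_n * 'rV[R]_n => t.1 0 i - t.2 0 i).
  apply: measurable_funB.
    exact: (measurableT_comp (measurable_coord_rV i) measurable_fst).
  exact: (measurableT_comp (measurable_coord_rV i) measurable_snd).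
by apply/funext => t; rewrite !mxE.
Qed.

Let phi_shift0 y x : r < `|x - y| -> phi (x - y) = 0.
Proof. exact: vtest_in0. Qed.

(** Fubini: the double integral is finite because the pairings with the translates of
    phi are bounded uniformly and mu is integrable. *)
Lemma pairing_conv :
  leb.-integrable setT (EFin \o (fun y => mu y * pairing (fun x => phi (x - y)))) /\
  pairing (Defs.conv mu phi) = \int[leb]_y (mu y * pairing (fun x => phi (x - y))).
Proof.
have [imu mu0] := wmu.
have [M M0 phiM] := vtest_in_bounded 0 tphi.
have phiM' k x : `|crd k (phi x)| <= M by exact: (phiM k [::] x).
have [C C0 HC] := pairing_bound r.
have [C' C'0 HC'] := ug r.
have HB y := @pairing_integrand r M (fun x => phi (x - y)) y (mphi^~ y) M0
  (@phi_shift0 y) (fun k x => phiM' k (x - y)) C' (HC' y).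
have iphi y : nu.-integrable setT (EFin \o (fun x => \sum_k (g x k * crd k (phi (x - y))))).
  exact: (HC _ y M (mphi^~ y) M0 (@phi_shift0 y) (fun k x => phiM' k (x - y))).1.
have mFE : measurable_fun setT (EFin \o F) by exact/measurable_EFinP.
have iF : (nu \x leb)%E.-integrable setT (EFin \o F).
  apply: (@integrable21ltyP _ _ _ _ R nu leb (EFin \o F) mFE).2.
  apply: (@le_lt_trans _ _ (\int[leb]_y ((M * C')%:E * (mu y)%:E))%E); last first.
    exact: integrable_lty (integrableZl measurableT (M * C') imu).
  apply: ge0_le_integral => //.
  - by move=> y _; apply: integral_ge0 => x _.
  - have mabs : measurable_fun setT (abse \o (EFin \o F)) by exact: measurableT_comp.
    exact: (@measurable_fun_fubini_tonelli_G _ _ _ _ R nu _ mabs (fun p => abse_ge0 _)).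
  - by apply: measurable_funeM; exact: measurable_int imu.
  move=> y _.
  rewrite (eq_integral (fun x => (mu y)%:E * `|(\sum_k (g x k * crd k (phi (x - y))))%:E|)%E); last first.
    by move=> x _; rewrite /F /= normrM ger0_norm// EFinM.
  rewrite ge0_integralZl_EFin//.
    by rewrite muleC lee_pmul ?lee_fin// ?HB//; exact: integral_ge0.
  by apply: measurableT_comp => //; exact: measurable_int (iphi y).
have innery y : (\int[nu]_x (F (x, y))%:E = (mu y * pairing (fun x => phi (x - y)))%:E)%E.
  rewrite /F /=; under eq_integral do rewrite EFinM.
  rewrite integralZl//; last exact: iphi.
  by rewrite EFinM /pairing /Rintegral fineK// integrable_fin_num//; exact: iphi.
have innerx x : (\int[leb]_y (F (x, y))%:E = (\sum_k (g x k * crd k (Defs.conv mu phi x)))%:E)%E.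
  have ik k : leb.-integrable setT (EFin \o (fun y => mu y * (crd k \o phi) (x - y))).
    exact: integrable_sconv wmu (tphi k).
  have igk k : leb.-integrable setT (EFin \o (fun y => g x k * (mu y * (crd k \o phi) (x - y)))).
    exact: (integrableZl measurableT (g x k) (ik k)).
  have isum : leb.-integrable setT (EFin \o (fun y => F (x, y))).
    have := @integrable_sum _ _ _ leb setT measurableT _ (index_enum _) xpredT
      (fun k y => (g x k * (mu y * (crd k \o phi) (x - y)))%:E) (fun k _ => igk k).
    congr (leb.-integrable _ _); apply/funext => y /=; rewrite sumEFin; congr EFin.
    by rewrite /F /= mulr_sumr; apply: eq_bigr => k _; rewrite mulrCA.
  transitivity ((\int[leb]_y F (x, y))%:E).
    by rewrite /Rintegral fineK// integrable_fin_num.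
  congr EFin; rewrite (_ : (fun y => F (x, y)) = fun y =>
      \sum_k g x k * (mu y * (crd k \o phi) (x - y))); last first.
    by apply/funext => y; rewrite /F /= mulr_sumr; apply: eq_bigr => k _; rewrite mulrCA.
  rewrite Rintegral_sum//; apply: eq_bigr => k _; rewrite RintegralZl//.
  by rewrite crd_convE.
split.
  have mG := @measurable_fubini_G _ _ _ _ R nu leb _ iF.
  have GE : fubini_G nu (EFin \o F) =
      EFin \o (fun y => mu y * pairing (fun x => phi (x - y))).
    by apply/funext => y; rewrite /fubini_G /= innery.
  rewrite GE in mG.
  apply: (le_integrable measurableT mG _ (integrableZl measurableT (C * M) imu)) => y _ /=.
  rewrite lee_fin (ger0_norm (mulr_ge0 (mulr_ge0 C0 M0) (mu0 y))) normrM (ger0_norm (mu0 y)).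
  rewrite mulrC ler_wpM2r//.
  exact: (HC _ y M (mphi^~ y) M0 (@phi_shift0 y) (fun k x => phiM' k (x - y))).2.
rewrite {1}/pairing /Rintegral; congr fine.
under eq_integral do rewrite -innerx.
rewrite (@Fubini _ _ _ _ R nu leb _ iF).
by apply: eq_integral => y _; rewrite innery.
Qed.

End pairing.

Section averaging_functionals.
Context (R : realType) (n : nat) (V : vectType R).
Local Notation leb := (leb R n).
Implicit Types (mu : 'rV[R]_n -> R) (u phi : 'rV[R]_n -> V) (E : ('rV[R]_n -> V) -> R).

(** What is needed of a functional given by integration: it can be applied under the
    integral sign of a convolution, even if mu has unbounded support, and its
    values on all translates obey one bound. *)
Definition averaging E :=
  (forall mu phi r, weight mu -> vtest_in r phi ->
    leb.-integrable setT (EFin \o (fun y => mu y * E (fun x => phi (x - y)))) /\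
    E (Defs.conv mu phi) = \int[leb]_y (mu y * E (fun x => phi (x - y)))) /\
  (forall r, exists2 C, 0 <= C & forall phi, vtest_in r phi -> forall M, 0 <= M ->
    (forall k x, `|crd k (phi x)| <= M) -> forall y, `|E (fun x => phi (x - y))| <= C * M).

Lemma averaging_pairing (nu : {sigma_finite_measure set 'rV[R]_n -> \bar R})
    (g : 'rV[R]_n -> 'I_(\dim {:V}) -> R) :
  (forall k, measurable_fun setT (fun x => g x k)) -> uniformly_local nu g ->
  averaging (pairing nu g).
Proof.
move=> mg ug; split; first by move=> mu phi r wmu tphi; exact: (pairing_conv mg ug tphi wmu).
move=> r; have [C C0 HC] := pairing_bound mg ug r; exists C => // phi tphi M M0 phiM y.
have mphi k : measurable_fun setT (crd k \o (fun x => phi (x - y))).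
  exact: continuous_measurable_rV (smooth_continuous (vsmooth_shift y tphi k)).
exact: (HC _ y M mphi M0 (fun x => @vtest_in0 _ _ _ _ _ (x - y) tphi) (fun k x => phiM k (x - y))).2.
Qed.

Lemma averaging_sum (I : Type) (s : seq I) (E : I -> ('rV[R]_n -> V) -> R) :
  (forall i, averaging (E i)) -> averaging (fun u => \sum_(i <- s) E i u).
Proof.
move=> aE; split=> [mu phi r wmu tphi|r].
  have iE i := ((aE i).1 mu phi r wmu tphi).1.
  have eE i := ((aE i).1 mu phi r wmu tphi).2.
  split.
    have := @integrable_sum _ _ _ leb setT measurableT _ s xpredT _ (fun i _ => iE i).
    congr (leb.-integrable _ _); apply/funext => y /=; rewrite sumEFin mulr_sumr//.
  rewrite (eq_bigr _ (fun i _ => eE i)) -Rintegral_sum//.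
  by apply: eq_Rintegral => y _; rewrite mulr_sumr.
have /choice[C HC] : forall i, exists C, 0 <= C /\ forall phi, vtest_in r phi -> forall M, 0 <= M ->
    (forall k x, `|crd k (phi x)| <= M) -> forall y, `|E i (fun x => phi (x - y))| <= C * M.
  by move=> i; have [C C0 HC] := (aE i).2 r; exists C.
exists (\sum_(i <- s) C i) => [|phi tphi M M0 phiM y].
  by apply: sumr_ge0 => i _; have [] := HC i.
rewrite (le_trans (ler_norm_sum _ _ _))// mulr_suml; apply: ler_sum => i _.
by have [_] := HC i; apply.
Qed.

Lemma averagingB E1 E2 : averaging E1 -> averaging E2 -> averaging (fun u => E1 u - E2 u).
Proof.
move=> a1 a2; split=> [mu phi r wmu tphi|r].
  have [i1 e1] := a1.1 mu phi r wmu tphi; have [i2 e2] := a2.1 mu phi r wmu tphi.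
  split.
    have := integrableB measurableT i1 i2.
    by congr (leb.-integrable _ _); apply/funext => y /=; rewrite mulrBr.
  rewrite e1 e2 -RintegralB//.
  by apply: eq_Rintegral => y _; rewrite mulrBr.
have [C1 C10 H1] := a1.2 r; have [C2 C20 H2] := a2.2 r.
exists (C1 + C2) => [|phi tphi M M0 phiM y]; first exact: addr_ge0.
by rewrite (le_trans (ler_normB _ _))// mulrDl lerD//; [exact: H1|exact: H2].
Qed.

Context (ip : {dot V for (@idfun R)}).
Local Notation e_ k := ((vbasis {:V})`_k).

Lemma ip_crd (v w : V) : ip v w = \sum_(k < \dim {:V}) ip v (e_ k) * crd k w.
Proof.
rewrite -{1}(crdK w) /from_crd linear_sumr /=.
by apply: eq_bigr => k _; rewrite linearZr_LR /= mulrC.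
Qed.

Lemma ip_sym (v w : V) : ip v w = ip w v.
Proof. by rewrite hermC /= expr0 mul1r. Qed.

Lemma ip_ge0 (v : V) : 0 <= ip v v.
Proof.
have [->|v0] := eqVneq v 0; first by rewrite linear0l.
by apply: ltW; exact: neq0_dnorm_gt0.
Qed.

Lemma cauchy_schwarz (v w : V) : `|ip v w| <= ipnorm ip v * ipnorm ip w.
Proof.
rewrite -(@ler_pXn2r _ 2)// ?nnegrE ?mulr_ge0 ?sqrtr_ge0//.
rewrite exprMn !sqr_sqrtr ?ip_ge0// real_normK ?num_real//.
have [->|w0] := eqVneq w 0; first by rewrite !linear0r /= expr0n.
have ww : 0 < ip w w by exact: neq0_dnorm_gt0.
set c := ip v w / ip w w.
have eZ x : ip x (c *: w) = c * ip x w by rewrite linearZr_LR.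
have := ip_ge0 (v - c *: w).
rewrite linearBl /= !linearBr /= !eZ (ip_sym (c *: w) v) (ip_sym (c *: w) w) !eZ /c => H.
have : 0 <= ip v v - ip v w ^+ 2 / ip w w.
  apply: le_trans H _; rewrite le_eqVlt; apply/orP; left; apply/eqP; field.
  by rewrite gt_eqF.
by rewrite subr_ge0 ler_pdivrMr.
Qed.

Lemma averaging_measure (nu : 'I_(\dim {:V}) -> {charge set 'rV[R]_n -> \bar R}) :
  averaging (measure_functional ip nu).
Proof.
apply: averaging_sum => j; rewrite /charge_integral.
move: (cid _) => P; move: (cid _) => N.
have aux (m : {finite_measure set 'rV[R]_n -> \bar R}) :
    averaging (fun u : 'rV[R]_n -> V => \int[m]_x ip (e_ j) (u x)).
  rewrite (_ : (fun u => _) = pairing m (fun _ k => ip (e_ j) (e_ k))); last first.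
    by apply/funext => u; apply: eq_Rintegral => x _; exact: ip_crd.
  apply: averaging_pairing => [k|r]; first exact: measurable_cst.
  pose A := \sum_(k < \dim {:V}) `|ip (e_ j) (e_ k)|.
  have A0 : 0 <= A by exact: sumr_ge0.
  exists (A * fine (m setT)) => [|y]; first by rewrite mulr_ge0// fine_ge0.
  rewrite /total integral_cst; last first.
    by apply: closed_measurable_rV; exact: closed_norm_le.
  rewrite EFinM fineK ?fin_num_measure// lee_pmul ?lee_fin//.
  apply: le_measure; rewrite ?inE//.
  by apply: closed_measurable_rV; exact: closed_norm_le.
by apply: averagingB; exact: aux.
Qed.

Lemma leb_closed_ball (y : 'rV[R]_n) (r : R) :
  leb [set x | (`|x - y| <= r)%R] = leb [set x | (`|x| <= r)%R].
Proof. by rewrite -(leb_shift (- y) (@measurable_norm_le R n r)). Qed.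

Lemma measurable_ipnorm (f : 'rV[R]_n -> V) : (forall k, measurable_fun setT (crd k \o f)) ->
  measurable_fun setT (ipnorm ip \o f).
Proof.
move=> mf.
have msqrt := continuous_measurable_fun (@sqrt_continuous R).
apply: (measurableT_comp msqrt).
rewrite (_ : (fun x => _) = fun x => \sum_(k < \dim {:V}) (\sum_(l < \dim {:V}) crd l (f x) * ip (e_ k) (e_ l)) * crd k (f x)).
  apply: measurable_sum => k; apply: measurable_funM; last exact: mf.
  apply: measurable_sum => l; apply: measurable_funM => //; exact: mf.
apply/funext => x; rewrite ip_crd; apply: eq_bigr => k _; congr (_ * _).
by rewrite ip_sym ip_crd; apply: eq_bigr => l _; rewrite mulrC.
Qed.

(** For finite p the local integrals of |f| are controlled through
    |f| <= 1 + |f|^p, and for infinite p by the essential bound; all cubes of a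
    given radius have the same measure. *)
Lemma averaging_fun (p : \bar R) (f : 'rV[R]_n -> V) : (1 <= p)%E -> Lp_fun ip p f ->
  averaging (fun_functional ip f).
Proof.
move=> p1 [mf fp].
have -> : fun_functional ip f = pairing leb (fun x k => ip (f x) (e_ k)).
  by apply/funext => u; apply: eq_Rintegral => x _; exact: ip_crd.
have mN := measurable_ipnorm mf.
have mg (k : 'I_(\dim {:V})) : measurable_fun setT (fun x => ip (f x) (e_ k)).
  rewrite (_ : (fun x => _) = fun x => \sum_(l < \dim {:V}) ip (e_ k) (e_ l) * crd l (f x)).
    by apply: measurable_sum => l; apply: measurable_funM => //; exact: mf.
  by apply/funext => x; rewrite ip_sym ip_crd.
apply: averaging_pairing => // r.
pose N x := ipnorm ip (f x); have N0 x : 0 <= N x by exact: sqrtr_ge0.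
pose A := \sum_(k < \dim {:V}) ipnorm ip (e_ k).
have A0 : 0 <= A by apply: sumr_ge0 => k _; exact: sqrtr_ge0.
have mball y : measurable [set x : 'rV[R]_n | `|x - y| <= r].
  by apply: closed_measurable_rV; exact: closed_norm_le.
pose b := leb [set x : 'rV[R]_n | (`|x| <= r)%R].
have bfin : b \is a fin_num.
  rewrite ge0_fin_numE /b. exact: (@leb_norm_lty R n r). exact: measure_ge0.
suff [B B0 HB] : exists2 B : R, 0 <= B & forall y,
    (\int[leb]_(x in [set x : 'rV[R]_n | (`|x - y| <= r)%R]) (N x)%:E <= B%:E)%E.
  exists (A * B) => [|y]; first by rewrite mulr_ge0.
  apply: (@le_trans _ _ (\int[leb]_(x in [set x : 'rV[R]_n | (`|x - y| <= r)%R]) (A%:E * (N x)%:E))%E).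
    apply: ge0_le_integral => //.
    - by move=> x _; rewrite lee_fin total_ge0.
    - by apply: measurable_funTS; apply/measurable_EFinP; exact: measurable_total.
    - by apply: measurable_funTS; apply: measurable_funeM; apply/measurable_EFinP.
    move=> x _; rewrite -EFinM lee_fin mulrC mulr_sumr; apply: ler_sum => k _.
    exact: cauchy_schwarz.
  rewrite ge0_integralZl_EFin//; last first.
  - by apply: measurable_funTS; apply/measurable_EFinP.
  - by move=> x _; rewrite lee_fin.
  rewrite EFinM lee_pmul ?lee_fin//; apply: integral_ge0 => x _; by rewrite lee_fin.
case: p p1 fp => [q||//] p1 fp.
- have q0 : 0 < q by rewrite (lt_le_trans ltr01).
  have Ilty : (\int[leb]_x (N x `^ q)%:E < +oo)%E.
    have := poweR_Lnorm leb (EFin \o N) (lt0r_neq0 q0).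
    rewrite (eq_integral (fun x => (N x `^ q)%:E)); last first.
      by move=> x _; rewrite /= ger0_norm.
    by move=> <-; apply: poweR_lty.
  pose I := (\int[leb]_x (N x `^ q)%:E)%E.
  have Ifin : I \is a fin_num.
    by rewrite ge0_fin_numE//; apply: integral_ge0 => x _; rewrite lee_fin powR_ge0.
  have mNq : measurable_fun setT (fun x => N x `^ q).
    by apply: (measurableT_comp (measurable_powR q)); exact: mN.
  exists (fine b + fine I) => [|y].
    by apply: addr_ge0; apply: fine_ge0; rewrite ?measure_ge0//; apply: integral_ge0 => x _; rewrite lee_fin powR_ge0.
  apply: (@le_trans _ _ (\int[leb]_(x in [set x : 'rV[R]_n | (`|x - y| <= r)%R]) (1 + (N x `^ q)%:E))%E).
    apply: ge0_le_integral => //.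
    - by move=> x _; rewrite lee_fin.
    - by apply: measurable_funTS; apply/measurable_EFinP.
    - by apply: measurable_funTS; apply: emeasurable_funD => //; apply/measurable_EFinP.
    move=> x _; rewrite -EFinD lee_fin; have [N1|N1] := leP (N x) 1.
      by rewrite (le_trans N1)// lerDl powR_ge0.
    rewrite (@le_trans _ _ (N x `^ q))// ?lerDr//.
    by rewrite -[leLHS]powRr1// ler_powR// ltW.
  rewrite ge0_integralD//; last 2 first.
  - by move=> x _; rewrite lee_fin powR_ge0.
  - by apply: measurable_funTS; apply/measurable_EFinP.
  rewrite integral_cst// mul1e [X in (X + _)%E](leb_closed_ball y r : _ = b) EFinD !fineK// leeD//.
  apply: ge0_subset_integral => //.
  - by apply/measurable_EFinP.
  - by move=> x _; rewrite lee_fin powR_ge0.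
have [B B0 HB] : exists2 B : R, 0 <= B & {ae leb, forall x, (N x <= B)%R}.
  move: fp; rewrite unlock; case: ifPn => [_ fp|/negP]; last first.
    move=> h _; exists 0 => //; exists setT; split => //.
    by apply/eqP; rewrite eq_le measure_ge0 andbT leNgt; apply/negP.
  have := ess_sup_inf.ess_sup_ge leb (abse \o (EFin \o ipnorm ip \o f)).
  move: fp; case: (ess_sup_inf.ess_sup _ _) => [s _ H|//|_ H].
    exists `|s| => //; apply: filterS H => x /=; rewrite lee_fin (ger0_norm (N0 x)) => h.
    by rewrite (le_trans h)// ler_norm.
  by exists 0 => //; apply: filterS H.
exists (B * fine b) => [|y]; first by apply: mulr_ge0 => //; apply: fine_ge0; exact: measure_ge0.
apply: (@le_trans _ _ (\int[leb]_(x in [set x : 'rV[R]_n | (`|x - y| <= r)%R]) (cst B%:E x))%E).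
  apply: ae_ge0_le_integral => //.
  - by move=> x _; rewrite lee_fin.
  - by apply: measurable_funTS; apply/measurable_EFinP.
  - by apply: filterS HB => x /= h _; rewrite lee_fin.
by rewrite integral_cst// [X in (_ * X)%E](leb_closed_ball y r : _ = b) EFinM fineK.
Qed.

Lemma averaging_integration E : integration_functional ip E -> averaging E.
Proof.
move=> [[p [p1 [f fp ->]]]|[nu ->]]; first exact: averaging_fun p1 fp.
exact: averaging_measure.
Qed.

End averaging_functionals.

(** * The nonlocal operator as an average of the local one *)

Section first_order_operators.
Context (R : realType) (n : nat) (V W : vectType R) (B : 'I_n -> 'Hom(W, V)).
Implicit Types (psi : 'rV[R]_n -> W).

Definition entry (i : 'I_n) (k : 'I_(\dim {:V})) (l : 'I_(\dim {:W})) : R :=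
  crd k (B i (vbasis {:W})`_l).

Lemma crd_lfun i k w : crd k (B i w) = \sum_(l < \dim {:W}) entry i k l * crd l w.
Proof.
rewrite -{1}(crdK w) /from_crd linear_sum crd_sum.
by apply: eq_bigr => l _; rewrite linearZ crdZ mulrC.
Qed.

Lemma crd_first_order psi k : crd k \o first_order B psi = fun x =>
  \sum_(p : 'I_n * 'I_(\dim {:W})) entry p.1 k p.2 * pderiv p.1 (crd p.2 \o psi) x.
Proof.
apply/funext => x; rewrite /= /first_order crd_sum.
rewrite -(pair_bigA _ (fun i (l : 'I_(\dim {:W})) => entry i k l * pderiv i (crd l \o psi) x)) /=.
apply: eq_bigr => i _; rewrite crd_lfun.
by apply: eq_bigr => l _; rewrite /vpderiv from_crdK.
Qed.

Lemma smooth_lincomb (I : Type) (s : seq I) (c : I -> R) (F : I -> 'rV[R]_n -> R) :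
  (forall j, smooth (F j)) -> smooth (fun x => \sum_(j <- s) c j * F j x).
Proof.
move=> sF; apply: (@smooth_sum _ _ _ s (fun j x => c j * F j x)) => j.
exact: (smoothZ (c j) (sF j)).
Qed.

Lemma pderivs_lincomb (I : Type) (s : seq I) (c : I -> R) (F : I -> 'rV[R]_n -> R) t :
  (forall j, smooth (F j)) ->
  pderivs t (fun x => \sum_(j <- s) c j * F j x) =
  fun x => \sum_(j <- s) c j * pderivs t (F j) x.
Proof.
move=> sF; elim: s => [|j s IH].
  under eq_fun do rewrite big_nil.
  by rewrite pderivs_cst0; apply/funext => x; rewrite big_nil.
rewrite (_ : (fun x => _) = fun x => c j * F j x + \sum_(i <- s) c i * F i x); last first.
  by apply/funext => x; rewrite big_cons.
rewrite (pderivsD t (smoothZ (c j) (sF j)) (smooth_lincomb s c sF)).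
rewrite (pderivsZ t (c j) (sF j)) IH.
by apply/funext => x; rewrite big_cons.
Qed.

Lemma vtest_in_first_order r psi : vtest_in r psi -> vtest_in r (first_order B psi).
Proof.
move=> tpsi k; rewrite crd_first_order; split.
  apply: (smooth_lincomb _ (fun p : 'I_n * 'I_(\dim {:W}) => entry p.1 k p.2)) => p.
  by have [sp _] := tpsi p.2; exact: (smooth_pderiv p.1 sp).
move=> x rx; rewrite big1// => p _.
by have [_ ->] := test_in_pderiv p.1 (tpsi p.2); rewrite ?mulr0.
Qed.

Lemma test_first_order psi : test psi -> test (first_order B psi).
Proof. by move=> /test_vtest_in[r tpsi]; exact: vtest_in_test (vtest_in_first_order tpsi). Qed.

Lemma first_order_bound : exists2 A : R, 0 <= A & forall N psi (M : R), vsmooth psi -> 0 <= M ->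
  (forall l s x, (size s <= N.+1)%N -> `|pderivs s (crd l \o psi) x| <= M) ->
  forall k s x, (size s <= N)%N -> `|pderivs s (crd k \o first_order B psi) x| <= A * M.
Proof.
pose A k := \sum_(p : 'I_n * 'I_(\dim {:W})) `|entry p.1 k p.2|.
have A0 k : 0 <= A k by apply: sumr_ge0 => p _.
exists (\sum_k A k) => [|N psi M spsi M0 HM k s x sN]; first by apply: sumr_ge0 => k _.
apply: (@le_trans _ _ (A k * M)); last first.
  by apply: ler_wpM2r => //; rewrite (bigD1 k)//= lerDl; apply: sumr_ge0 => j _.
rewrite crd_first_order.
rewrite (pderivs_lincomb _ (fun p : 'I_n * 'I_(\dim {:W}) => entry p.1 k p.2) s
  (fun p => smooth_pderiv p.1 (spsi p.2))).
rewrite (le_trans (ler_norm_sum _ _ _))// /A mulr_suml; apply: ler_sum => p _.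
rewrite normrM; apply: ler_wpM2l => //.
have := HM p.2 (rcons s p.1) x; rewrite size_rcons pderivs_rcons; exact.
Qed.

Lemma first_order_shift psi y :
  first_order B (fun x => psi (x - y)) = fun x => first_order B psi (x - y).
Proof.
apply/funext => x; apply: crd_inj => k.
have E f := congr1 (fun g => g x) (crd_first_order f k).
have E' f := congr1 (fun g => g (x - y)) (crd_first_order f k).
rewrite [LHS]E [RHS]E'; apply: eq_bigr => p _; congr (_ * _).
exact: (derive_shift_fun (crd p.2 \o psi)).
Qed.

Lemma first_order_lin (a : R) u v : vsmooth u -> vsmooth v ->
  first_order B (fun x => a *: u x + v x) = fun x => a *: first_order B u x + first_order B v x.
Proof.
move=> su sv; apply/funext => x; apply: crd_inj => k.
have E f := congr1 (fun g => g x) (crd_first_order f k).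
rewrite [LHS]E crdD crdZ [crd k (first_order B u x)]E [crd k (first_order B v x)]E.
rewrite mulr_sumr -big_split; apply: eq_bigr => p _ /=.
rewrite (_ : crd p.2 \o _ = fun x => a * (crd p.2 \o u) x + (crd p.2 \o v) x); last first.
  by apply/funext => z /=; rewrite crdD crdZ.
have := congr1 (fun g => g x) (pderivsD [:: p.1] (smoothZ a (su p.2)) (sv p.2)) => /= ->.
have := congr1 (fun g => g x) (pderivsZ [:: p.1] a (su p.2)) => /= ->.
by rewrite mulrDr mulrCA.
Qed.

End first_order_operators.

Section mu_rho_kernel.
Context (R : realType) (m : nat) (rhat : R -> R).
Local Notation n := m.+1.
Local Notation leb := (leb R n).
Context (mrho : measurable_fun setT (fun x : 'rV[R]_n => rhat (enorm x))).
Context (rho0 : forall x : 'rV[R]_n, 0 <= rhat (enorm x)).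

(** Made even, rhat becomes measurable on the whole line: the hypotheses on
    rhat (enorm x) leave its values at negative reals arbitrary. *)
Definition profile (r : R) := rhat `|r|.

Lemma enorm_axis (r : R) : enorm (r *: delta_mx 0 ord0 : 'rV[R]_n) = `|r|.
Proof.
rewrite /enorm (bigD1 ord0)//= big1 ?addr0 => [|i i0].
  by rewrite !mxE !eqxx mulr1 sqrtr_sqr.
by rewrite !mxE (negbTE i0) andbF mulr0 expr0n.
Qed.

Lemma measurable_profile : measurable_fun setT profile.
Proof.
rewrite (_ : profile = (fun x : 'rV[R]_n => rhat (enorm x)) \o
    (fun r : R => r *: delta_mx 0 ord0 : 'rV[R]_n)); last first.
  by apply/funext => r /=; rewrite enorm_axis.
apply: (measurableT_comp mrho); apply: measurable_fun_rV => i.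
rewrite (_ : (fun t => _) = fun t : R => t * (delta_mx 0 ord0 : 'rV[R]_n) 0 i); last first.
  by apply/funext => t; rewrite mxE.
by apply: measurable_funM.
Qed.

Lemma profile_ge0 r : 0 <= profile r.
Proof. by rewrite /profile -enorm_axis; exact: rho0. Qed.

Lemma profile_enorm (x : 'rV[R]_n) : profile (enorm x) = rhat (enorm x).
Proof. by rewrite /profile ger0_norm// enorm_ge0. Qed.

Lemma mu_rhoE (x : 'rV[R]_n) : mu_rho rhat x = kern profile x.
Proof.
rewrite /mu_rho /kern Rintegral_mkcond /Rintegral.
have -> : (\int[lebesgue_measure]_r
    ((fun r => n%:R * rhat r * \1_[set y : 'rV[R]_n | enorm y < r] x / r) \_ `]0, +oo[ r)%:E =
    n%:R%:E * tail profile (enorm x))%E.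
  rewrite /tail -ge0_integralZl_EFin//; last first.
  - apply/measurable_EFinP.
    exact: (measurableT_comp (measurable_tail_fun measurable_profile) (pair1_measurable (enorm x))).
  - by move=> r _; rewrite lee_fin; apply: tail_fun_ge0; exact: profile_ge0.
  apply: eq_integral => r _; rewrite -EFinM; congr EFin.
  rewrite patchE /tail_fun mem_setE in_itv /= andbT.
  case: (ltP 0 r) => r0 /=; last by rewrite mulr0.
  rewrite indicE; case: ifP => xr.
    by rewrite mem_set//= mulr1 /profile gtr0_norm// mulrA.
  by rewrite memNset ?mulr0 ?mul0r//= xr.
have : (0 <= tail profile (enorm x))%E by apply: tail_ge0; exact: profile_ge0.
(* Where the integral diverges, both sides are 0, as fine sends +oo to 0. *)
have npos : 0 < n%:R :> R by rewrite ltr0n.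
case: (tail profile (enorm x)) => [t _|_|]; last by rewrite leNgt ltNyr.
  by rewrite -EFinM.
by rewrite gt0_muley ?lte_fin// mulr0.
Qed.

End mu_rho_kernel.

Section truncation.
Context (R : realType) (n : nat).
Local Notation leb := (leb R n).

Lemma cvg_truncated_integral (Q : 'rV[R]_n -> R) :
  leb.-integrable setT (EFin \o Q) -> Q 0 = 0 ->
  (\int[leb]_(x in [set x | d <= enorm x]) Q x) @[d --> 0^'+] --> \int[leb]_x Q x.
Proof.
move=> iQ Q0; apply/cvg_at_rightP => d [d0 d_0].
pose D k := [set x : 'rV[R]_n | d k <= enorm x].
have mQ : measurable_fun setT (EFin \o Q) by exact: measurable_int iQ.
have mQD k : measurable_fun setT ((EFin \o Q) \_ (D k)).
  apply/(measurable_restrictT _ (measurable_enorm_ge (d k))).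
  exact: measurable_funTS.
have cQ x : ((EFin \o Q) \_ (D k)) x @[k --> \oo] --> (EFin \o Q) x.
  have [->|x0] := eqVneq x 0.
    apply: cvg_near_cst; near=> k.
    by rewrite patchE; case: ifP => //= _; rewrite Q0.
  have ex : 0 < enorm x.
    by rewrite lt_neqAle enorm_ge0 andbT eq_sym; apply: contra_neq x0; exact: enorm_eq0.
  apply: cvg_near_cst; near=> k; rewrite patchE mem_set//=.
  near: k; have /cvgrPdist_le /(_ _ ex) := d_0; apply: filterS => k.
  by rewrite sub0r normrN gtr0_norm.
have leQ x k : (`|((EFin \o Q) \_ (D k)) x| <= (abse \o (EFin \o Q)) x)%E.
  by rewrite patchE; case: ifP => //= _; rewrite normr0 lee_fin.
have [_ _ H] := @dominated_convergence _ _ _ leb setT measurableT _ _ (abse \o (EFin \o Q))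
  mQD mQ (aeW _ (fun x _ => cQ x)) (integrable_abse iQ) (aeW _ (fun x k _ => leQ x k)).
have fQ : (\int[leb]_x (EFin \o Q) x)%E \is a fin_num by exact: integrable_fin_num.
move: H; rewrite -(fineK fQ) => /fine_cvg.
apply: cvg_trans; apply: near_eq_cvg; apply: nearW => k /=.
by rewrite [in RHS]/Rintegral [in RHS]integral_mkcond.
Unshelve. all: by end_near. Qed.

End truncation.

Section nonlocal_operators.
Context (R : realType) (m : nat) (V W : vectType R).
Local Notation n := m.+1.
Local Notation leb := (leb R n).
Context (B : 'I_n -> 'Hom(W, V)) (rhat : R -> R).
Context (mrho : measurable_fun setT (fun x : 'rV[R]_n => rhat (enorm x))).
Context (rho0 : forall x : 'rV[R]_n, 0 <= rhat (enorm x)).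
Context (irho : leb.-integrable setT (fun x : 'rV[R]_n => (rhat (enorm x))%:E)).
Local Notation h := (profile rhat).

Let mh : measurable_fun setT h := measurable_profile mrho.
Let h0 : forall r, 0 <= h r := profile_ge0 rho0.

Lemma integrable_profile : leb.-integrable setT (EFin \o (h \o @enorm R n)).
Proof.
move: irho; congr (leb.-integrable _ _); apply/funext => x /=.
by rewrite profile_enorm.
Qed.

Let ih := integrable_profile.

Lemma weight_mu_rho : weight (mu_rho rhat : 'rV[R]_n -> R).
Proof.
have -> : (mu_rho rhat : 'rV[R]_n -> R) = kern h by apply/funext => x; exact: mu_rhoE.
split; first exact: integrable_kern.
by move=> y; exact: kern_ge0.
Qed.

Lemma nonlocal_integrand (psi : 'rV[R]_n -> W) k (x xi : 'rV[R]_n) :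
  crd k (rhat (enorm xi) *: symbol B ((enorm xi)^-1 *: xi)
     ((enorm xi)^-1 *: (psi (x + xi) - psi x))) =
  \sum_(p : 'I_n * 'I_(\dim {:W})) entry B p.1 k p.2 *
     (radial_density h p.1 xi * (crd p.2 (psi (x + xi)) - crd p.2 (psi x))).
Proof.
rewrite -(pair_bigA _ (fun i (l : 'I_(\dim {:W})) => entry B i k l *
  (radial_density h i xi * (crd l (psi (x + xi)) - crd l (psi x))))) /=.
rewrite crdZ /symbol sum_lfunE crd_sum mulr_sumr; apply: eq_bigr => i _.
rewrite lfunE /= crdZ crd_lfun !mulr_sumr; apply: eq_bigr => l _.
rewrite /radial_density profile_enorm mxE crdZ crdB -exprVn; ring.
Qed.

Lemma integral_kern_reverse (f : 'rV[R]_n -> R) x : measurable_fun setT f ->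
  \int[leb]_y (kern h y * f (x - y)) = \int[leb]_y (kern h y * f (y + x)).
Proof.
move=> mf.
have mg : measurable_fun setT (fun y => kern h y * f (y + x)).
  apply: measurable_funM; first exact: measurable_kern.
  exact: (measurableT_comp mf (measurable_shift_rV x)).
have E y : mirror xpredT y = - y :> 'rV[R]_n by apply/rowP => i; rewrite !mxE.
rewrite -(Rintegral_preserving (measurable_mirror xpredT) (fun A => leb_mirror xpredT (A := A)) mg).
by apply: eq_Rintegral => y _; rewrite E /kern enormN addrC.
Qed.

(** In coordinates the truncated integrals converge, the increments of psi being
    dominated by its Lipschitz constant. The kernel identity for the translate of
    psi by x turns the limit into an average of partial derivatives at x + y, and the
    kernel is even, so this is the convolution. *)
Lemma nonlocal_conv r (psi : 'rV[R]_n -> W) : vtest_in r psi ->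
  nonlocal B rhat psi = Defs.conv (mu_rho rhat) (first_order B psi).
Proof.
move=> tpsi; apply/funext => x; apply: crd_inj => k.
rewrite crd_convE.
rewrite /nonlocal from_crdK.
pose I := ('I_n * 'I_(\dim {:W}))%type.
pose q (p : I) xi := radial_density h p.1 xi * (crd p.2 (psi (x + xi)) - crd p.2 (psi x)).
pose Q xi := \sum_(p : I) entry B p.1 k p.2 * q p xi.
have [L L0 HL] := vtest_in_lipschitz 0 tpsi.
have [M M0 HM] := vtest_in_bounded 1 tpsi.
have lip (l : 'I_(\dim {:W})) y : `|crd l (psi (y + x)) - crd l (psi x)| <= L * enorm y.
  apply: (le_trans (HL l [::] (leqnn _) x (y + x))).
  by rewrite addrK; apply: ler_wpM2l => //; exact: norm_le_enorm.
have cl (l : 'I_(\dim {:W})) : continuous (crd l \o psi).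
  by have [sl _] := tpsi l; exact: smooth_continuous sl.
have iq p : leb.-integrable setT (EFin \o q p).
  have H := @integrable_radial_increment R m h ih L p.1
    (fun y => crd p.2 (psi (y + x)) - crd p.2 (psi x)) L0 _ (lip p.2).
  rewrite (_ : q p = fun y => radial_density h p.1 y * (crd p.2 (psi (y + x)) - crd p.2 (psi x))).
    apply: H; apply: measurable_funB => //.
    exact: (measurableT_comp (continuous_measurable_rV (cl p.2)) (measurable_shift_rV x)).
  by apply/funext => y; rewrite /q (addrC x y).
have icq p : leb.-integrable setT (EFin \o (fun y => entry B p.1 k p.2 * q p y)).
  exact: (integrableZl measurableT (entry B p.1 k p.2) (iq p)).
have iQ : leb.-integrable setT (EFin \o Q).
  have := @integrable_sum _ _ _ leb setT measurableT _ (index_enum _) xpredT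
    (fun p y => (entry B p.1 k p.2 * q p y)%:E) (fun p _ => icq p).
  by congr (leb.-integrable _ _); apply/funext => y /=; rewrite sumEFin.
have Q0 : Q 0 = 0.
  by rewrite /Q big1// => p _; rewrite /q addr0 subrr !mulr0.
have -> : (fun delta : R => crd k (n%:R *: vint [set xi : 'rV[R]_n | delta <= enorm xi]
       (fun xi => rhat (enorm xi) *: symbol B ((enorm xi)^-1 *: xi)
          ((enorm xi)^-1 *: (psi (x + xi) - psi x))))) =
    fun delta => n%:R * \int[leb]_(xi in [set xi | delta <= enorm xi]) Q xi.
  apply/funext => delta; rewrite crdZ /vint from_crdK; congr (_ * _).
  by apply: eq_Rintegral => xi _; exact: nonlocal_integrand.
have cQ := cvg_truncated_integral iQ Q0.
have cst : (n%:R : R) @[_ --> (0 : R)^'+] --> (n%:R : R) by exact: cvg_cst.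
rewrite (cvg_lim (@norm_hausdorff _ _) (cvgM cst cQ)).
rewrite /Q Rintegral_sum// mulr_sumr.
have kE p : n%:R * \int[leb]_y q p y = \int[leb]_y (kern h y * pderiv p.1 (crd p.2 \o psi) (x - y)).
  have [sp _] := tpsi p.2.
  have cf : continuous (pderiv p.1 (crd p.2 \o psi)).
    exact: smooth_continuous (smooth_pderiv p.1 sp).
  rewrite integral_kern_reverse; last exact: continuous_measurable_rV.
  pose u (y : 'rV[R]_n) : R := (crd p.2 \o psi) (y + x); pose f (y : 'rV[R]_n) : R := pderiv p.1 (crd p.2 \o psi) (y + x).
  transitivity (n%:R * \int[leb]_y (radial_density h p.1 y * (u y - u 0))).
    by congr (_ * _); apply: eq_Rintegral => y _; rewrite /q /u /= (addrC x y) add0r.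
  symmetry; apply: (@kernel_identity R m h mh h0 ih p.1 u f M L).
  - exact: (@continuous_shift_fun _ _ (crd p.2 \o psi) x (cl p.2)).
  - exact: (@continuous_shift_fun _ _ (pderiv p.1 (crd p.2 \o psi)) x cf).
  - move=> y; apply: DeriveDef; last exact: derive_shift_fun.
    apply: (@derivable_shift _ _ (crd p.2 \o psi)).
    exact: (@smooth_derivable _ _ (crd p.2 \o psi) (y + x) p.1 sp).
  - by move=> y; exact: (HM p.2 [:: p.1] (y + x) (leqnn _)).
  - exact: L0.
  - by move=> y; rewrite /u /= add0r; exact: lip.
transitivity (\sum_(p : I) \int[leb]_y (entry B p.1 k p.2 *
    (kern h y * pderiv p.1 (crd p.2 \o psi) (x - y)))).
  apply: eq_bigr => p _; rewrite RintegralZl//.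
  rewrite mulrCA kE RintegralZl//.
  have := integrable_sconv x weight_mu_rho (test_in_pderiv p.1 (tpsi p.2)).
  by congr (leb.-integrable _ _); apply/funext => y /=; rewrite mu_rhoE.
rewrite -Rintegral_sum => [|p]; last first.
  have := integrableZl measurableT (entry B p.1 k p.2)
    (integrable_sconv x weight_mu_rho (test_in_pderiv p.1 (tpsi p.2))).
  by congr (leb.-integrable _ _); apply/funext => y /=; rewrite mu_rhoE.
apply: eq_Rintegral => y _; rewrite mu_rhoE// crd_first_order mulr_sumr.
by apply: eq_bigr => p _; rewrite mulrCA.
Qed.

End nonlocal_operators.

(** * Averages of translates of a distribution *)

Lemma continuous_local (R : realType) (U : normedModType R) (f : U -> R) :
  (forall y, exists2 g : U -> R, continuous g & forall z, `|z - y| <= 1 -> g z = f z) ->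
  continuous f.
Proof.
move=> H y; have [g cg gf] := H y.
have := cg y; rewrite /continuous_at (gf y) ?subrr ?normr0 ?ler01// => gy.
apply: cvg_trans gy; apply: near_eq_cvg; near=> z; apply: gf; rewrite distrC ltW//.
Unshelve. all: by end_near. Qed.

Section translates.
Context (R : realType) (n : nat) (V : vectType R).
Local Notation leb := (leb R n).
Implicit Types (mu : 'rV[R]_n -> R) (u phi : 'rV[R]_n -> V) (T : ('rV[R]_n -> V) -> R).
Implicit Types (Y : set 'rV[R]_n).

(** Continuity of T, uniform over the translations by elements of Y. *)
Definition translation_bounded Y T := forall r : R, exists (C : R) (N : nat), 0 <= C /\
  forall phi, vtest_in r phi -> forall M, 0 <= M ->
  (forall k s x, (size s <= N)%N -> `|pderivs s (crd k \o phi) x| <= M) ->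
  forall y, Y y -> `|T (fun x => phi (x - y))| <= C * M.

Definition average mu T phi : R := \int[leb]_y (mu y * T (fun x => phi (x - y))).

Lemma distribution_of_bound T :
  (forall (a : R) u v, test u -> test v -> T (fun x => a *: u x + v x) = a * T u + T v) ->
  (forall r : R, exists (C : R) (N : nat), 0 <= C /\ forall u, vtest_in r u ->
    forall M, 0 <= M -> (forall k s x, (size s <= N)%N -> `|pderivs s (crd k \o u) x| <= M) ->
    `|T u| <= C * M) ->
  schwartz_distribution T.
Proof.
move=> linT bT; split => // K cK; have [b [_ Kb]] := compact_bounded cK.
have [C [N [C0 HC]]] := bT (b + 1).
case: (posnP (\dim {:V})) => [V0|Vpos].
  (* Without coordinates the bounds on derivatives are void and M may be negative,
     which forces the constant 0. *)
  exists 0, 0%N => u _ _ M _.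
  have noI (k : 'I_(\dim {:V})) : False by case: k => k; rewrite V0.
  have -> : u = fun=> 0 by apply/funext => x; apply: crd_eq0 => k; case: (noI k).
  have t0 : test (fun _ : 'rV[R]_n => 0 : V) by exact: vtest_in_test (@vtest_in_cst0 R n V 0).
  have := linT 1 _ _ t0 t0; rewrite mul1r (_ : (fun x => _) = fun=> 0).
    move=> T00; have -> : T (fun=> 0) = 0 by apply: (@addrI _ (T (fun=> 0))); rewrite addr0.
    by rewrite normr0 mul0r.
  by apply/funext => x; rewrite scaler0 addr0.
exists C, N => u [su _] uK M HM; apply: HC => //.
- move=> k; split; first exact: su.
  move=> x bx /=; have [->|ux] := eqVneq (u x) 0; first exact: crd0.
  have /Kb : K x by apply: uK; apply: subset_closure.
  by move=> /(_ (b + 1)); rewrite ltrDl ltr01 => /(_ isT) /=; rewrite leNgt bx.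
- exact: le_trans (normr_ge0 _) (HM (Ordinal Vpos) [::] 0 (leq0n _)).
Qed.

Lemma test_in_plateau (a : R) : 0 < a -> test_in (2 * a) (plateau (0 : 'rV[R]_n) a).
Proof.
move=> a0; split; first exact: smooth_plateau.
by move=> x ax; rewrite plateau0// subr0 ltW.
Qed.

Lemma cutoff_test_in (K : set 'rV[R]_n) chi : cutoff K chi -> exists rho, test_in rho chi.
Proof.
move=> [schi cchi _]; have [b [_ bchi]] := compact_bounded cchi.
exists (b + 1); split => // x bx; have [//|chix] := eqVneq (chi x) 0.
have : `|x| <= b + 1.
  by apply: bchi; [rewrite ltrDl|apply: subset_closure].
by rewrite leNgt bx.
Qed.

Context (T : ('rV[R]_n -> V) -> R) (dT : schwartz_distribution T).

(** The difference of the two arguments vanishes where chi = 1, a neighbourhood of the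
    support of T. *)
Lemma dist_cutoff chi u : cutoff (dsupp T) chi -> test u ->
  T (fun x => chi x *: u x) = T u.
Proof.
move=> [schi _ [U [oU TU chiU]]] tu; apply/esym/eqP.
have tchi := test_mul schi tu.
rewrite -subr_eq0 -(distB dT tu tchi); apply/eqP.
apply: (dist_off_dsupp dT).
  have := test_lin (-1) tchi tu; congr test.
  by apply/funext => x; rewrite scaleN1r addrC.
move=> x sx /TU Ux; have [z [/= uz Uz]] := sx U (open_nbhs_nbhs (conj oU Ux)).
by move: uz; rewrite chiU// scale1r subrr eqxx.
Qed.

Definition local_radius (r b : R) := Num.max (r + b) 1.

Lemma local_radius_gt0 r b : 0 < local_radius r b.
Proof. by rewrite lt_max ltr01 orbT. Qed.

(** As long as translations stay bounded, T acts as a distribution of compact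
    support. *)
Lemma dist_local r b phi y : vtest_in r phi -> `|y| <= b ->
  T (fun x => phi (x - y)) = cutoff_dist T (plateau 0 (local_radius r b)) (fun x => phi (x - y)).
Proof.
move=> tphi yb; congr T; apply/funext => x.
have [xa|ax] := leP `|x| (local_radius r b).
  by rewrite plateau1 ?scale1r ?subr0// local_radius_gt0.
rewrite (vtest_in0 tphi) ?scaler0//.
apply: lt_le_trans (lerB_dist x y); rewrite ltrBrDr.
apply: le_lt_trans ax; rewrite le_max; apply/orP; left; exact: lerD.
Qed.

Lemma translate_continuous r phi : vtest_in r phi ->
  continuous (fun y : 'rV[R]_n => T (fun x => phi (x - y))).
Proof.
move=> tphi; apply: continuous_local => y; pose b := `|y| + 1.
pose chi := plateau (0 : 'rV[R]_n) (local_radius r b).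
have tchi := test_in_plateau (local_radius_gt0 r b).
exists (cutoff_shift T chi phi); first exact: (cutoff_shift_continuous dT tchi tphi).
move=> z zy; rewrite (@dist_local r b)//.
by rewrite -[z](subrK y) (le_trans (ler_normD _ _))// addrC lerD2l.
Qed.

Lemma translation_bounded_cut Y : (forall r, exists rho chi, test_in rho chi /\
    forall phi y, vtest_in r phi -> Y y ->
      T (fun x => phi (x - y)) = cutoff_dist T chi (fun x => phi (x - y))) ->
  translation_bounded Y T.
Proof.
move=> H r; have [rho [chi [tchi E]]] := H r.
have [C [N [C0 HC]]] := cutoff_dist_bound dT tchi.
exists C, N; split => // phi tphi M M0 HM y Yy; rewrite E//; apply: HC => //.
  exact: vsmooth_shift tphi.
move=> k s x sN; have := HM k s (x - y) sN.
by rewrite [X in _ -> `|X| <= _](congr1 (fun f => f x) (pderivs_shift s (crd k \o phi) (- y))).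
Qed.

Lemma translation_bounded_ball b : translation_bounded [set y | `|y| <= b] T.
Proof.
apply: translation_bounded_cut => r.
exists (2 * local_radius r b), (plateau 0 (local_radius r b)); split.
  exact: test_in_plateau (local_radius_gt0 r b).
by move=> phi y tphi yb; exact: dist_local.
Qed.

Lemma translation_bounded_cutoff chi : cutoff (dsupp T) chi -> translation_bounded setT T.
Proof.
move=> cchi; apply: translation_bounded_cut => r.
have [rho tchi] := cutoff_test_in cchi; exists rho, chi; split => // phi y tphi _.
by rewrite /cutoff_dist (dist_cutoff cchi)//; exact: vtest_in_test (vtest_in_shift y tphi).
Qed.

Lemma translation_bounded_represents E : averaging E -> represents E T ->
  translation_bounded setT T.
Proof.
move=> [_ bE] ET r; have [C C0 HC] := bE r; exists C, 0%N; split => // phi tphi M M0 HM y _.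
rewrite ET; last exact: vtest_in_test (vtest_in_shift y tphi).
by apply: HC => // k x; exact: (HM k [::] x).
Qed.

Lemma cutoff_conv chi mu r phi : cutoff (dsupp T) chi -> weight mu -> vtest_in r phi ->
  T (fun x => chi x *: Defs.conv mu phi x) = average mu T phi.
Proof.
move=> cchi wmu tphi; have [rho tchi] := cutoff_test_in cchi.
rewrite -[LHS]/(cutoff_dist T chi (Defs.conv mu phi)) (cutoff_dist_conv dT tchi tphi wmu).
apply: eq_Rintegral => y _; congr (_ * _); rewrite /cutoff_shift /cutoff_dist (dist_cutoff cchi)//.
exact: vtest_in_test (vtest_in_shift y tphi).
Qed.

Lemma bounded_conv mu b r phi : weight mu -> (forall y, b < `|y| -> mu y = 0) ->
  vtest_in r phi -> T (Defs.conv mu phi) = average mu T phi.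
Proof.
move=> wmu mu0 tphi; pose a := local_radius r b; have a0 := local_radius_gt0 r b.
have conv0 x : a < `|x| -> Defs.conv mu phi x = 0.
  move=> ax; apply: crd_eq0 => k.
  rewrite crd_convE.
  apply: Rintegral_eq0 => y; have [yb|/mu0 ->] := leP `|y| b; last by rewrite mul0r.
  rewrite /= (vtest_in0 tphi) ?crd0 ?mulr0//.
  apply: lt_le_trans (lerB_dist x y); rewrite ltrBrDr.
  apply: le_lt_trans ax; rewrite le_max; apply/orP; left; exact: lerD.
have -> : Defs.conv mu phi = fun x => plateau 0 a x *: Defs.conv mu phi x.
  apply/funext => x; have [xa|/conv0 ->] := leP `|x| a; last by rewrite scaler0.
  by rewrite plateau1 ?scale1r ?subr0.
rewrite -[LHS]/(cutoff_dist T (plateau 0 a) (Defs.conv mu phi)).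
rewrite (cutoff_dist_conv dT (test_in_plateau a0) tphi wmu).
apply: eq_Rintegral => y _; have [yb|/mu0 ->] := leP `|y| b; last by rewrite !mul0r.
by rewrite (dist_local tphi yb).
Qed.

Lemma represents_conv E mu r phi : averaging E -> represents E T -> weight mu ->
  vtest_in r phi -> E (Defs.conv mu phi) = average mu T phi.
Proof.
move=> [aE _] ET wmu tphi; have [_ ->] := aE mu phi r wmu tphi.
apply: eq_Rintegral => y _; rewrite ET//.
exact: vtest_in_test (vtest_in_shift y tphi).
Qed.

End translates.

Section averages.
Context (R : realType) (n : nat) (V : vectType R) (ip : {dot V for (@idfun R)}).
Local Notation leb := (leb R n).
Context (T : ('rV[R]_n -> V) -> R) (dT : schwartz_distribution T).
Context (Y : set 'rV[R]_n) (bT : translation_bounded Y T).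

(** The supremum includes u = 0. *)
Lemma extended_norm_ge0 (p : \bar R) : (1 <= p)%E -> (0 <= dnorm ip p T)%E.
Proof.
move=> p1; have t0 : test (fun _ : 'rV[R]_n => 0 : V) by exact: vtest_in_test (@vtest_in_cst0 R n V 0).
apply: ereal_sup_ubound; exists (fun=> 0); last by rewrite (dist0 dT).
split => //; have q1 := hoelder_conj_ge1 p1.
rewrite (_ : _ \o _ = cst 0%E); last first.
  by apply/funext => x /=; rewrite /ipnorm linear0r sqrtr0.
by rewrite Lnorm0// gt_eqF// (lt_le_trans _ q1).
Qed.

Lemma dnorm_translate (p : \bar R) (d : R) u y : (1 <= p)%E -> dnorm ip p T = d%:E ->
  test u -> ('N[leb]_(hoelder_conjugate p)[EFin \o ipnorm ip \o u] <= 1)%E ->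
  T (fun x => u (x - y)) <= d.
Proof.
move=> p1 Td tu u1; rewrite -lee_fin -Td.
apply: ereal_sup_ubound; exists (fun x => u (x - y)) => //; split; first exact: test_shift.
have [r tr] := test_vtest_in tu.
have mu' : measurable_fun setT (ipnorm ip \o u).
  apply: measurable_ipnorm => k; have [sk _] := tr k.
  by apply: continuous_measurable_rV; exact: smooth_continuous sk.
have q0 : (0 <= hoelder_conjugate p)%E by rewrite (le_trans _ (hoelder_conj_ge1 p1)).
have mE : measurable_fun setT (EFin \o ipnorm ip \o u) by exact/measurable_EFinP.
by have := Lnorm_preserving (measurable_shift_rV (- y)) (fun A => leb_shift (- y) (A := A)) q0 mE => ->.
Qed.

Context (mu : 'rV[R]_n -> R) (wmu : weight mu) (mass : \int[leb]_y mu y = 1).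
Context (muY : forall y, ~ Y y -> mu y = 0).

Lemma integrable_average r phi : vtest_in r phi ->
  leb.-integrable setT (EFin \o (fun y => mu y * T (fun x => phi (x - y)))).
Proof.
move=> tphi; have [imu mu0] := wmu; have [C [N [C0 HC]]] := bT r.
have [M M0 HM] := vtest_in_bounded N tphi.
have mG := continuous_measurable_rV (translate_continuous dT tphi).
have mmu : measurable_fun setT mu by apply/measurable_EFinP; exact: measurable_int imu.
apply: (le_integrable measurableT _ _ (integrableZl measurableT (C * M) imu)).
  by apply/measurable_EFinP; exact: measurable_funM.
move=> y _ /=; rewrite lee_fin (ger0_norm (mulr_ge0 (mulr_ge0 C0 M0) (mu0 y))) normrM (ger0_norm (mu0 y)).
have [Yy|/muY ->] := pselect (Y y); last by rewrite mul0r mulr0.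
by rewrite mulrC ler_wpM2r//; apply: HC.
Qed.

Lemma average_le r phi (B : R) : vtest_in r phi ->
  (forall y, Y y -> `|T (fun x => phi (x - y))| <= B) -> `|average mu T phi| <= B.
Proof.
move=> tphi HB; have [imu mu0] := wmu; have i := integrable_average tphi.
rewrite -[B]mulr1 -mass -RintegralZl//.
apply: (le_trans (le_normr_Rintegral measurableT i)).
apply: le_Rintegral => //; [exact: (integrable_abse i)|exact: (integrableZl measurableT B imu)|].
move=> y _; rewrite normrM (ger0_norm (mu0 y)) mulrC.
have [Yy|/muY ->] := pselect (Y y); last by rewrite !mulr0.
by rewrite ler_wpM2r//; exact: HB.
Qed.

Lemma average_distribution S : (forall u, test u -> S u = average mu T u) ->
  schwartz_distribution S.
Proof.
move=> ST; apply: distribution_of_bound => [a u v tu tv|r].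
  rewrite !ST//; last exact: test_lin.
  have [r tr] := test_vtest_in tu; have [s ts] := test_vtest_in tv.
  have iu := integrable_average tr; have iv := integrable_average ts.
  rewrite /average -RintegralZl// -RintegralD//; last exact: (integrableZl measurableT a iu).
  apply: eq_Rintegral => y _; rewrite mulrCA -mulrDr; congr (_ * _).
  by rewrite -(dist_lin a dT)//; exact: test_shift.
have [C [N [C0 HC]]] := bT r; exists C, N; split => // u tu M M0 HM.
rewrite ST; last exact: vtest_in_test tu.
by apply: (average_le tu) => y Yy; exact: HC.
Qed.

(** T u(. - y) is at most the norm of T for every y, since translations preserve the
    dual norm of u, and an average of such values is no larger. *)
Lemma dnorm_average (p : \bar R) S : (1 <= p)%E -> (forall u, test u -> S u = average mu T u) ->
  (dnorm ip p S <= dnorm ip p T)%E.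
Proof.
move=> p1 ST; have := extended_norm_ge0 p1; have dl := @dnorm_translate p.
case: (dnorm ip p T) dl => [d|_ _|//]; last by rewrite leey.
move=> dl d0; apply: ge_ereal_sup => _ [u [tu u1] <-]; rewrite lee_fin ST//.
have [r tr] := test_vtest_in tu; have [imu mu0] := wmu.
rewrite -[d]mulr1 -mass -RintegralZl//.
apply: le_Rintegral => //; [exact: integrable_average tr|exact: (integrableZl measurableT d imu)|].
by move=> y _; rewrite mulrC ler_wpM2r//; exact: dl.
Qed.

End averages.

Section approximation_of_identity.
Context (R : realType) (n : nat) (V : vectType R).
Local Notation leb := (leb R n).
Context (T : ('rV[R]_n -> V) -> R) (dT : schwartz_distribution T).
Context (Y : set 'rV[R]_n) (bT : translation_bounded Y T) (Y0 : Y 0).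

(** Near 0 the average is controlled by continuity of y |-> T phi(. - y), elsewhere by
    its bound on Y. The constants d and K are chosen before mu. *)
Lemma average_close r phi (e : R) : vtest_in r phi -> 0 < e ->
  exists d K : R, [/\ 0 < d, 0 <= K & forall mu, weight mu -> \int[leb]_y mu y = 1 ->
    (forall y, ~ Y y -> mu y = 0) ->
    `|average mu T phi - T phi| <=
      e + K * \int[leb]_(y in [set y : 'rV[R]_n | d <= enorm y]) mu y].
Proof.
move=> tphi e0; pose G (y : 'rV[R]_n) : R := T (fun x => phi (x - y)).
have cG : continuous G := translate_continuous dT tphi.
have G0 : G 0 = T phi by congr T; apply/funext => x; rewrite subr0.
have /cvgrPdist_le /(_ e e0) /nbhs_normP[d /= d0 Gd] := cG 0.
have [C [N [C0 HC]]] := bT r; have [M M0 HM] := vtest_in_bounded N tphi.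
have HG y : Y y -> `|G y| <= C * M by exact: HC.
have K0 : 0 <= C * M + C * M by rewrite addr_ge0 ?mulr_ge0.
exists d, (C * M + C * M); split => // mu wmu mass muY; have [imu mu0] := wmu.
set K := C * M + C * M in K0 *; pose D := [set y : 'rV[R]_n | d <= enorm y].
have mD : measurable D by exact: measurable_enorm_ge.
have [iD muD0] := weight_restrict wmu mD.
have iG := integrable_average dT bT wmu muY tphi.
have iG0 : leb.-integrable setT (EFin \o (fun y => mu y * G 0)).
  have := integrableZl measurableT (G 0) imu.
  by congr (leb.-integrable _ _); apply/funext => y /=; rewrite mulrC.
have ie : leb.-integrable setT (EFin \o (fun y => e * mu y)) := integrableZl measurableT e imu.
have iK : leb.-integrable setT (EFin \o (fun y => K * (mu \_ D) y)) := integrableZl measurableT K iD.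
have -> : average mu T phi - T phi = \int[leb]_y (mu y * G y - mu y * G 0).
  by rewrite RintegralB// RintegralZr// mass mul1r G0.
have -> : e + K * \int[leb]_(y in D) mu y = \int[leb]_y (e * mu y + K * (mu \_ D) y).
  by rewrite RintegralD// !RintegralZl// mass mulr1 -Rintegral_mkcond.
have i := integrableB measurableT iG iG0.
apply: (le_trans (le_normr_Rintegral measurableT i)).
apply: le_Rintegral => //; [exact: (integrable_abse i)|exact: (integrableD measurableT ie iK)|].
move=> y _; rewrite -mulrBr normrM (ger0_norm (mu0 y)) patchE.
have [Yy|/muY ->] := pselect (Y y); last by rewrite mul0r mulr0 add0r; case: ifP; rewrite ?mulr0.
case: ifPn => [_|/negP Dy].
  apply: ler_wpDl; first by rewrite mulr_ge0// ltW.
  rewrite mulrC ler_wpM2r// (le_trans (ler_normB _ _))// lerD//; exact: HG.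
rewrite mulr0 addr0 mulrC ler_wpM2r// distrC; apply: Gd => /=.
rewrite sub0r normrN (le_lt_trans (norm_le_enorm y))// ltNge; apply/negP => dy.
by apply: Dy; rewrite inE.
Qed.

End approximation_of_identity.

(** * The limit of the nonlocal operators *)

Section averaged_operator.
Context (R : realType) (m : nat) (V W : vectType R).
Local Notation n := m.+1.
Local Notation leb := (leb R n).
Context (ipV : {dot V for (@idfun R)}) (ipW : {dot W for (@idfun R)}).
Context (A : 'I_n -> 'Hom(V, W)) (T : ('rV[R]_n -> V) -> R) (dT : schwartz_distribution T).
Local Notation B := (formal_adjoint ipV ipW A).
Local Notation AT := (distr_op ipV ipW A T).

Lemma distr_op_shift psi (y : 'rV[R]_n) :
  AT (fun x => psi (x - y)) = T (fun x => first_order B psi (x - y)).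
Proof. by rewrite /distr_op first_order_shift. Qed.

Lemma average_distr_op mu psi : average mu AT psi = average mu T (first_order B psi).
Proof. by apply: eq_Rintegral => y _; rewrite distr_op_shift. Qed.

Lemma distribution_distr_op : schwartz_distribution AT.
Proof.
apply: distribution_of_bound => [a u v tu tv|r].
  rewrite /distr_op (first_order_lin B a tu.1 tv.1).
  by apply: (dist_lin a dT); exact: test_first_order.
have [C [N [C0 HC]]] := dist_bound r dT; have [D D0 HD] := first_order_bound B.
exists (C * D), N.+1; split => [|psi tpsi M M0 HM]; first exact: mulr_ge0.
rewrite -mulrA; apply: (HC _ (vtest_in_first_order B tpsi)); last exact: mulr_ge0.
move=> k s x sN; apply: (HD N psi M) => // l.
by have [sl _] := tpsi l.
Qed.

Lemma translation_bounded_distr_op Y : translation_bounded Y T -> translation_bounded Y AT.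
Proof.
move=> bT r; have [C [N [C0 HC]]] := bT r; have [D D0 HD] := first_order_bound B.
exists (C * D), N.+1; split => [|psi tpsi M M0 HM y Yy]; first exact: mulr_ge0.
rewrite distr_op_shift -mulrA.
apply: (HC _ (vtest_in_first_order B tpsi)) => //; first exact: mulr_ge0.
move=> k s x sN; apply: (HD N psi M) => // l.
by have [sl _] := tpsi l.
Qed.

(** In all three cases A T pairs with every translate of a test function under one
    bound: by the cutoff for a compact support, by integration otherwise. *)
Lemma strongly_admissible_translation_bounded : strongly_admissible ipV ipW A T ->
  translation_bounded setT AT.
Proof.
case=> [cT|[E iE ET]|[E iE EAT]].
- have [chi cchi] := cutoff_exists cT.
  by apply: translation_bounded_distr_op; exact: (translation_bounded_cutoff dT cchi).
- apply: translation_bounded_distr_op.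
  exact: translation_bounded_represents (averaging_integration iE) ET.
- exact: translation_bounded_represents (averaging_integration iE) EAT.
Qed.

Lemma frakA_spec rhat : strongly_admissible ipV ipW A T \/ @radial_compact_support R n rhat ->
  is_frakA ipV ipW A rhat T (frakA ipV ipW A rhat T).
Proof.
move=> H; apply: (@xgetPex _ (fun=> 0) [set S | is_frakA ipV ipW A rhat T S]).
case: H => [[cT|[E iE ET]|[E iE EAT]]|crho].
- have [chi cchi] := cutoff_exists cT.
  exists (fun psi => T (fun x => chi x *: frakA_star ipV ipW A rhat psi x)).
  by apply: Or42; split => //; exists chi.
- by exists (fun psi => E (frakA_star ipV ipW A rhat psi)); apply: Or43; exists E.
- by exists (fun psi => E (Defs.conv (mu_rho rhat) psi)); apply: Or44; exists E.
- by exists (fun psi => T (frakA_star ipV ipW A rhat psi)); apply: Or41.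
Qed.

Context (rhat : R -> R).
Context (mrho : measurable_fun setT (fun x : 'rV[R]_n => rhat (enorm x))).
Context (rho0 : forall x : 'rV[R]_n, 0 <= rhat (enorm x)).
Context (irho : leb.-integrable setT (fun x : 'rV[R]_n => (rhat (enorm x))%:E)).

(** mu_rho at y only involves rhat at radii larger than |y|. *)
Lemma mu_rho_bounded_support (b : R) : (forall x : 'rV[R]_n, b < `|x| -> rhat (enorm x) = 0) ->
  forall y : 'rV[R]_n, b < `|y| -> mu_rho rhat y = 0.
Proof.
move=> rhob y yb; rewrite mu_rhoE// /kern /tail integral0_eq ?mulr0// => r _.
rewrite /tail_fun; case: ifP => // /andP[r0 yr]; congr EFin.
suff -> : profile rhat r = 0 by rewrite mul0r.
rewrite /profile -(@enorm_axis R m); apply: rhob.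
have -> : `|r *: delta_mx 0 ord0 : 'rV[R]_n| = r.
  apply/eqP; rewrite eq_le; apply/andP; split.
    by apply: (le_trans (norm_le_enorm _)); rewrite enorm_axis gtr0_norm.
  apply: le_trans (normr_coord_le _ ord0).
  by rewrite !mxE !eqxx mulr1 ler_norm.
exact: lt_trans (lt_le_trans yb (norm_le_enorm y)) yr.
Qed.

Lemma compact_support_radius : @radial_compact_support R n rhat ->
  exists b, forall x : 'rV[R]_n, b < `|x| -> rhat (enorm x) = 0.
Proof.
move=> [K cK K0]; have [b [_ Kb]] := compact_bounded cK.
exists (b + 1) => x bx; apply: K0 => Kx.
by have := Kb (b + 1); rewrite ltrDl ltr01 => /(_ isT x Kx) /=; rewrite leNgt bx.
Qed.

(** The choices left open by is_frakA do not matter: each prescription gives the average of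
    A T over translations with weight mu_rho. *)
Lemma frakA_average S : is_frakA ipV ipW A rhat T S ->
  forall psi, test psi -> S psi = average (mu_rho rhat) AT psi.
Proof.
have wmu := weight_mu_rho mrho rho0 irho.
have E psi (tpsi : test psi) :
    frakA_star ipV ipW A rhat psi = Defs.conv (mu_rho rhat) (first_order B psi).
  by have [r tr] := test_vtest_in tpsi; exact: (nonlocal_conv B mrho rho0 irho tr).
case=> [[crho ST]|[cT [chi cchi ST]]|[F [iF FT ST]]|[F [iF FT ST]]] psi tpsi;
    have [r tr] := test_vtest_in tpsi; have tB := vtest_in_first_order B tr;
    rewrite ST// ?E// ?average_distr_op.
- have [b rhob] := compact_support_radius crho.
  exact: (bounded_conv dT wmu (mu_rho_bounded_support rhob) tB).
- exact: (cutoff_conv dT cchi wmu tB).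
- exact: (represents_conv (averaging_integration iF) FT wmu tB).
- rewrite -average_distr_op.
  exact: (represents_conv (averaging_integration iF) FT wmu tr).
Qed.

Lemma mu_rho_mass : \int[leb]_y mu_rho rhat y = fine (\int[leb]_y (rhat (enorm y))%:E)%E.
Proof.
have mh := measurable_profile mrho; have h0 := profile_ge0 rho0.
have ih := integrable_profile irho.
rewrite /Rintegral; congr fine.
transitivity (\int[leb]_y (kern (profile rhat) y)%:E)%E.
  by apply: eq_integral => y _; rewrite mu_rhoE.
rewrite (integral_kern mh h0 ih); apply: eq_integral => y _.
by rewrite profile_enorm.
Qed.

Lemma mu_rho_concentration (d e : R) : 0 < d ->
  (\int[leb]_(x in [set x : 'rV[R]_n | (d <= enorm x)%R]) `|rhat (enorm x)|%:E <= e%:E)%E ->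
  \int[leb]_(y in [set y : 'rV[R]_n | d <= enorm y]) mu_rho rhat y <= e.
Proof.
have mh := measurable_profile mrho; have h0 := profile_ge0 rho0.
have ih := integrable_profile irho.
move=> d0 rhoe; have wmu := weight_mu_rho mrho rho0 irho; have [imu _] := wmu.
have mD := @measurable_enorm_ge R n d.
rewrite -lee_fin /Rintegral fineK; last first.
  by apply: integrable_fin_num => //; exact: (integrableS measurableT mD (@subsetT _ _) imu).
apply: le_trans rhoe.
rewrite (eq_integral (fun y => (kern (profile rhat) y)%:E)) => [|y _]; last by rewrite mu_rhoE.
apply: (le_trans (kern_concentration mh h0 ih d0)).
rewrite le_eqVlt; apply/orP; left; apply/eqP; apply: eq_integral => y _.
by rewrite profile_enorm ger0_norm.
Qed.

End averaged_operator.

Lemma extended_limit (R : realType) (F : set_system R) (FF : ProperFilter F) (D : \bar R)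
    (f : R -> \bar R) : (0 <= D)%E -> (\forall x \near F, (f x <= D)%E) ->
  (forall a : R, (a%:E < D)%E -> \forall x \near F, (a%:E < f x)%E) -> f x @[x --> F] --> D.
Proof.
case: D => [d| |//] D0 fD Df; last by apply/cvgeyPgt => a; apply: Df; rewrite ltry.
have f1 := Df (d - 1); rewrite lte_fin ltrBlDr ltrDl ltr01 in f1; have {}f1 := f1 isT.
have ffin : \forall x \near F, f x \is a fin_num.
  near=> x; have h1 : (f x <= d%:E)%E by near: x.
  have h2 : ((d - 1)%:E < f x)%E by near: x.
  by move: h1 h2; case: (f x).
apply/fine_cvgP; split => //; apply/cvgrPdist_le => e e0.
have fe := Df (d - e); rewrite lte_fin ltrBlDr ltrDl e0 in fe; have {}fe := fe isT.
near=> x; have h1 : (f x <= d%:E)%E by near: x.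
have h2 : ((d - e)%:E < f x)%E by near: x.
move: h1 h2; rewrite /=; case: (f x) => [t|//|//]; rewrite lee_fin lte_fin /= => h1 h2.
by rewrite ger0_norm ?subr_ge0// lerBlDr addrC -lerBlDr ltW.
Unshelve. all: by end_near. Qed.

Theorem corollary2p12 (R : realType) (n : nat) (n_gt0 : (0 < n)%N)
    (V W : vectType R)
    (ipV : {dot V for (@idfun R)}) (ipW : {dot W for (@idfun R)})
    (A : 'I_n -> 'Hom(V, W))
    (rhat : R -> R -> R)
    (rho_measurable : forall eps : R, 0 < eps ->
       measurable_fun setT (fun x : 'rV[R]_n => rhat eps (enorm x)))
    (rho_ge0 : forall eps : R, 0 < eps ->
       forall x : 'rV[R]_n, 0 <= rhat eps (enorm x))
    (rho_norm1 : forall eps : R, 0 < eps ->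
       (\int[leb R n]_x `|rhat eps (enorm x)|%:E = 1)%E)
    (rho_concentrates : forall delta : R, 0 < delta ->
       (\int[leb R n]_(x in [set x : 'rV[R]_n | (delta <= enorm x)%R])
          `|rhat eps (enorm x)|%:E)%E @[eps --> 0^'+] --> 0%E)
    (T : ('rV[R]_n -> V) -> R)
    (T_distribution : schwartz_distribution T)
    (T_admissible : strongly_admissible ipV ipW A T \/
       exists2 K : set 'rV[R]_n, compact K &
         forall eps : R, 0 < eps -> forall x, ~ K x -> rhat eps (enorm x) = 0) :
  ((forall eps : R, 0 < eps ->
      schwartz_distribution (frakA ipV ipW A (rhat eps) T)) /\
   schwartz_distribution (distr_op ipV ipW A T) /\
   dcvg (0^'+ : set_system R) (fun eps => frakA ipV ipW A (rhat eps) T)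
     (distr_op ipV ipW A T)) /\
  (forall p : \bar R, (1 <= p)%E ->
     exists2 l : \bar R, (0 <= l)%E &
       dnorm ipW p (frakA ipV ipW A (rhat eps) T) @[eps --> 0^'+] --> l).
Proof.
case: n n_gt0 A rho_measurable rho_ge0 rho_norm1 rho_concentrates T T_distribution
  T_admissible => [//|m] _ A mrho rho0 rho1 rhoc T dT aT.
set AT := distr_op ipV ipW A T.
have dAT : schwartz_distribution AT by exact: distribution_distr_op.
have irho eps : 0 < eps ->
    (leb R m.+1).-integrable setT (fun x : 'rV[R]_m.+1 => (rhat eps (enorm x))%:E).
  move=> e0; apply/integrableP; split; first by apply/measurable_EFinP; exact: mrho.
  by have := rho1 eps e0 => /= ->; exact: ltry.
pose mu eps : 'rV[R]_m.+1 -> R := mu_rho (rhat eps).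
have wmu eps (e0 : 0 < eps) : weight (mu eps) := weight_mu_rho (mrho _ e0) (rho0 _ e0) (irho _ e0).
have mass eps : 0 < eps -> \int[leb R m.+1]_y mu eps y = 1.
  move=> e0; rewrite (mu_rho_mass (mrho _ e0) (rho0 _ e0) (irho _ e0)).
  have := rho1 eps e0; rewrite (eq_integral (fun x => (rhat eps (enorm x))%:E)) => [->//|x _].
  by rewrite ger0_norm// rho0.
have spec eps : 0 < eps -> is_frakA ipV ipW A (rhat eps) T (frakA ipV ipW A (rhat eps) T).
  move=> e0; apply: frakA_spec; case: aT => [|[K cK K0]]; [by left|right].
  by exists K => // x; exact: K0.
have avg eps (e0 : 0 < eps) := frakA_average dT (mrho _ e0) (rho0 _ e0) (irho _ e0) (spec _ e0).
(* Y carries all the kernels: the whole space for a strongly admissible T, a cube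
   for a common compact support. *)
have [Y [bY Y0 muY]] : exists Y : set 'rV[R]_m.+1, [/\ translation_bounded Y AT, Y 0 &
    forall eps, 0 < eps -> forall y, ~ Y y -> mu eps y = 0].
  case: aT => [sT|[K cK K0]].
    exists setT; split => //; last by move=> eps _ y /(_ I).
    exact: strongly_admissible_translation_bounded.
  have [b [_ Kb]] := compact_bounded cK; pose b' := Num.max (b + 1) 0.
  exists [set y | `|y| <= b']; split; first exact: translation_bounded_ball.
    by rewrite /= normr0 le_max lexx orbT.
  move=> eps e0 y /= /negP; rewrite -ltNge => yb.
  apply: (mu_rho_bounded_support (mrho _ e0) (rho0 _ e0) (b := b')) => // x xb.
  apply: K0 => // Kx; have := Kb (b + 1); rewrite ltrDl ltr01 => /(_ isT x Kx) /=.
  by rewrite leNgt (le_lt_trans _ xb)// le_max lexx.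
have pos : \forall eps \near (0 : R)^'+, 0 < eps by exact: nbhs_right_gt.
have cvg : dcvg (0^'+ : set_system R) (fun eps => frakA ipV ipW A (rhat eps) T) AT.
  move=> psi tpsi; apply/cvgrPdist_le => e e0.
  have [r tr] := test_vtest_in tpsi; have e2 : 0 < e / 2 by rewrite divr_gt0.
  have [d [K [d0 K0 close]]] := average_close dAT bY Y0 tr e2.
  pose c := e / 2 / (K + 1); have K1 : 0 < K + 1 by rewrite ltr_wpDl.
  have c0 : 0 < c by rewrite divr_gt0.
  have small : \forall eps \near (0 : R)^'+,
      (\int[leb R m.+1]_(x in [set x : 'rV[R]_m.+1 | (d <= enorm x)%R])
          `|rhat eps (enorm x)|%:E < c%:E)%E.
    have /fine_cvgP[ffin /cvgrPdist_lt /(_ c c0) H] := rhoc d d0.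
    near=> eps; rewrite -[ltLHS]fineK; last by near: eps.
    rewrite lte_fin; apply: le_lt_trans (ler_norm _) _; rewrite -normrN -[X in `|X|]sub0r.
    by near: eps.
  near=> eps; have eps0 : 0 < eps by near: eps.
  rewrite distrC (avg _ eps0)//.
  apply: (le_trans (close _ (wmu _ eps0) (mass _ eps0) (muY _ eps0))).
  rewrite [leRHS]splitr lerD2l.
  apply: (@le_trans _ _ (K * c)).
    rewrite ler_wpM2l//; apply: (mu_rho_concentration (mrho _ eps0) (rho0 _ eps0) (irho _ eps0) d0).
    by apply: ltW; near: eps.
  rewrite /c mulrCA ler_piMr ?(ltW e2)// ler_pdivrMr// mul1r lerDl.
  exact: ler01.
split; first split.
- by move=> eps e0; apply: (average_distribution dAT bY (wmu _ e0) (mass _ e0) (muY _ e0)); exact: avg.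
- by split.
move=> p p1; exists (dnorm ipW p AT); first exact: (extended_norm_ge0 ipW dAT p1).
apply: extended_limit; first exact: (extended_norm_ge0 ipW dAT p1).
  near=> eps; have e0 : 0 < eps by near: eps.
  exact: (dnorm_average ipW dAT bY (wmu _ e0) (mass _ e0) (muY _ e0) p1 (avg _ e0)).
move=> a /ereal_sup_gt[_ [u [tu u1] <-]]; rewrite lte_fin => au.
have := cvg u tu => /cvgr_gt /(_ a au); apply: filterS => eps aS.
apply: lt_le_trans (_ : (frakA ipV ipW A (rhat eps) T u)%:E <= _)%E; first by rewrite lte_fin.
by apply: ereal_sup_ubound; exists u.
Unshelve. all: by end_near. Qed.
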